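(* Let $C$ be a commutative Noetherian ring of Krull dimension $\dim C=D<\infty$, let $n\ge 1$ and $A=C[x_1,\ldots,x_n]$, and let $r\ge \max(3,D+2)$. (Even case) Set $N=n(11r-7)+\left(nD+\tfrac{r(r-1)}{2}\right)\left(\tfrac{r(r-1)}{2}+\lceil\tfrac{r-1}{2}\rceil+8r-2\right)+10r-10$. Then for every $g\in O(2r,A)$ there exists $h\in EO(2r,A)^{\le N}$ such that $hg$ lies in the subgroup $$\begin{pmatrix}1&&\\&O(2r-2,A)&\\&&1\end{pmatrix}.$$ (Odd case) Set $N=n(12r-8)+\left(nD+\tfrac{r(r-1)}{2}\right)\left(\tfrac{r(r-1)}{2}+\lceil\tfrac{r-1}{2}\rceil+9r-2\right)+11r-9$. Then for every $g\in O(2r+1,A)$ there exists $h\in EO(2r+1,A)^{\le N}$ such that $hg$ lies in the subgroup $$\begin{pmatrix}1&&\\&O(2r-1,A)&\\&&1\end{pmatrix}.$$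
   Context: All rings are commutative with $1$. For a ring $R$: the even split orthogonal group $O(2r,R)$ is the group of $R$-linear automorphisms of $R^{2r}$ preserving the quadratic form $q(x)=\sum_{i=1}^r x_ix_{-i}$, where coordinates are indexed by the basis $e_1,\ldots,e_r,e_{-r},\ldots,e_{-1}$ in this order; elements are identified with their matrices in this basis. The odd split orthogonal group $O(2r+1,R)$ is the group of automorphisms of $R^{2r+1}$ with basis $e_1,\ldots,e_r,e_0,e_{-r},\ldots,e_{-1}$ (in this order) preserving $q(x)=x_0^2+\sum_{i=1}^r x_ix_{-i}$. Let $e$ be the identity matrix and $e_{i,j}$ the matrix units. Elementary orthogonal transvections are $T_{i,j}(\xi)=e+\xi e_{i,j}-\xi e_{-j,-i}$ for $\xi\in R$, $i,j\in\{\pm1,\ldots,\pm r\}$, $i\ne\pm j$ (in both cases), and in the odd case additionally $T_{i,0}(\xi)=e+2\xi e_{i,0}-\xi e_{0,-i}-\xi^2e_{i,-i}$ for $i\in\{\pm1,\ldots,\pm r\}$. $EO(m,R)^{\le N}$ denotes the set of elements of $O(m,R)$ expressible as a product of at most $N$ elementary orthogonal transvections. The displayed subgroup consists of block-diagonal matrices (with respect to the given ordering of the basis) with entry $1$ at positions $(1,1)$ and $(-1,-1)$ and an element of the smaller split orthogonal group (on the span of the remaining basis vectors, with the induced form) in the middle. *)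

(* Defs.v *)
From HB Require Import structures.
From mathcomp Require Import all_boot all_order all_algebra.
From mathcomp Require Import mpoly.
Set Implicit Arguments.
Unset Strict Implicit.
Unset Printing Implicit Defensive.
Import Order.TTheory GRing.Theory Num.Theory.
Local Open Scope ring_scope.

Section CommAlg.
Variable C : comNzRingType.

Definition is_ideal (I : C -> Prop) : Prop :=
  [/\ I 0, (forall x y, I x -> I y -> I (x + y)) & (forall a x, I x -> I (a * x))].

Definition noetherian : Prop :=
  forall I : nat -> C -> Prop,
    (forall k, is_ideal (I k)) ->
    (forall k x, I k x -> I k.+1 x) ->
    exists k0, forall k, (k0 <= k)%N -> forall x, I k x <-> I k0 x.

Definition is_prime_ideal (P : C -> Prop) : Prop :=
  [/\ is_ideal P, ~ P 1 & forall x y, P (x * y) -> P x \/ P y].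

Definition prime_chain (P : nat -> C -> Prop) (L : nat) : Prop :=
  (forall k, (k <= L)%N -> is_prime_ideal (P k)) /\
  (forall k, (k < L)%N ->
     (forall x, P k x -> P k.+1 x) /\ exists x, P k.+1 x /\ ~ P k x).

Definition krull_dim_eq (D : nat) : Prop :=
  (exists P, prime_chain P D) /\ (forall P L, prime_chain P L -> (L <= D)%N).
End CommAlg.

Section Orth.
Variable R : comNzRingType.

(* signed index of position a in dimension m, r = m./2:
   positions 0..r-1 -> 1..r ; (m odd) position r -> 0 ; remaining -> -r..-1 *)
Definition sidx (m : nat) (a : 'I_m) : int :=
  if (a < m./2)%N then (a.+1)%:Z
  else if odd m && (nat_of_ord a == m./2) then 0
  else (a%:Z - m%:Z).

Definition qform (m : nat) (x : 'cV[R]_m) : R :=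
  \sum_(a < m) \sum_(b < m)
     (if (0 < sidx a) && (sidx b == - sidx a) then x a 0 * x b 0 else 0)
  + \sum_(a < m) (if sidx a == 0 then x a 0 ^+ 2 else 0).

Definition is_orth (m : nat) (g : 'M[R]_m) : Prop :=
  (exists g' : 'M[R]_m, g *m g' = 1%:M /\ g' *m g = 1%:M) /\
  (forall x : 'cV[R]_m, qform (g *m x) = qform x).

Definition valid_sidx (m : nat) (i : int) : bool :=
  (i != 0) && (absz i <= m./2)%N.

Definition transv (m : nat) (i j : int) (xi : R) : 'M[R]_m :=
  \matrix_(a, b)
    ((a == b)%:R
     + xi * ((sidx a == i) && (sidx b == j))%:R
     - xi * ((sidx a == - j) && (sidx b == - i))%:R).

Definition transv0 (m : nat) (i : int) (xi : R) : 'M[R]_m :=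
  \matrix_(a, b)
    ((a == b)%:R
     + 2%:R * xi * ((sidx a == i) && (sidx b == 0))%:R
     - xi * ((sidx a == 0) && (sidx b == - i))%:R
     - xi ^+ 2 * ((sidx a == i) && (sidx b == - i))%:R).

Definition elem_transv (m : nat) (g : 'M[R]_m) : Prop :=
  (exists i j xi, [/\ valid_sidx m i, valid_sidx m j, i != j, i != - j
                    & g = transv m i j xi])
  \/ (odd m /\ exists i xi, valid_sidx m i /\ g = transv0 m i xi).

Definition EO_le (m N : nat) (h : 'M[R]_m) : Prop :=
  exists s : seq 'M[R]_m,
    [/\ (size s <= N)%N, (forall t, t \in s -> elem_transv t)
      & h = foldr (fun t acc => t *m acc) 1%:M s].

Lemma emb2_dim (k : nat) : (1 + (k + 1))%N = k.+2.
Proof. by rewrite addn1. Qed.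

Definition emb2 (k : nat) (h : 'M[R]_k) : 'M[R]_(k.+2) :=
  castmx (emb2_dim k, emb2_dim k)
    (block_mx (1%:M : 'M[R]_1) 0 0 (block_mx h 0 0 (1%:M : 'M[R]_1))).

Definition emb_mid (m : nat) : 'M[R]_(m.-2) -> 'M[R]_m :=
  match m return 'M[R]_(m.-2) -> 'M[R]_m with
  | k.+2 => fun h : 'M[R]_k => emb2 h
  | _ => fun _ => 0
  end.

Definition in_mid_subgroup (m : nat) (g : 'M[R]_m) : Prop :=
  exists h : 'M[R]_(m.-2), is_orth h /\ g = emb_mid h.
End Orth.

(* Main.v *)
Require Import Defs.
From HB Require Import structures.
From mathcomp Require Import all_boot all_order all_algebra.
From mathcomp Require Import mpoly.
From mathcomp Require Import zify ring.
From Stdlib Require Import Classical ClassicalEpsilon FunctionalExtensionality PropExtensionality.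
Set Implicit Arguments.
Unset Strict Implicit.
Unset Printing Implicit Defensive.
Import Order.TTheory GRing.Theory Num.Theory.
Local Open Scope ring_scope.

(* Let A = C[x_1, .., x_n] and let v be the first column of g; it is isotropic, and
   its coordinates with index <> 0 generate the unit ideal.  After a general position
   argument the ideal (v_2, .., v_r) has height >= r - 1 > dim C, so some element of it
   becomes monic in t after the substitution x_i -> t x_i + t^(N_i) - t, which is the
   identity at t = 1 and maps A to C at t = 0.  This turns v into a vector V(t) with
   V(1) = v and V(0) over C, and V_1 can be made monic in t.

   If b in A lies in the ideal (V_1, V_2) of A[t], then V(z) and V(z - b^K y) are related
   by boundedly many transvections, because V_3 can be changed by b^K and V_1, V_2 can
   be shifted along multiples of V_3 before and after this change.  As V_1 is monic, a
   few transvections over A[t] make V_1 and V_2 coprime modulo finitely many given primes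
   of A, so b can be taken outside these primes.  Since dim A <= D + n, after D + n + 1
   choices the elements b generate the unit ideal, and V(1) is moved to V(0).  Over C the
   general position argument alone reduces V(0) to e_1.  All variables are eliminated at
   once, so the number of steps is linear in n. *)

(** * Ideals of Noetherian rings *)

(** The number of transvections must not depend on the degrees of the entries of [g]. In a move from
    z to z - b^K y the element y is arbitrary and the cost is the same for every y; hence it is
    enough to write 1 as a combination of boundedly many powers b^K, however complicated the
    coefficients are. The exponent K is the price of zero divisors: b can be cancelled only in the
    form that b^(M+1) x = 0 implies b^M x = 0, with M taken from the chain of annihilators of the
    powers of b.

    A transvection always changes two coordinates, so the coordinates of negative index cannot be
    prescribed independently. During a move they are only kept congruent to their targets modulo a
    power of b; at the end just two of them are still wrong, and isotropy leaves for these a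
    discrepancy that a single transvection removes.

    No localisation or quotient ring is formed: elements outside a prime act as denominators, and
    ideals containing a fixed ideal replace ideals of the quotient. *)

Section Ideals.
Variable R : comNzRingType.
Implicit Types (I J P Q : R -> Prop) (ps : seq (R -> Prop)).

Definition incl I J := forall x, I x -> J x.

Lemma ideal0 I : is_ideal I -> I 0. Proof. by case. Qed.
Lemma idealD I x y : is_ideal I -> I x -> I y -> I (x + y).
Proof. by case=> _ h _; apply: h. Qed.
Lemma idealMl I a x : is_ideal I -> I x -> I (a * x).
Proof. by case=> _ _; apply. Qed.
Lemma idealMr I a x : is_ideal I -> I x -> I (x * a).
Proof. by rewrite mulrC; apply: idealMl. Qed.
Lemma idealN I x : is_ideal I -> I x -> I (- x).
Proof. by move=> hI h; rewrite -mulN1r; apply: idealMl. Qed.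
Lemma idealB I x y : is_ideal I -> I x -> I y -> I (x - y).
Proof. by move=> hI hx hy; apply: idealD => //; apply: idealN. Qed.
Lemma ideal_subr I x y : is_ideal I -> I y -> I (x - y) <-> I x.
Proof.
move=> hI hy; split=> h; last exact: idealB.
by rewrite -(subrK y x); apply: idealD.
Qed.
Lemma ideal_addr I x y : is_ideal I -> I y -> I (x + y) <-> I x.
Proof.
move=> hI hy; split=> h; last exact: idealD.
by rewrite -(addrK y x); apply: idealB.
Qed.
Lemma ideal_sum I (T : Type) (s : seq T) (p : pred T) (F : T -> R) :
  is_ideal I -> (forall i, p i -> I (F i)) -> I (\sum_(i <- s | p i) F i).
Proof.
move=> hI h; apply: (big_ind I) => //; first exact: ideal0.
by move=> x y hx hy; apply: idealD.
Qed.

Lemma prime_ideal P : is_prime_ideal P -> is_ideal P. Proof. by case. Qed.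
Lemma prime1 P : is_prime_ideal P -> ~ P 1. Proof. by case. Qed.
Lemma primeM P x y : is_prime_ideal P -> ~ P x -> ~ P y -> ~ P (x * y).
Proof. by case=> _ _ h nx ny /h []. Qed.
Lemma primeX P x k : is_prime_ideal P -> ~ P x -> ~ P (x ^+ k).
Proof.
move=> hP nx; elim: k => [|k IH]; first by rewrite expr0; apply: prime1.
by rewrite exprS; apply: primeM.
Qed.
Lemma prime_prod P (T : Type) (s : seq T) (F : T -> R) :
  is_prime_ideal P -> (forall i, List.In i s -> ~ P (F i)) ->
  ~ P (\prod_(i <- s) F i).
Proof.
move=> hP; elim: s => [|a s IH] h; first by rewrite big_nil; apply: prime1.
rewrite big_cons; apply: primeM => //; first by apply: h; left.
by apply: IH => i hi; apply: h; right.
Qed.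

Lemma incl_refl I : incl I I. Proof. by []. Qed.
Lemma incl_trans I J P : incl I J -> incl J P -> incl I P.
Proof. by move=> h1 h2 x /h1 /h2. Qed.
Lemma not_incl I J : ~ incl I J -> exists x, I x /\ ~ J x.
Proof.
move=> h; apply: NNPP => h2; apply: h => x hx; apply: NNPP => nx; apply: h2.
by exists x.
Qed.

Definition adj I a x := exists y r, I y /\ x = y + r * a.

Lemma adj_ideal I a : is_ideal I -> is_ideal (adj I a).
Proof.
move=> hI; split.
- by exists 0, 0; split; [exact: ideal0 | rewrite mul0r addr0].
- move=> _ _ [y1 [r1 [h1 ->]]] [y2 [r2 [h2 ->]]]; exists (y1 + y2), (r1 + r2).
  by split; [exact: idealD | rewrite mulrDl addrACA].
- move=> b _ [y [r [h ->]]]; exists (b * y), (b * r).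
  by split; [exact: idealMl | rewrite mulrDr mulrA].
Qed.
Lemma adj_incl I a : incl I (adj I a).
Proof. by move=> x h; exists x, 0; rewrite mul0r addr0. Qed.
Lemma adj_self I a : is_ideal I -> adj I a a.
Proof. by move=> hI; exists 0, 1; split; [exact: ideal0 | rewrite mul1r add0r]. Qed.
Lemma adj_sub I J a : is_ideal J -> incl I J -> J a -> incl (adj I a) J.
Proof.
by move=> hJ h ha _ [y [r [hy ->]]]; apply: idealD => //; [exact: h | exact: idealMl].
Qed.

Lemma noeth_max (F : (R -> Prop) -> Prop) :
  noetherian R -> (forall I, F I -> is_ideal I) -> (exists I, F I) ->
  exists I, F I /\ forall J, F J -> incl I J -> incl J I.
Proof.
move=> HN hF [I0 F0]; apply: NNPP => hno.
have next (s : {I | F I}) : exists t : {I | F I},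
    incl (sval s) (sval t) /\ ~ incl (sval t) (sval s).
  case: s => I FI /=; apply: NNPP => hn; apply: hno; exists I; split=> // J FJ hIJ.
  by apply: NNPP => hJI; apply: hn; exists (exist _ J FJ).
pose nx s := sval (constructive_indefinite_description _ (next s)).
have hnx s : incl (sval s) (sval (nx s)) /\ ~ incl (sval (nx s)) (sval s).
  by rewrite /nx; case: constructive_indefinite_description.
pose sq k := iter k nx (exist _ I0 F0).
have [] := HN (fun k => sval (sq k)).
- by move=> k; apply: hF; case: (sq k).
- by move=> k x; case: (hnx (sq k)) => h _; apply: h.
move=> k0 h; case: (hnx (sq k0)) => _; apply=> x hx.
exact/(h k0.+1 (leqnSn k0) x).
Qed.

Lemma noeth_ind (F : (R -> Prop) -> Prop) : noetherian R ->
  (forall I, is_ideal I ->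
     (forall J, is_ideal J -> incl I J -> ~ incl J I -> F J) -> F I) ->
  forall I, is_ideal I -> F I.
Proof.
move=> HN h I hI; apply: NNPP => nF.
have [|J [[hJ nJ] hmax]] := @noeth_max (fun I => is_ideal I /\ ~ F I) HN _
  (ex_intro _ I (conj hI nF)); first by move=> ? [].
apply: nJ; apply: h => // K hK hJK nKJ; apply: NNPP => nK.
by apply: nKJ; apply: hmax.
Qed.

(** The second clause says that the product of the ideals in [ps] lies in [I], tested on one chosen
    element of each. The list contains the minimal primes over [I] but may contain others; it is
    empty when [I] is the unit ideal. *)
Definition primes_over I ps :=
  (forall P, List.In P ps -> is_prime_ideal P /\ incl I P) /\
  (forall f : (R -> Prop) -> R, (forall P, List.In P ps -> P (f P)) ->
     I (\prod_(P <- ps) f P)).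

(** Noetherian induction: if a b lies in [I] but a and b do not, then (I + a)(I + b) is contained in
    [I], and the lists of the two larger ideals are concatenated. *)
Lemma primes_overP I : noetherian R -> is_ideal I -> exists ps, primes_over I ps.
Proof.
move=> HN; move: I; apply: (noeth_ind HN) => I hI IH.
case: (classic (I 1)) => [h1|n1].
  by exists [::]; split=> // f _; rewrite big_nil.
case: (classic (is_prime_ideal I)) => [hp|np].
  exists [:: I]; split; first by move=> P [<-|[]]; split.
  by move=> f /(_ I (or_introl erefl)); rewrite big_seq1.
have [a [b [hab [na nb]]]] : exists a b, I (a * b) /\ ~ I a /\ ~ I b.
  apply: NNPP => h; apply: np; split=> // x y hxy.
  apply: NNPP => /not_or_and [nx ny]; apply: h; by exists x, y.
have IHa c : ~ I c -> exists ps, primes_over (adj I c) ps.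
  move=> nc; apply: IH; [exact: adj_ideal | exact: adj_incl|].
  by move=> h; apply: nc; apply: h; apply: adj_self.
have [ps1 [h1 k1]] := IHa a na; have [ps2 [h2 k2]] := IHa b nb.
exists (ps1 ++ ps2); split=> [P hP|f hf].
  case: (List.in_app_or _ _ _ hP) => [/h1|/h2] [hp hi].
  - by split=> // x /(adj_incl a) /hi.
  - by split=> // x /(adj_incl b) /hi.
rewrite big_cat /=.
have [|y1 [r1 [hy1 ->]]] := k1 f.
  by move=> P hP; apply: hf; apply: List.in_or_app; left.
have [|y2 [r2 [hy2 ->]]] := k2 f.
  by move=> P hP; apply: hf; apply: List.in_or_app; right.
rewrite mulrDl; apply: idealD => //; first exact: idealMr.
rewrite mulrDr; apply: idealD => //; first exact: idealMl.
by rewrite mulrACA; apply: idealMl.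
Qed.

Lemma primes_over_below I ps Q : primes_over I ps -> is_prime_ideal Q ->
  incl I Q -> exists P, List.In P ps /\ incl P Q.
Proof.
move=> [_ hprod] hQ hIQ; apply: NNPP => hno.
have hx P : exists x, List.In P ps -> P x /\ ~ Q x.
  case: (classic (List.In P ps)) => [hP|nP]; last by exists 0.
  have [x [px qx]] : exists x, P x /\ ~ Q x.
    by apply: not_incl => h; apply: hno; exists P.
  by exists x.
pose f P := sval (constructive_indefinite_description _ (hx P)).
have hf P : List.In P ps -> P (f P) /\ ~ Q (f P).
  by rewrite /f; case: constructive_indefinite_description.
apply: (@prime_prod Q _ ps f) => //; first by move=> P /hf [].
by apply: hIQ; apply: hprod => P /hf [].
Qed.

Lemma no_prime_unit I : noetherian R -> is_ideal I ->
  (forall P, is_prime_ideal P -> ~ incl I P) -> I 1.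
Proof.
move=> HN hI h; have [[|P ps] [h1 h2]] := primes_overP HN hI.
  by have := h2 (fun=> 0); rewrite big_nil; apply.
by have [hP /(h _ hP)] := h1 P (or_introl erefl).
Qed.

Lemma max_disjoint_prime I (S : R -> Prop) : noetherian R -> is_ideal I ->
  S 1 -> (forall x y, S x -> S y -> S (x * y)) -> (forall x, I x -> ~ S x) ->
  exists P, [/\ is_prime_ideal P, incl I P & forall x, P x -> ~ S x].
Proof.
move=> HN hI S1 SM hIS.
have [||P [[hP hIP hPS] hmax]] := @noeth_max
  (fun J => [/\ is_ideal J, incl I J & forall x, J x -> ~ S x]) HN.
- by move=> J [hJ _ _].
- by exists I; split.
exists P; split=> //; split=> // [h1|x y hxy]; first exact: hPS h1 S1.
apply: NNPP => /not_or_and [nx ny].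
have hc c : ~ P c -> exists z, adj P c z /\ S z.
  move=> nc; apply: NNPP => hn; apply: nc.
  apply: (hmax (adj P c)); last exact: adj_self.
    split=> [||z hz hs]; [exact: adj_ideal | exact/(incl_trans hIP)/adj_incl |].
    by apply: hn; exists z.
  exact: adj_incl.
have [_ [[p1 [r1 [hp1 ->]]] s1]] := hc x nx.
have [_ [[p2 [r2 [hp2 ->]]] s2]] := hc y ny.
apply: (hPS _ _ (SM _ _ s1 s2)).
rewrite mulrDl; apply: idealD => //; first exact: idealMr.
rewrite mulrDr; apply: idealD => //; first exact: idealMl.
by rewrite mulrACA; apply: idealMl.
Qed.

Definition span (s : seq R) x := exists c : nat -> R, x = \sum_(i < size s) c i * s`_i.

Lemma span_ideal s : is_ideal (span s).
Proof.
split.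
- by exists (fun=> 0); rewrite big1 // => i _; rewrite mul0r.
- move=> _ _ [c ->] [d ->]; exists (fun i => c i + d i).
  by rewrite -big_split; apply: eq_bigr => i _; rewrite mulrDl.
- move=> a _ [c ->]; exists (fun i => a * c i).
  by rewrite mulr_sumr; apply: eq_bigr => i _; rewrite mulrA.
Qed.

Lemma span_mem s i : (i < size s)%N -> span s s`_i.
Proof.
move=> hi; exists (fun j => (j == i)%:R).
rewrite (bigD1 (Ordinal hi)) //= eqxx mul1r big1 ?addr0 // => j hj.
by rewrite (_ : (_ == _) = false) ?mul0r //; apply/negbTE.
Qed.

Lemma span_sub s J : is_ideal J -> (forall i, (i < size s)%N -> J s`_i) -> incl (span s) J.
Proof.
by move=> hJ h _ [c ->]; apply: ideal_sum => // i _; apply: idealMl => //; apply: h.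
Qed.

Lemma noeth_fg I : noetherian R -> is_ideal I ->
  exists s, (forall i, (i < size s)%N -> I s`_i) /\ incl I (span s).
Proof.
move=> HN hI.
have [||_ [[s [hs ->]] hmax]] := @noeth_max
  (fun J => exists s, (forall i, (i < size s)%N -> I s`_i) /\ J = span s) HN.
- by move=> _ [s [_ ->]]; apply: span_ideal.
- by exists (span [::]), [::].
exists s; split=> // x hx.
apply: (hmax (span (x :: s))); first by exists (x :: s); split=> // -[|i] // /hs.
  apply: span_sub; first exact: span_ideal.
  by move=> i hi; apply: (@span_mem (x :: s) i.+1).
exact: (@span_mem (x :: s) 0).
Qed.

(** The annihilators of the powers of b form an increasing chain. This replaces cancellation of b
    where b may be a zero divisor. *)
Lemma torsion_bound (b : R) : noetherian R ->
  exists M, forall k (w : R), b ^+ k * w = 0 -> b ^+ M * w = 0.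
Proof.
move=> HN; have [||M h] := HN (fun k (w : R) => b ^+ k * w = 0).
- move=> k; split; first by rewrite mulr0.
    by move=> x y hx hy; rewrite mulrDr hx hy addr0.
  by move=> a x hx; rewrite mulrCA hx mulr0.
- by move=> k x hx; rewrite exprS -mulrA hx mulr0.
exists M => k w hk; apply/(h (maxn M k)); first exact: leq_maxl.
by rewrite -(subnK (leq_maxr M k)) exprD -mulrA hk mulr0.
Qed.

End Ideals.

(** * Prime avoidance *)

Section Avoidance.
Variable R : comNzRingType.
Implicit Types (I J P Q : R -> Prop) (ps : seq (R -> Prop)).

Lemma incl_antisym I J : incl I J -> incl J I -> I = J.
Proof.
move=> h1 h2; apply: functional_extensionality => x.
by apply: propositional_extensionality; split; [apply: h1|apply: h2].
Qed.

Lemma minimal_in ps P0 : List.In P0 ps ->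
  exists P, List.In P ps /\ forall Q, List.In Q ps -> incl Q P -> Q = P.
Proof.
elim: ps P0 => [//|P ps IH] P0 _.
case: ps IH => [|P1 ps] IH.
  by exists P; split; [left | move=> Q [->|[]]].
have [|M [hM hmin]] := IH P1; first by left.
case: (classic (incl P M)) => [hPM|nPM].
  exists P; split; first by left.
  move=> Q [->//|hQ] hQP; apply: incl_antisym => //.
  by rewrite (hmin Q hQ (incl_trans hQP hPM)).
exists M; split; first by right.
by move=> Q [<- //|hQ]; apply: hmin.
Qed.

(* Primes are added smallest last, so that at each stage the earlier primes have
   a common element outside the new one; it corrects [f] without spoiling it. *)
Lemma avoid_primes ps (X : (R -> Prop) -> R * R) :
  (forall P, List.In P ps -> is_prime_ideal P /\ ~ (P (X P).1 /\ P (X P).2)) ->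
  exists f, forall P, List.In P ps -> ~ P ((X P).1 + f * (X P).2).
Proof.
have [n] := ubnP (length ps); elim: n ps => // n IH ps hn hps.
case: (classic (exists P0, List.In P0 ps)) => [[P0 hP0]|nps]; last first.
  by exists 0 => P hP; case: nps; exists P.
have [P [hP hmin]] := minimal_in hP0.
have dec : forall x y : R -> Prop, {x = y} + {x <> y}.
  by move=> x y; apply: excluded_middle_informative.
pose ps' := List.remove dec P ps.
have hps' Q : List.In Q ps' -> List.In Q ps /\ Q <> P by apply: List.in_remove.
have [|Q /hps' [hQ _]|f hf] := IH ps'; last 1 first.
- have [P_ideal nPX] := hps P hP.
  have hQps Q : List.In Q ps -> Q = P \/ List.In Q ps'.
    move=> hQ; case: (classic (Q = P)) => [->|nQP]; first by left.
    by right; apply: List.in_in_remove.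
  case: (classic (P ((X P).1 + f * (X P).2))) => [hbad|hgood]; last first.
    by exists f => Q hQ; case: (hQps Q hQ) => [->|/hf].
  have he Q : exists e, List.In Q ps' -> Q e /\ ~ P e.
    case: (classic (List.In Q ps')) => [hQ|nQ]; last by exists 0.
    have [hQ1 hQ2] := hps' Q hQ.
    have [e he] : exists e, Q e /\ ~ P e.
      by apply: not_incl => /(hmin Q hQ1).
    by exists e.
  pose e Q := sval (constructive_indefinite_description _ (he Q)).
  have hE Q : List.In Q ps' -> Q (e Q) /\ ~ P (e Q).
    by rewrite /e; case: constructive_indefinite_description.
  pose g := \prod_(Q <- ps') e Q.
  have nPg : ~ P g by apply: prime_prod => // Q /hE [].
  have gQ Q : List.In Q ps' -> Q g.
    move=> hQ; have [hQ1 _] := hps' Q hQ; have [/prime_ideal Qid _] := hps Q hQ1.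
    rewrite /g; elim: (ps') hQ (hE) => [//|Q1 s IHs] [->|hQ] hes; rewrite big_cons.
      by apply: idealMr => //; have [] := hes Q (or_introl erefl).
    by apply: idealMl => //; apply: IHs => // Q2 hQ2; apply: hes; right.
  exists (f + g) => Q hQ; case: (hQps Q hQ) => [->|hQ']; rewrite mulrDl addrA.
    have [Pid _ _] := P_ideal.
    rewrite addrC; move/(ideal_addr _ Pid hbad); apply: primeM => //.
    move=> h2; apply: nPX; split=> //.
    by move: hbad; rewrite ideal_addr //; apply: idealMl.
  have [/prime_ideal Qid _] := hps Q hQ.
  by rewrite ideal_addr //; [exact: hf | apply: idealMr => //; apply: gQ].
- have := List.remove_length_lt dec ps P hP; rewrite -/ps'; lia.
- exact: hps.
Qed.

End Avoidance.

(** * Nakayama's lemma at a prime, with denominators cleared *)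

Section Nakayama.
Variables (B R : comNzRingType) (iota : {rmorphism B -> R}) (P : B -> Prop).
Variable N : R -> Prop.
Hypothesis P_prime : is_prime_ideal P.
Hypothesis N0 : N 0.
Hypothesis ND : forall x y, N x -> N y -> N (x + y).
Hypothesis NZ : forall b x, N x -> N (iota b * x).

(** The module is the [B]-span of [s] modulo [N], localised at [P]. Instead of a determinant,
    induction on [s]: the relation for the first generator is solved for it and substituted into the
    others. *)
Lemma nakayama (s : seq R) :
  (forall i, (i < size s)%N -> exists a (c : nat -> B), [/\ ~ P a, forall j, P (c j) &
     N (iota a * s`_i - \sum_(j < size s) iota (c j) * s`_j)]) ->
  exists a, ~ P a /\ forall i, (i < size s)%N -> N (iota a * s`_i).
Proof.
have Pid := prime_ideal P_prime.
elim: s => [|g s IH] h; first by exists 1; split=> //; apply: prime1.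
have [a0 [c0 [na0 hc0 h0]]] := h 0%N isT.
(* The coefficient of the first generator in its own relation; it is a unit at [P]. *)
pose t := a0 - c0 0%N.
have nt : ~ P t by rewrite ideal_subr.
have {}h0 : N (iota t * g - \sum_(j < size s) iota (c0 j.+1) * s`_j).
  by move: h0; rewrite big_ord_recl /= rmorphB mulrBl opprD addrA.
have [i hi|a [na ha]] := IH.
  have [ai [ci [nai hci hi']]] := h i.+1 hi.
  exists (t * ai), (fun j => ci 0%N * c0 j.+1 + t * ci j.+1); split.
  - exact: primeM.
  - by move=> j; apply: idealD => //; apply: idealMl.
  pose S0 := \sum_(j < size s) iota (c0 j.+1) * s`_j.
  pose S1 := \sum_(j < size s) iota (ci j.+1) * s`_j.
  have {}hi' : N (iota ai * s`_i - (iota (ci 0%N) * g + S1)).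
    by move: hi'; rewrite big_ord_recl.
  have -> : \sum_(j < size s) iota (ci 0%N * c0 j.+1 + t * ci j.+1) * s`_j
     = iota (ci 0%N) * S0 + iota t * S1.
    rewrite !mulr_sumr -big_split; apply: eq_bigr => j _ /=.
    by rewrite rmorphD !rmorphM mulrDl !mulrA.
  have := ND (NZ t hi') (NZ (ci 0%N) h0); rewrite -/S0; congr N.
  rewrite !rmorphM; ring.
exists (a * t); split=> [|[|i] hi]; first exact: primeM.
  rewrite rmorphM -mulrA /= -[iota t * g](subrK (\sum_(j < size s) iota (c0 j.+1) * s`_j)).
  rewrite mulrDr; apply: ND; first exact: NZ.
  rewrite mulr_sumr; apply: (big_ind N) => // j _.
  by rewrite mulrCA; apply: NZ; apply: ha.
by rewrite [a * t]mulrC rmorphM -mulrA; apply: NZ; apply: ha.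
Qed.

End Nakayama.

(** * Krull's principal ideal theorem *)

Section PrincipalIdeal.
Variable R : comNzRingType.
Implicit Types (I J P Q : R -> Prop).

(** The contraction to [R] of the extension of [J] to the localisation at [P]. *)
Definition satur P J x := exists s, ~ P s /\ J (s * x).

Lemma satur_ideal P J : is_prime_ideal P -> is_ideal J -> is_ideal (satur P J).
Proof.
move=> hP hJ; split.
- by exists 1; split; [exact: prime1 | rewrite mulr0; exact: ideal0].
- move=> x y [s [ns hs]] [t [nt ht]]; exists (s * t); split; first exact: primeM.
  rewrite mulrDr; apply: idealD => //; last by rewrite -mulrA; apply: idealMl.
  by rewrite mulrAC; apply: idealMr.
- by move=> a x [s [ns hs]]; exists s; split=> //; rewrite mulrCA; apply: idealMl.
Qed.

Lemma satur_incl P J : is_prime_ideal P -> incl J (satur P J).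
Proof. by move=> hP x hx; exists 1; split; [exact: prime1 | rewrite mul1r]. Qed.

Lemma satur_closed P J s x : is_prime_ideal P -> ~ P s -> satur P J (s * x) -> satur P J x.
Proof.
move=> hP ns [t [nt ht]]; exists (t * s); split; first exact: primeM.
by rewrite -mulrA.
Qed.

(* If no prime lies strictly between [I] and [P], the localisation of [R / I] at
   [P] is Artinian. *)
Lemma artinian_chain P I : noetherian R -> is_prime_ideal P -> is_ideal I ->
  (forall Q, is_prime_ideal Q -> incl I Q -> incl Q P -> incl P Q) ->
  forall J : nat -> R -> Prop,
  (forall k, is_ideal (J k)) ->
  (forall k s x, ~ P s -> J k (s * x) -> J k x) ->
  (forall k, incl (J k.+1) (J k)) -> (forall k, incl I (J k)) ->
  exists k, forall l, (k <= l)%N -> incl (J k) (J l).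
Proof.
move=> HN hP; move: I; apply: (noeth_ind HN) => I hI IH hbetween J hJ hsat hdec hIJ.
have hmono k l : (k <= l)%N -> incl (J l) (J k).
  move/subnK <-; elim: (l - k)%N => [//|d IHd]; exact: incl_trans (hdec _) IHd.
have hunit s k l : ~ P s -> J l s -> incl (J k) (J l).
  move=> ns hs x _; rewrite -[x]mul1r; apply: idealMr => //.
  by apply: (hsat l s) => //; rewrite mulr1.
case: (classic (incl I P)) => [hIP|/not_incl [s [hs ns]]]; last first.
  by exists 0%N => l _; apply: (hunit s) => //; apply: hIJ.
case: (classic (is_prime_ideal I)) => [hIprime|np].
  have hPI := hbetween I hIprime (@incl_refl _ I) hIP.
  case: (classic (exists k, incl (J k) P)) => [[k hk]|nk].
    by exists k => l _; apply: incl_trans hk (incl_trans hPI (hIJ l)).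
  exists 0%N => l _.
  have [s [hs ns]] : exists s, J l s /\ ~ P s.
    by apply: not_incl => h; apply: nk; exists l.
  exact: hunit ns hs.
have [a [b [hab [na nb]]]] : exists a b, I (a * b) /\ ~ I a /\ ~ I b.
  apply: NNPP => h; apply: np; split=> // [h1|x y hxy].
    by apply: (prime1 hP); apply: hIP.
  apply: NNPP => /not_or_and [nx ny]; apply: h; by exists x, y.
(* A chain is stationary as soon as its sums with (a) and its colon ideals by a are; these chains
   lie over I + (a) and (I : a), both strictly larger than [I]. *)
pose I1 := adj I a; pose I2 x := I (x * a).
pose J1 k := satur P (adj (J k) a); pose J2 k x := J k (x * a).
have [k1 h1] : exists k, forall l, (k <= l)%N -> incl (J1 k) (J1 l).
  apply: (IH I1).
  - exact: adj_ideal.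
  - exact: adj_incl.
  - by move=> h; apply: na; apply: h; apply: adj_self.
  - by move=> Q hQ hIQ; apply: hbetween => //; apply: incl_trans (adj_incl a) hIQ.
  - by move=> k; apply: satur_ideal => //; apply: adj_ideal.
  - by move=> k s x; apply: satur_closed.
  - move=> k x [s [ns [y [r [hy e]]]]]; exists s; split=> //; exists y, r; split=> //.
    exact: hdec.
  - move=> k x hx; apply: satur_incl => //; move: x hx; apply: adj_sub.
    + exact: adj_ideal.
    + by move=> x hx; apply: adj_incl; apply: hIJ.
    + exact: adj_self.
have [k2 h2] : exists k, forall l, (k <= l)%N -> incl (J2 k) (J2 l).
  apply: (IH I2).
  - split=> [|x y hx hy|c x hx]; rewrite /I2.
    + by rewrite mul0r; apply: ideal0.
    + by rewrite mulrDl; apply: idealD.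
    + by rewrite -mulrA; apply: idealMl.
  - by move=> x hx; apply: idealMr.
  - by move=> h; apply: nb; apply: h; rewrite /I2 mulrC.
  - move=> Q hQ hIQ; apply: hbetween => //; apply: incl_trans hIQ => x hx.
    exact: idealMr.
  - move=> k; split=> [|x y hx hy|c x hx]; rewrite /J2.
    + by rewrite mul0r; apply: ideal0.
    + by rewrite mulrDl; apply: idealD.
    + by rewrite -mulrA; apply: idealMl.
  - by move=> k s x ns; rewrite /J2 -mulrA; apply: hsat.
  - by move=> k x; apply: hdec.
  - by move=> k x; apply: hIJ.
exists (maxn k1 k2) => l hl x hx.
have {}h1 : J1 l x.
  apply: (h1 l); first by apply: leq_trans hl; apply: leq_maxl.
  apply: satur_incl => //; apply: adj_incl; move: x hx; apply: hmono.
  exact: leq_maxl.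
have [s [ns [y [r [hy e]]]]] := h1.
apply: (hsat l s) => //; rewrite e; apply: idealD => //.
have hl2 : (k2 <= l)%N by apply: leq_trans hl; apply: leq_maxr.
apply: (h2 l hl2); rewrite /J2.
have -> : r * a = s * x - y by rewrite e addrC addKr.
apply: idealB => //.
  by apply: idealMl => //; move: x hx {e h1}; apply: hmono; apply: leq_maxr.
by move: y hy {e}; apply: hmono.
Qed.

(** Krull's principal ideal theorem in R/Q0: a prime of height at least 2 is not minimal over (a).
    Otherwise the ideals (y^k), with y in [Q] outside [Q0], saturated at [Q], would be stationary
    modulo a at [P]; Nakayama removes the a, and y^k would lie in (y^(k+1)) at [Q]. *)
Lemma principal_ideal_exchange Q0 Q P a : noetherian R ->
  is_prime_ideal Q0 -> is_prime_ideal Q -> is_prime_ideal P ->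
  incl Q0 Q -> incl Q P -> ~ incl Q Q0 -> P a -> ~ Q a ->
  exists Q', [/\ is_prime_ideal Q', Q' a, incl Q0 Q', incl Q' P & ~ incl P Q'].
Proof.
move=> HN hQ0 hQ hP h0Q hQP n0 Pa nQa; apply: NNPP => hno.
have hbetween Q' : is_prime_ideal Q' -> incl (adj Q0 a) Q' -> incl Q' P -> incl P Q'.
  move=> hQ' h1 h2; apply: NNPP => h3; apply: hno; exists Q'; split=> //.
    by apply: h1; apply: adj_self; apply: prime_ideal.
  by apply: incl_trans h1; apply: adj_incl.
have [Q0id Qid Pid] := And3 (prime_ideal hQ0) (prime_ideal hQ) (prime_ideal hP).
have [y [hy ny]] := not_incl n0.
pose J k := satur Q (adj Q0 (y ^+ k)).
have Jid k : is_ideal (J k) by apply: satur_ideal => //; apply: adj_ideal.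
have Jdec k : incl (J k.+1) (J k).
  move=> x [s [ns [z [r [hz e]]]]]; exists s; split=> //; exists z, (r * y).
  by split=> //; rewrite e exprS mulrA.
have J0 k : incl Q0 (J k).
  by move=> x hx; apply: satur_incl => //; apply: adj_incl.
have nP_nQ s : ~ P s -> ~ Q s by move=> h1 h2; apply: h1; apply: hQP.
have [k hk] : exists k, forall l, (k <= l)%N ->
    incl (satur P (adj (J k) a)) (satur P (adj (J l) a)).
  apply: (artinian_chain HN hP (adj_ideal a Q0id) hbetween).
  - by move=> k; apply: satur_ideal => //; apply: adj_ideal.
  - by move=> k s x; apply: satur_closed.
  - move=> k x [s [ns [z [r [hz e]]]]]; exists s; split=> //; exists z, r; split=> //.
    exact: Jdec.
  - move=> k x hx; apply: satur_incl => //; move: x hx; apply: adj_sub.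
    + exact: adj_ideal.
    + by move=> x hx; apply: adj_incl; apply: J0.
    + exact: adj_self.
have [gs [hgs hspan]] := noeth_fg HN (Jid k).
have [|||i hi|t [nt ht]] := @nakayama R R idfun P (J k.+1) hP _ _ _ gs.
- exact: ideal0.
- by move=> x z hx hz; apply: idealD.
- by move=> b x hx; apply: idealMl.
- have [|s [ns [z [r [hz e]]]]] := hk k.+1 (leqnSn k) (gs`_i).
    by apply: satur_incl => //; apply/adj_incl/hgs.
  have hr : J k r.
    have : J k (a * r).
      have -> : a * r = s * gs`_i - z by rewrite e addrC addKr mulrC.
      apply: idealB => //; last exact: Jdec.
      by apply: idealMl => //; apply: hgs.
    exact: satur_closed.
  have [c ec] := hspan r hr.
  exists s, (fun j => a * c j); split=> // [j|/=]; first exact: idealMr.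
  suff -> : \sum_(j < size gs) a * c j * gs`_j = r * a by rewrite e addrK.
  by rewrite ec mulr_suml; apply: eq_bigr => j _; rewrite -mulrA mulrC.
have hy1 : J k.+1 (t * y ^+ k).
  have [c ->] : span gs (y ^+ k).
    by apply: hspan; apply: satur_incl => //; apply: adj_self.
  by rewrite mulr_sumr; apply: ideal_sum => // i _; rewrite mulrCA; apply: idealMl => //; apply: ht.
have [s [ns [z [r [hz e]]]]] := hy1.
have hst : ~ Q (s * t) by apply: primeM => //; apply: nP_nQ.
(* [Q0] is prime without y, so s t - r y would lie in [Q0], hence s t in [Q]. *)
have : Q0 ((s * t - r * y) * y ^+ k).
  by rewrite mulrBl -!mulrA e -exprS addrK.
case: (hQ0) => _ _ /[apply] [[/h0Q h|]]; last exact: primeX.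
by apply: hst; rewrite -(subrK (r * y) (s * t)); apply: idealD => //; apply: idealMl.
Qed.

End PrincipalIdeal.

(** * Chains of primes and polynomial rings *)

Section Chains.
Variable R : comNzRingType.
Implicit Types (I J P Q : R -> Prop).

Fixpoint height_ge (P : R -> Prop) (h : nat) : Prop :=
  is_prime_ideal P /\
  match h with
  | 0 => True
  | h'.+1 => exists Q, [/\ height_ge Q h', incl Q P & ~ incl P Q]
  end.

(** Unlike [height_ge], this unfolds from the bottom, which gives access to the second member of a
    chain. *)
Fixpoint chain_from (L : nat) (Q P : R -> Prop) : Prop :=
  is_prime_ideal Q /\
  match L with
  | 0 => Q = P
  | L'.+1 => exists Q', [/\ incl Q Q', ~ incl Q' Q & chain_from L' Q' P]
  end.

Lemma height_ge_prime P h : height_ge P h -> is_prime_ideal P.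
Proof. by case: h => [|h] []. Qed.

Lemma height_ge_lt Q P h : height_ge Q h -> is_prime_ideal P -> incl Q P ->
  ~ incl P Q -> height_ge P h.+1.
Proof. by move=> hQ hP h1 h2; split=> //; exists Q. Qed.

Lemma height_ge_incl Q P h : height_ge Q h -> is_prime_ideal P -> incl Q P -> height_ge P h.
Proof.
case: h => [|h] [hQ h1] hP hQP //; case: h1 => Q' [h1 h2 h3].
apply: (height_ge_lt h1) => //; first exact: incl_trans hQP.
by move=> h4; apply: h3; apply: incl_trans h4.
Qed.

Lemma height_ge_pred P h : height_ge P h.+1 -> height_ge P h.
Proof. by case=> hP [Q [hQ h1 h2]]; exact: height_ge_incl hQ hP h1. Qed.

Lemma height_ge_leq P h h' : (h' <= h)%N -> height_ge P h -> height_ge P h'.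
Proof. by move/subnK <-; elim: (h - h')%N => // d IH /height_ge_pred. Qed.

Lemma chain_from_prime L Q P : chain_from L Q P -> is_prime_ideal Q.
Proof. by case: L => [|L] []. Qed.

Lemma chain_from_incl L Q P : chain_from L Q P -> incl Q P.
Proof.
elim: L Q => [|L IH] Q [hQ]; first by move->.
by move=> [Q' [h1 _ /IH]]; apply: incl_trans.
Qed.

Lemma chain_from_rcons L Q P P' : chain_from L Q P -> is_prime_ideal P' ->
  incl P P' -> ~ incl P' P -> chain_from L.+1 Q P'.
Proof.
elim: L Q => [|L IH] Q [hQ].
  by move=> <- hP' h1 h2; split=> //; exists P'; split.
move=> [Q' [h1 h2 h3]] hP' h4 h5; split=> //; exists Q'; split=> //.
exact: IH.
Qed.

Lemma height_ge_chain P h : height_ge P h -> exists Q, chain_from h Q P.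
Proof.
elim: h P => [|h IH] P [hP]; first by exists P.
by move=> [Q [/IH [Q0 hQ0] h1 h2]]; exists Q0; exact: chain_from_rcons hQ0 hP h1 h2.
Qed.

Lemma chain_height_ge L Q P : chain_from L Q P -> height_ge P L.
Proof.
suff H k : chain_from L Q P -> height_ge Q k -> height_ge P (k + L).
  by move=> h; apply: (H 0%N h); split=> //; apply: chain_from_prime h.
elim: L Q k => [|L IH] Q k [hQ]; first by move=> <-; rewrite addn0.
move=> [Q' [h1 h2 h3]] h4; rewrite addnS -addSn; apply: (IH Q') => //.
exact: height_ge_lt h4 (chain_from_prime h3) h1 h2.
Qed.

Lemma krull_dim_height D P : krull_dim_eq R D -> ~ height_ge P D.+1.
Proof.
have H h P' : height_ge P' h -> exists f, prime_chain f h /\ f h = P'.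
  elim: h P' => [|h IH] P' [hP'].
    by exists (fun=> P'); split=> //; split=> // k; rewrite ltn0.
  move=> [Q [/IH [f [[f1 f2] fQ]] h1 h2]].
  exists (fun k => if (k <= h)%N then f k else P'); split; last by rewrite ltnn.
  split=> k hk; first by case: ifP => // /f1.
  case: (ltngtP k h) => hkh; [| lia |].
  - exact: f2.
  - rewrite hkh fQ; split; first exact: h1.
    by have [x hx] := not_incl h2; exists x.
by move=> [_ hD] /H [f [/hD]]; rewrite ltnn.
Qed.

Lemma exchange Q0 Q P a : noetherian R -> is_prime_ideal Q0 -> is_prime_ideal Q ->
  is_prime_ideal P -> incl Q0 Q -> ~ incl Q Q0 -> incl Q P -> ~ incl P Q -> P a -> ~ Q0 a ->
  exists Q', [/\ is_prime_ideal Q', Q' a, incl Q0 Q', incl Q' P & ~ incl P Q'].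
Proof.
move=> HN h0 h1 h2 i01 n10 i12 n21 hPa n0a.
case: (classic (Q a)) => [hQa|nQa]; first by exists Q.
exact: (principal_ideal_exchange HN h0 h1 h2).
Qed.

(* Moving [a] down the chain to its second member lets one compare a chain in a
   polynomial ring with the chain of contractions. *)
Lemma chain_exchange L Q P a : noetherian R -> chain_from L.+1 Q P -> P a -> ~ Q a ->
  exists Q', [/\ incl Q Q', Q' a & chain_from L Q' P].
Proof.
move=> HN; elim: L Q => [|L IH] Q [hQ [Q1 [i01 n10 h1]]] Pa nQa.
  by exists Q1; split=> //; case: h1 => _ ->.
case: (classic (Q1 a)) => [hQ1a|nQ1a]; first by exists Q1.
have [Q2 [i12 hQ2a h2]] := IH Q1 h1 Pa nQ1a.
have [hQ1 hQ2] := conj (proj1 h1) (chain_from_prime h2).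
have n21 : ~ incl Q2 Q1 by move=> h; apply: nQ1a; apply: h.
have [Q' [hQ' Q'a i0 i2 n2]] := exchange HN hQ hQ1 hQ2 i01 n10 i12 n21 hQ2a nQa.
by exists Q'; split=> //; split=> //; exists Q2.
Qed.

End Chains.

(** * Primes of a polynomial ring: basis theorem, fibres, leading coefficients *)

Section PolynomialPrimes.
Variable B : comNzRingType.
Implicit Types (I J P Q : {poly B} -> Prop) (p : B -> Prop) (f g h : {poly B}).

(** The ideals [Lc k d] of coefficients in degree d increase with the stage k and with d. If they
    all agree from some stage on, so do the [I k], by lowering the degree of an element. *)
Lemma hilbert_basis : noetherian B -> noetherian {poly B}.
Proof.
move=> HN I hI hinc.
have hmono k l : (k <= l)%N -> incl (I k) (I l).
  move/subnK <-; elim: (l - k)%N => [//|d IH]; exact: incl_trans IH (hinc _).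
pose Lc k d c := exists f, [/\ I k f, (size f <= d.+1)%N & f`_d = c].
have LcI k d : is_ideal (Lc k d).
  split.
  - by exists 0; rewrite size_poly0 coef0; split=> //; apply: ideal0.
  - move=> _ _ [f [f1 f2 <-]] [g [g1 g2 <-]]; exists (f + g); split.
    + exact: idealD.
    + by rewrite (leq_trans (size_polyD _ _)) // geq_max f2.
    + by rewrite coefD.
  - move=> a _ [f [f1 f2 <-]]; exists (a%:P * f); split.
    + exact: idealMl.
    + by rewrite mul_polyC (leq_trans (size_scale_leq _ _)).
    + by rewrite coefCM.
have Lck k l d : (k <= l)%N -> incl (Lc k d) (Lc l d).
  by move=> hkl c [f [f1 f2 f3]]; exists f; split=> //; apply: hmono f1.
have Lcd k d e : (d <= e)%N -> incl (Lc k d) (Lc k e).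
  move/subnK <-; elim: (e - d)%N => [//|j IH] c /IH [f [f1 f2 f3]].
  exists (f * 'X); split; first exact: idealMr.
    by rewrite (leq_trans (size_polyMleq _ _)) // size_polyX; lia.
  by rewrite addSn coefMX.
(* The diagonal settles all degrees from k0 on at once; the finitely many degrees below k0 are then
   treated one by one. *)
have [||k0 hk0] := HN (fun k => Lc k k); first by move=> k; apply: LcI.
  by move=> k c /(Lck k k.+1 k (leqnSn k)); apply: Lcd.
have [K hK] : exists K, forall d, (d < k0)%N -> forall k, (K <= k)%N -> incl (Lc k d) (Lc K d).
  elim: (k0) => [|m [K hK]]; first by exists 0%N.
  have [||K' hK'] := HN (fun k => Lc k m); first by move=> k; apply: LcI.
    by move=> k c; apply: Lck.
  exists (maxn K K') => d; rewrite ltnS leq_eqVlt => /orP [/eqP ->|hd] k hk c hc.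
    apply: (Lck K') (leq_maxr _ _) _ _; apply/(hK' k) => //.
    by apply: leq_trans hk; apply: leq_maxr.
  apply: (Lck K) (leq_maxl _ _) _ _; apply: (hK d hd k) => //.
  by apply: leq_trans hk; apply: leq_maxl.
pose M := maxn K k0; exists M => k hk f; split; last exact: hmono.
have [n] := ubnP (size f); elim: n f => // n IH f hn hf.
case: (posnP (size f)) => [/eqP|hs].
  by rewrite size_poly_eq0 => /eqP ->; apply: ideal0.
pose d := (size f).-1.
have hd : size f = d.+1 by rewrite /d prednK.
have [g [g1 g2 g3]] : Lc M d f`_d.
  have hc : Lc k d f`_d by exists f; rewrite hd.
  case: (ltnP d k0) => hdk.
    apply: (Lck K); first exact: leq_maxl.
    by apply: (hK d hdk k) hc; apply: leq_trans hk; apply: leq_maxl.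
  have : Lc k0 k0 f`_d.
    apply/(hk0 (maxn k d)); first by apply: leq_trans hdk _; apply: leq_maxr.
    apply: (Lcd _ d); first exact: leq_maxr.
    by apply: (Lck k) hc; apply: leq_maxl.
  move/(Lcd _ _ _ hdk); apply: Lck; exact: leq_maxr.
rewrite -(subrK g f); apply: idealD => //; apply: IH.
  apply: (@leq_ltn_trans d); last by rewrite -ltnS -hd.
  apply/leq_sizeP => j; rewrite leq_eqVlt => /orP [/eqP <-|hj].
    by rewrite coefB g3 subrr.
  by rewrite coefB !nth_default ?subrr ?hd //; apply: leq_trans g2 _.
by apply: idealB => //; apply: hmono g1.
Qed.

Definition ext p f := forall i, p f`_i.
Definition contr P b := P b%:P.

Lemma ext_ideal p : is_ideal p -> is_ideal (ext p).
Proof.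
move=> hp; split.
- by move=> i; rewrite coef0; apply: ideal0.
- by move=> f g hf hg i; rewrite coefD; apply: idealD.
- by move=> f g hg i; rewrite coefM; apply: ideal_sum => // j _; apply: idealMl.
Qed.

Lemma contr_prime P : is_prime_ideal P -> is_prime_ideal (contr P).
Proof.
move=> [[h0 hD hM] h1 hp]; split; first split; rewrite /contr //.
- by move=> x y hx hy; rewrite polyCD; apply: hD.
- by move=> a x hx; rewrite polyCM; apply: hM.
- by move=> x y; rewrite polyCM; apply: hp.
Qed.

Lemma ext_contr p P : is_ideal P -> incl p (contr P) -> incl (ext p) P.
Proof.
move=> hP h f hf; rewrite -(coefK f) poly_def; apply: ideal_sum => // i _.
by rewrite -mul_polyC; apply: idealMr => //; apply: h.
Qed.

(** Takes the place of reduction modulo [p]: [g] represents [f] modulo p[X], and its degree is the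
    true degree of the reduction. *)
Lemma strip p f : is_ideal p -> exists g,
  [/\ ext p (f - g), (size g <= size f)%N & g = 0 \/ ~ p (lead_coef g)].
Proof.
move=> hp; have [n] := ubnP (size f); elim: n f => // n IH f hn.
case: (eqVneq f 0) => [->|nf].
  by exists 0; split=> //; [rewrite subrr; apply: ideal0; apply: ext_ideal | left].
case: (classic (p (lead_coef f))) => [hl|nl]; last first.
  by exists f; split=> //; [rewrite subrr; apply: ideal0; apply: ext_ideal | right].
pose d := (size f).-1.
have hd : size f = d.+1 by rewrite /d prednK // lt0n size_poly_eq0.
pose f1 := f - (lead_coef f)%:P * 'X^d.
have hf1 : (size f1 <= d)%N.
  apply/leq_sizeP => j; rewrite leq_eqVlt => /orP [/eqP <-|hj].
    by rewrite coefB coefCM coefXn eqxx mulr1 lead_coefE subrr.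
  rewrite coefB coefCM coefXn (gtn_eqF hj) mulr0 subr0 nth_default //.
  by rewrite hd.
have [|g [g1 g2 g3]] := IH f1; first by rewrite (leq_ltn_trans hf1) // -ltnS -hd.
exists g; split=> //; last by rewrite (leq_trans g2) // (leq_trans hf1) // hd.
have -> : f - g = (f1 - g) + (lead_coef f)%:P * 'X^d by rewrite /f1; ring.
apply: (idealD (ext_ideal hp)) => //.
by move=> i; rewrite coefCM; apply: idealMr.
Qed.

Lemma lead_mul p f g : is_prime_ideal p -> ~ p (lead_coef f) -> ~ p (lead_coef g) ->
  lead_coef (f * g) = lead_coef f * lead_coef g /\ ~ p (lead_coef (f * g)).
Proof.
move=> hp hf hg; have hfg := primeM hp hf hg.
rewrite lead_coef_proper_mul //; apply/eqP => h0; apply: hfg; rewrite h0.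
by apply: ideal0; apply: prime_ideal.
Qed.

Lemma ext_prime p : is_prime_ideal p -> is_prime_ideal (ext p).
Proof.
move=> hp; have pid := prime_ideal hp; have eid := ext_ideal pid; split=> //.
  by move/(_ 0%N); rewrite coef1; apply: prime1.
move=> f g hfg; apply: NNPP => /not_or_and [nf ng].
have [f1 [f2 _ f4]] := strip f pid; have [g1 [g2 _ g4]] := strip g pid.
have hlf : ~ p (lead_coef f1).
  by case: f4 => // h0; case: nf; move: f2; rewrite h0 subr0.
have hlg : ~ p (lead_coef g1).
  by case: g4 => // h0; case: ng; move: g2; rewrite h0 subr0.
have [_ hn] := lead_mul hp hlf hlg; apply: hn; rewrite lead_coefE; move: (_.-1).
have -> : f1 * g1 = f * g - (f * (g - g1) + g1 * (f - f1)) by ring.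
by apply: (idealB eid) => //; apply: (idealD eid); apply: (idealMl _ eid).
Qed.

Lemma min_size (S : {poly B} -> Prop) : (exists f, S f) ->
  exists f, S f /\ forall g, S g -> (size f <= size g)%N.
Proof.
move=> [f]; have [n] := ubnP (size f); elim: n f => // n IH f hn hf.
case: (classic (exists g, S g /\ (size g < size f)%N)) => [[g [hg hs]]|hno].
  by apply: (IH g) => //; lia.
by exists f; split=> // g hg; rewrite leqNgt; apply/negP => h; apply: hno; exists g.
Qed.

Lemma pseudo_division h f : h != 0 ->
  exists k w r, [/\ (lead_coef h ^+ k)%:P * f = h * w + r, (size r < size h)%N
    & forall p, is_ideal p -> ext p f -> ext p r].
Proof.
move=> nh; have [n] := ubnP (size f); elim: n f => // n IH f hn.
case: (ltnP (size f) (size h)) => hs.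
  by exists 0%N, 0, f; rewrite expr0 mul1r mulr0 add0r.
have hh : (0 < size h)%N by rewrite lt0n size_poly_eq0.
pose f1 := (lead_coef h)%:P * f - h * ((lead_coef f)%:P * 'X^(size f - size h)).
have hf1 : (size f1 <= (size f).-1)%N.
  apply/leq_sizeP => j hj.
  rewrite coefB coefCM mulrCA coefCM coefMXn.
  have hj2 : (j < size f - size h)%N = false by apply/negbTE; lia.
  rewrite hj2; move: hj; rewrite leq_eqVlt => /orP [/eqP <-|hj].
    have -> : ((size f).-1 - (size f - size h) = (size h).-1)%N by lia.
    by rewrite -!lead_coefE mulrC subrr.
  have hfj : (size f <= j)%N by lia.
  have hhj : (size h <= j - (size f - size h))%N by lia.
  by rewrite [f`_j]nth_default // [h`__]nth_default // !mulr0 subrr.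
have [|k [w [r [e hr hext]]]] := IH f1; first by lia.
exists k.+1, (w + (lead_coef h ^+ k)%:P * ((lead_coef f)%:P * 'X^(size f - size h))), r.
split=> [|//|p hp hf].
  by rewrite mulrDr addrAC -e /f1 exprSr polyCM; ring.
have eid := ext_ideal hp; apply: hext => //; apply: (idealB eid).
  exact: (idealMl _ eid).
apply: (idealMl _ eid); apply: (idealMr _ eid) => i; rewrite coefC.
by case: eqP => _; [apply: hf | apply: ideal0].
Qed.

(** Over the fraction field of B/p a nonzero prime is maximal. Concretely, if [P] were larger than
    p[X], take [f] of least degree in [P] and [h] of least degree in P + (g), with g in [Q] outside
    [P]. Up to powers of the leading coefficient [h] divides [f] and [g] modulo p[X], so [P]
    contains either [h], hence [g], or a cofactor of too small degree. *)
Lemma fibre_lemma P Q : is_prime_ideal P -> is_prime_ideal Q -> incl P Q -> ~ incl Q P ->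
  incl (contr Q) (contr P) -> incl P (ext (contr P)).
Proof.
move=> hP hQ hPQ nQP hc; set p := contr P.
have hp : is_prime_ideal p by apply: contr_prime.
have [pid Pid Qid] := And3 (prime_ideal hp) (prime_ideal hP) (prime_ideal hQ).
have hext : incl (ext p) P by apply: ext_contr.
apply: NNPP => /not_incl [f0 [hf0 nf0]].
have [f [[hf hlf] fmin]] : exists f, (P f /\ ~ p (lead_coef f)) /\
    forall g, P g /\ ~ p (lead_coef g) -> (size f <= size g)%N.
  apply: min_size; have [g [g1 _ g3]] := strip f0 pid; exists g; split.
    by rewrite -(ideal_subr _ Pid (hext _ g1)) in hf0; move: hf0; rewrite subKr.
  by case: g3 => // h0; case: nf0; move: g1; rewrite h0 subr0.
have [g [hg ng]] := not_incl nQP.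
have Jid := adj_ideal g Pid; have hPJ := @adj_incl _ P g.
have hJQ : incl (adj P g) Q by apply: adj_sub.
have [h [[hh hlh] hmin]] : exists h, (adj P g h /\ ~ p (lead_coef h)) /\
    forall h', adj P g h' /\ ~ p (lead_coef h') -> (size h <= size h')%N.
  by apply: min_size; exists f; split=> //; apply: hPJ.
have lead0 h' : ~ p (lead_coef h') -> h' != 0.
  by move=> hl; apply/eqP => e; apply: hl; rewrite e lead_coef0; apply: ideal0.
(* A constant in [Q] lies in the contraction of [P], so [h] cannot be constant. *)
have sh : (1 < size h)%N.
  rewrite ltnNge; apply/negP => /size1_polyC e; apply: hlh; apply: hc; rewrite /contr.
  by rewrite e lead_coefC -e; apply: hJQ.
have hdiv f1 : adj P g f1 -> exists k w, ext p ((lead_coef h ^+ k)%:P * f1 - h * w).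
  move=> hf1; have [k [w [r [e hr _]]]] := pseudo_division f1 (lead0 _ hlh).
  exists k, w; rewrite e addrC addKr.
  have [r1 [r2 r3 r4]] := strip r pid.
  suff h0 : r1 = 0 by move: r2; rewrite h0 subr0.
  case: r4 => // r4; have : adj P g r1.
    have <- : r - (r - r1) = r1 by ring.
    apply: idealB => //; last by apply: hPJ; apply: hext.
    have -> : r = (lead_coef h ^+ k)%:P * f1 - h * w by rewrite e addrC addKr.
    by apply: idealB => //; [apply: idealMl | apply: idealMr].
  by move=> hr1; have := hmin r1 (conj hr1 r4); lia.
have [k [w hw]] := hdiv f (hPJ f hf).
have hPhw : P (h * w).
  rewrite -[h * w](subKr ((lead_coef h ^+ k)%:P * f)).
  by apply: idealB => //; [apply: idealMl | apply: hext].
case: (hP) => _ _ /(_ _ _ hPhw) [hPh|hPw].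
  have [l [w' hw']] := hdiv g (adj_self g Pid).
  have : P ((lead_coef h ^+ l)%:P * g).
    by move: (hext _ hw'); rewrite ideal_subr //; apply: idealMr.
  by apply: primeM => //; exact: (@primeX _ p _ l hp hlh).
have [w1 [w2 _ w4]] := strip w pid.
have hPw1 : P w1.
  have <- : w - (w - w1) = w1 by ring.
  by apply: idealB => //; apply: hext.
have {}hw : ext p ((lead_coef h ^+ k)%:P * f - h * w1).
  have -> : (lead_coef h ^+ k)%:P * f - h * w1
    = ((lead_coef h ^+ k)%:P * f - h * w) + h * (w - w1) by ring.
  have eid := ext_ideal pid; apply: (idealD eid) => //; exact: (idealMl _ eid).
case: w4 => [w10|hlw].
  move: (hw (size f).-1); rewrite w10 mulr0 subr0 coefCM; apply: primeM => //.
  exact: primeX.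
(* Now h w1 has larger degree than [f], yet it equals a multiple of [f] modulo p[X]; its leading
   coefficient would lie in [p]. *)
have sf := fmin _ (conj hPw1 hlw).
have [e hl] := lead_mul hp hlh hlw.
have hs : size (h * w1) = (size h + size w1).-1.
  apply: size_proper_mul; rewrite -e; apply/eqP => e0; apply: hl.
  by rewrite e0; apply: ideal0.
apply: hl; have := hw (size (h * w1)).-1.
rewrite coefB [X in p (X - _)]nth_default.
  by rewrite sub0r -lead_coefE => /(idealN pid); rewrite opprK.
have hle : (size f <= (size h + size w1).-1.-1)%N by lia.
by rewrite mul_polyC hs; apply: leq_trans (size_scale_leq _ _) hle.
Qed.

(** A fibre has dimension at most one: by [fibre_lemma] the middle prime would be extended from [B],
    and then contained in [P0]. *)
Lemma fibre_dim P0 P1 P2 : is_prime_ideal P0 -> is_prime_ideal P1 -> is_prime_ideal P2 ->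
  incl P0 P1 -> ~ incl P1 P0 -> incl P1 P2 -> ~ incl P2 P1 -> ~ incl (contr P2) (contr P0).
Proof.
move=> h0 h1 h2 i01 n10 i12 n21 hc; apply: n10.
apply: incl_trans (fibre_lemma h1 h2 i12 n21 _) _.
  by apply: incl_trans hc _ => b; apply: i01.
apply: ext_contr; first exact: prime_ideal.
by apply: incl_trans hc => b; apply: i12.
Qed.

(** While the contractions of [Q] and [P] differ, [chain_exchange] puts an element of [B] into the
    second member, and the contracted chain grows too. Once they agree at most one step is left, by
    [fibre_dim]; it is lost, and does not occur when [P] is extended from [B]. *)
Lemma contr_chain L Q P : noetherian B -> chain_from L Q P ->
  exists L', [/\ chain_from L' (contr Q) (contr P), (L <= L'.+1)%N &
                 incl P (ext (contr P)) -> (L <= L')%N].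
Proof.
move=> HN; have HN' := hilbert_basis HN.
elim: L Q => [|L IH] Q hchain.
  case: (hchain) => hQ <-; exists 0%N; split=> //; split=> //; exact: contr_prime.
have hQ := chain_from_prime hchain.
have hQP : incl Q P := chain_from_incl hchain.
have hP : is_prime_ideal P by case: (chain_height_ge hchain).
case: (classic (incl (contr P) (contr Q))) => [hc|/not_incl [a [Pa nQa]]]; last first.
  have [Q' [i0 hQ'a /IH [L' [h1 h2 h3]]]] := chain_exchange HN' hchain Pa nQa.
  exists L'.+1; split=> //; split; first exact: contr_prime.
  exists (contr Q'); split=> // [b|h]; [exact: i0 | exact: (nQa (h a hQ'a))].
case: L {IH} hchain => [|L] hchain; last first.
  case: hchain => _ [Q1 [i01 n10 [hQ1 [Q2 [i12 n21 h2]]]]]; exfalso.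
  apply: (fibre_dim hQ hQ1 (chain_from_prime h2) i01 n10 i12 n21).
  by apply: incl_trans hc => b; apply: (chain_from_incl h2).
exists 0%N; split=> // [|hext].
  by split; [exact: contr_prime | apply: incl_antisym => // b; apply: hQP].
exfalso; case: hchain => _ [Q1 [i01 n10 h1]]; apply: n10.
case: h1 => _ -> x /hext; apply: ext_contr => //.
exact: prime_ideal.
Qed.

Definition dim_le (R : comNzRingType) d := forall P : R -> Prop, ~ height_ge P d.+1.

Lemma dim_poly d : noetherian B -> dim_le B d -> dim_le {poly B} d.+1.
Proof.
move=> HN hd P /height_ge_chain [Q /(contr_chain HN) [L [/chain_height_ge h1 h2 _]]].
by apply: (hd (contr P)); apply: height_ge_leq h1.
Qed.

Definition leadI I c := exists f, I f /\ lead_coef f = c.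

Lemma leadI_ideal I : is_ideal I -> is_ideal (leadI I).
Proof.
move=> hI; split.
- by exists 0; split; [exact: ideal0 | rewrite lead_coef0].
- have hD f g : (size g <= size f)%N -> I f -> I g ->
    leadI I (lead_coef f + lead_coef g).
    move=> hs hf hg; pose h := f + g * 'X^(size f - size g).
    have Ih : I h by apply: idealD => //; apply: idealMr.
    case: (eqVneq (lead_coef f + lead_coef g) 0) => [->|n0].
      by exists 0; split; [exact: ideal0 | rewrite lead_coef0].
    have hc : h`_(size f).-1 = lead_coef f + lead_coef g.
      rewrite coefD coefMXn -lead_coefE; case: (posnP (size g)) => [g0|gp].
        move/eqP: g0; rewrite size_poly_eq0 => /eqP ->.
        by rewrite coef0 if_same lead_coef0.
      have -> : ((size f).-1 < size f - size g)%N = false by apply/negbTE; lia.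
      by congr (_ + g`__); lia.
    exists h; split=> //; rewrite -hc lead_coefE; congr h`_(_.-1).
    apply/eqP; rewrite eqn_leq; apply/andP; split.
      rewrite (leq_trans (size_polyD _ _)) // geq_max leqnn /=.
      have hle : ((size g + (size f - size g).+1).-1 <= size f)%N by lia.
      by apply: leq_trans (size_polyMleq _ _) _; rewrite size_polyXn.
    rewrite -(@prednK (size f)).
      by rewrite ltnNge; apply/negP => /(nth_default 0) e; rewrite -hc e eqxx in n0.
    rewrite lt0n size_poly_eq0; apply/eqP => f0; move: n0; rewrite f0 size_poly0 in hs *.
    by move: hs; rewrite leqn0 size_poly_eq0 => /eqP ->; rewrite lead_coef0 addr0 eqxx.
  move=> _ _ [f [hf <-]] [g [hg <-]].
  by case: (leqP (size g) (size f)) => [|/ltnW] hs; [|rewrite addrC]; apply: hD.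
- move=> a _ [f [hf <-]]; case: (eqVneq (a * lead_coef f) 0) => [->|n0].
    by exists 0; split; [exact: ideal0 | rewrite lead_coef0].
  exists (a%:P * f); split; first exact: idealMl.
  by rewrite lead_coef_proper_mul lead_coefC.
Qed.

(** Let p be the contraction of [P]. If P = p[X], no height is lost in passing to p, which lies in
    [m]. Otherwise one is lost, but an element of [P] outside p[X] gives a leading coefficient in
    [m] outside p, so [m] is strictly larger than p. *)
Lemma leadI_height_prime P (m : B -> Prop) (k : nat) : noetherian B -> height_ge P k -> is_prime_ideal m ->
  incl (leadI P) m -> height_ge m k.
Proof.
move=> HN hPh hm hlm; have hP := height_ge_prime hPh.
have [Q /(contr_chain HN) [L [/chain_height_ge h1 h2 h3]]] := height_ge_chain hPh.
have hcm : incl (contr P) m.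
  by move=> b hb; apply: hlm; exists b%:P; rewrite lead_coefC.
have hcp := contr_prime hP.
case: (classic (incl P (ext (contr P)))) => [/h3 hL|/not_incl [f [hf nf]]].
  by apply: height_ge_leq hL _; apply: height_ge_incl h1 hm hcm.
apply: (height_ge_leq h2); apply: (height_ge_lt h1) => // hmc.
have [g [g1 _ [g0|g3]]] := strip f (prime_ideal hcp).
  by apply: nf; move: g1; rewrite g0 subr0.
apply: g3; apply: hmc; apply: hlm; exists g; split=> //.
have <- : f - (f - g) = g by ring.
apply: idealB => //; first exact: prime_ideal.
by move: g1; apply: ext_contr => //; apply: prime_ideal.
Qed.

(** [m] contains the leading coefficients of one of the finitely many primes over [I]: otherwise a
    product of elements of these primes would lie in [I] with leading coefficient outside [m]. *)
Lemma leadI_height I (k : nat) : noetherian B -> is_ideal I ->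
  (forall P, is_prime_ideal P -> incl I P -> height_ge P k) ->
  forall m, is_prime_ideal m -> incl (leadI I) m -> height_ge m k.
Proof.
move=> HN hI hh m hm hlm.
have [ps [h1 h2]] := primes_overP (hilbert_basis HN) hI.
suff [P [hP hPm]] : exists P, List.In P ps /\ incl (leadI P) m.
  have [hPp hIP] := h1 P hP; exact: (leadI_height_prime HN (hh P hPp hIP)).
apply: NNPP => hno.
have hx P : exists f, List.In P ps -> P f /\ ~ m (lead_coef f).
  case: (classic (List.In P ps)) => [hP|nP]; last by exists 0.
  have [_ [[f [hf <-]] hfm]] : exists c, leadI P c /\ ~ m c.
    by apply: not_incl => h'; apply: hno; exists P.
  by exists f.
pose F P := sval (constructive_indefinite_description _ (hx P)).
have hF P : List.In P ps -> P (F P) /\ ~ m (lead_coef (F P)).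
  by rewrite /F; case: constructive_indefinite_description.
have hI1 : I (\prod_(P <- ps) F P) by apply: h2 => P /hF [].
suff hprod : ~ m (lead_coef (\prod_(P <- ps) F P)).
  by apply: hprod; apply: hlm; exists (\prod_(P <- ps) F P).
elim: (ps) hF => [|P s IHs] hF.
  by rewrite big_nil lead_coef1; apply: prime1.
rewrite big_cons.
have [] // := @lead_mul m (F P) (\prod_(Q <- s) F Q) hm.
  by case: (hF P (or_introl erefl)).
by apply: IHs => Q hQ; apply: hF; right.
Qed.

End PolynomialPrimes.

(** * Contracting a polynomial ring onto its coefficients *)

Section Transfer.
Variables (A B : comNzRingType) (phi : {rmorphism A -> B}).

Lemma preim_ideal (I : B -> Prop) : is_ideal I -> is_ideal (fun a => I (phi a)).
Proof.
move=> hI; split=> [|x y hx hy|a x hx].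
- by rewrite rmorph0; apply: ideal0.
- by rewrite rmorphD; apply: idealD.
- by rewrite rmorphM; apply: idealMl.
Qed.

Lemma preim_prime (P : B -> Prop) : is_prime_ideal P -> is_prime_ideal (fun a => P (phi a)).
Proof.
move=> [hP h1 hM]; split; first exact: preim_ideal.
  by rewrite rmorph1.
by move=> x y; rewrite rmorphM; apply: hM.
Qed.

Hypothesis phi_surj : forall b, exists a, phi a = b.

Lemma noetherian_surj : noetherian A -> noetherian B.
Proof.
move=> HN I hI hinc.
have [||k0 hk] := HN (fun k a => I k (phi a)).
- by move=> k; apply: preim_ideal.
- by move=> k x; apply: hinc.
exists k0 => k hk0 b; have [a <-] := phi_surj b; exact: hk.
Qed.

Lemma height_ge_preim (P : B -> Prop) h : height_ge P h -> height_ge (fun a => P (phi a)) h.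
Proof.
elim: h P => [|h IH] P [hP].
  by split=> //; apply: preim_prime.
move=> [Q [/IH hQ h1 h2]]; apply: (height_ge_lt hQ).
- exact: preim_prime.
- by move=> a; apply: h1.
- by move=> h3; apply: h2 => b; have [a <-] := phi_surj b; apply: h3.
Qed.

Lemma dim_surj d : dim_le A d -> dim_le B d.
Proof. by move=> hd P /height_ge_preim /hd. Qed.

End Transfer.

(* [A] contracts onto [C] along a parameter [t], in such a way that some element of
   a given ideal of large height becomes monic in [t]. *)
Definition contractible (C A : comNzRingType) (iota : {rmorphism C -> A}) (h : nat) :=
  forall I : A -> Prop, is_ideal I ->
  (forall P, is_prime_ideal P -> incl I P -> height_ge P h) ->
  exists (sigma : {rmorphism A -> {poly A}}) (pi : {rmorphism A -> C}) (m : A),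
    [/\ I m, sigma m \is monic, forall a, (sigma a).[1] = a
      & forall a, (sigma a).[0] = iota (pi a)].

(** Without variables an ideal of height above the dimension is the unit ideal, and 1 is already
    monic. *)
Lemma contractible_id (C : comNzRingType) h : noetherian C -> dim_le C h ->
  contractible (idfun : {rmorphism C -> C}) h.+1.
Proof.
move=> HN hd I hI hh.
have h1 : I 1.
  by apply: no_prime_unit => // P hP hIP; apply: (hd P); apply: hh.
exists (@polyC C : {rmorphism C -> {poly C}}), (idfun : {rmorphism C -> C}), 1.
by split=> //= [|a|a]; rewrite ?hornerC // monic1.
Qed.

(** * Adjoining one variable *)

Section ContractiblePoly.
Variables (C B : comNzRingType) (iota : {rmorphism C -> B}) (h : nat).
Hypotheses (HN : noetherian B) (hB : contractible iota h).

Section Path.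
Variables (sigma : {rmorphism B -> {poly B}}) (N : nat).

Definition path_coef : B -> {poly {poly B}} := map_poly (@polyC B) \o sigma.
HB.instance Definition _ := GRing.RMorphism.on path_coef.

(* The image of the variable x: here ['X%:P] is x and ['X] is the parameter t, so this
   is t x + t^N - t, equal to x at t = 1 and to 0 at t = 0. *)
Definition path_var : {poly {poly B}} := 'X%:P * 'X + 'X^N - 'X.

Lemma path_comm : commr_rmorph path_coef path_var.
Proof. by move=> a; apply: mulrC. Qed.

Definition path_poly : {rmorphism {poly B} -> {poly {poly B}}} := horner_morph path_comm.

Lemma path_polyE p : path_poly p = (map_poly path_coef p).[path_var].
Proof. by []. Qed.

Lemma path_coef_eval b c : (path_coef b).[c%:P] = ((sigma b).[c])%:P.
Proof. by rewrite /path_coef /= horner_map. Qed.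

Lemma path_eval p c : (path_poly p).[c%:P] =
  (map_poly (polyC \o horner_eval c \o sigma) p).[path_var.[c%:P]].
Proof.
rewrite path_polyE -[LHS]/(horner_eval c%:P _) -horner_map -map_poly_comp.
congr (_.[_]); apply: eq_map_poly => b /=.
by rewrite /horner_eval path_coef_eval.
Qed.

Lemma path_eval1 p : (forall b, (sigma b).[1] = b) -> (path_poly p).[1] = p.
Proof.
move=> h1; rewrite -[X in _.[X]]polyC1 path_eval.
have -> : path_var.[1%:P] = 'X.
  rewrite /path_var !hornerE ?hornerXn ?expr1n polyC1 ?hornerE; ring.
rewrite (eq_map_poly (g := @polyC B)); last by move=> b /=; rewrite /horner_eval h1.
exact: comp_polyXr.
Qed.

Lemma path_eval0 p : (0 < N)%N -> (path_poly p).[0] = ((sigma p`_0).[0])%:P.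
Proof.
move=> hN; rewrite -[X in _.[X]]polyC0 path_eval.
have -> : path_var.[0%:P] = 0.
  rewrite /path_var !hornerE ?hornerXn polyC0 expr0n eqn0Ngt hN /=.
  exact: subrr.
by rewrite [LHS]horner_coef0 coef_map_id0 //= /horner_eval rmorph0 horner0.
Qed.

End Path.

Lemma size_path_coef (sigma : {rmorphism B -> {poly B}}) b :
  size (path_coef sigma b) = size (sigma b).
Proof. by rewrite /path_coef /= size_map_inj_poly //; apply: polyC_inj. Qed.

(** [N] exceeds the degrees in t of all coefficients by enough that different powers of the image of
    x cannot interfere: the image of the leading term dominates. The summand 2 makes t^N the leading
    term of t x + t^N - t. *)
Lemma path_monic (sigma : {rmorphism B -> {poly B}}) p :
  sigma (lead_coef p) \is monic ->
  exists N, (0 < N)%N /\ path_poly sigma N p \is monic.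
Proof.
move=> hm; pose N := (2 + \max_(i < size p) size (sigma p`_i)%R)%N.
exists N; split=> //.
have hp : (0 < size p)%N.
  rewrite lt0n size_poly_eq0; apply/eqP => p0; move: hm.
  by rewrite p0 lead_coef0 rmorph0 monicE lead_coef0 eq_sym oner_eq0.
pose y := path_var N.
have hX : (size ('X%:P * 'X - 'X : {poly {poly B}})%R < size ('X^N : {poly {poly B}})%R)%N.
  rewrite size_polyXn (leq_ltn_trans (size_polyD _ _)) // size_polyN size_polyX.
  rewrite gtn_max mul_polyC (leq_ltn_trans (size_scale_leq _ _)) ?size_polyX //.
have yE : y = 'X^N + ('X%:P * 'X - 'X) by rewrite /y /path_var; ring.
have ym : y \is monic by rewrite monicE yE lead_coefDl // lead_coefXn.
have ys : size y = N.+1 by rewrite yE size_polyDl // size_polyXn.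
have yXs i : size (y ^+ i) = (N * i).+1.
  elim: i => [|i IH]; first by rewrite expr0 size_poly1 muln0.
  by rewrite exprS size_monicM ?monic_neq0 ?monic_exp // IH ys; lia.
have hszm : (size (map_poly (path_coef sigma) p) <= size p)%N by apply: size_poly.
rewrite path_polyE (horner_coef_wide _ hszm) -/y.
have hcm i : (map_poly (path_coef sigma) p)`_i = path_coef sigma p`_i by rewrite coef_map.
under eq_bigr => i _ do rewrite hcm.
have hmax i : (i < size p)%N -> (size (sigma p`_i)%R + 2 <= N)%N.
  by move=> hi; rewrite addnC leq_add2l (leq_bigmax (Ordinal hi)).
move: hm hmax; rewrite lead_coefE; move: hp; case: (size p) => // e _ /= hm hmax.
rewrite big_ord_recr /=; set lo := \sum_(i < e) _; set top := path_coef sigma p`_e.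
have tm : top \is monic by rewrite /top /path_coef /= monic_map.
have htop : (N * e < size (top * y ^+ e)%R)%N.
  rewrite size_monicM ?monic_neq0 ?monic_exp // yXs.
  have : (0 < size top)%N by rewrite lt0n size_poly_eq0 monic_neq0.
  lia.
rewrite monicE lead_coefDr; last first.
  apply: leq_ltn_trans htop; apply: leq_trans (size_sum _ _ _) _.
  apply/bigmax_leqP => i _; apply: leq_trans (size_polyMleq _ _) _.
  rewrite yXs size_path_coef.
  have h1 : (size (sigma p`_i)%R <= N - 2)%N 
    by have := hmax i (ltnW (ltn_ord i)); move: (size _) => k; lia.
  have h2 : (N * i + N <= N * e)%N by rewrite -mulnSr leq_mul2l ltn_ord orbT.
  apply: (@leq_trans (N - 2 + (N * i).+1).-1); last by lia.
  by rewrite -!subn1 leq_sub2r // leq_add2r.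
by rewrite -monicE; apply: rpredM => //; apply: monic_exp.
Qed.

(** The hypothesis on [B] is applied to the ideal of leading coefficients, which still has large
    height; an element whose leading coefficient becomes monic becomes monic itself. *)
Lemma contractible_poly : contractible (polyC \o iota : {rmorphism C -> {poly B}}) h.
Proof.
move=> I hI hh.
have [m hm|sigma [pi [m [[f [hf fm]] h1 h2 h3]]]] := hB (leadI_ideal hI).
  by move=> hlm; apply: (leadI_height HN hI hh).
have [|N [hN hmon]] := @path_monic sigma f; first by rewrite fm.
exists (path_poly sigma N), (pi \o horner_eval 0 : {rmorphism _ -> _}), f.
split=> // [p|p]; first exact: path_eval1.
by rewrite path_eval0 //= h3 /horner_eval horner_coef0.
Qed.

End ContractiblePoly.

Lemma contractible_iso (C A B : comNzRingType) (iA : {rmorphism C -> A})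
  (iB : {rmorphism C -> B}) (phi : {rmorphism A -> B}) (psi : {rmorphism B -> A}) h :
  cancel phi psi -> cancel psi phi -> (forall c, phi (iA c) = iB c) ->
  contractible iA h -> contractible iB h.
Proof.
move=> phiK psiK hi hA I hI hh.
have surj b : exists a, phi a = b by exists (psi b).
have [|P hP hIP|sigma [pi [m [hm h1 h2 h3]]]] := hA (fun a => I (phi a)).
- exact: preim_ideal.
- have hP' : height_ge (fun b => P (psi b)) h.
    apply: hh; first exact: preim_prime.
    by move=> b hb; apply: hIP; rewrite psiK.
  have -> : P = (fun a => P (psi (phi a))).
    by apply: functional_extensionality => a; rewrite phiK.
  exact: height_ge_preim hP'.
exists (map_poly phi \o sigma \o psi : {rmorphism _ -> _}), (pi \o psi : {rmorphism _ -> _}), (phi m).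
split=> //= [|b|b].
- by rewrite phiK; apply: monic_map.
- by rewrite -(rmorph1 phi) horner_map h2 psiK.
- by rewrite -(rmorph0 phi) horner_map h3 /= hi.
Qed.

(** * Polynomials in several variables as iterated polynomials *)

Section MPoly.
Variable C : comNzRingType.

Lemma mpoly_rmorph_ext n (S : comNzRingType) (f g : {rmorphism {mpoly C[n]} -> S}) :
  (forall c, f c%:MP = g c%:MP) -> (forall i, f 'X_i = g 'X_i) -> f =1 g.
Proof.
move=> hC hX p; rewrite (mpolyE p) !rmorph_sum; apply: eq_bigr => m _.
rewrite -mul_mpolyC !rmorphM hC mpolyXE_id !rmorph_prod; congr (_ * _).
by apply: eq_bigr => i _; rewrite !rmorphXn hX.
Qed.

Lemma poly_rmorph_ext (B S : comNzRingType) (f g : {rmorphism {poly B} -> S}) :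
  (forall c, f c%:P = g c%:P) -> f 'X = g 'X -> f =1 g.
Proof.
move=> hC hX p; rewrite -(coefK p) poly_def !rmorph_sum; apply: eq_bigr => i _.
by rewrite -mul_polyC !rmorphM !rmorphXn hX hC.
Qed.

Variable n : nat.

Lemma unmuni_comm : commr_rmorph (@mwiden n C) 'X_ord_max.
Proof. by move=> a; apply: mulrC. Qed.

Definition unmuni : {rmorphism {poly {mpoly C[n]}} -> {mpoly C[n.+1]}} :=
  horner_morph unmuni_comm.

Lemma unmuniC p : unmuni p%:P = mwiden p.
Proof. exact: horner_morphC. Qed.
Lemma unmuniX : unmuni 'X = 'X_ord_max.
Proof. exact: horner_morphX. Qed.

Lemma muniX_max : muni 'X_ord_max = 'X :> {poly {mpoly C[n]}}.
Proof.
rewrite /muni mmapX mmap1U; case: splitP => // j /= /eqP.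
by rewrite gtn_eqF // ltn_ord.
Qed.

Lemma muniX_widen (i : 'I_n) : muni 'X_(widen_ord (leqnSn n) i) = ('X_i)%:P :> {poly {mpoly C[n]}}.
Proof.
rewrite /muni mmapX mmap1U; case: splitP => [j|k] /= h.
  by congr ('X__)%:P; apply: val_inj.
by have := ltn_ord i; rewrite h ltnNge leq_addr.
Qed.

Lemma ord_widen_max (i : 'I_n.+1) : i = ord_max \/ exists j, i = widen_ord (leqnSn n) j.
Proof.
case: (ltnP i n) => hi; last first.
  by left; apply: val_inj; apply/eqP; rewrite eqn_leq hi -ltnS ltn_ord.
by right; exists (Ordinal hi); apply: val_inj.
Qed.

Lemma mwidenXi (i : 'I_n) : mwiden ('X_i : {mpoly C[n]}) = 'X_(widen_ord (leqnSn n) i).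
Proof. by rewrite mwidenX mnmwiden1. Qed.

Lemma muniK : cancel (@muni n C) unmuni.
Proof.
apply: (@mpoly_rmorph_ext n.+1 _ (unmuni \o @muni n C : {rmorphism _ -> _}) idfun) => [c|i] /=.
  by rewrite muniC unmuniC mwidenC.
case: (ord_widen_max i) => [->|[j ->]]; first by rewrite muniX_max unmuniX.
by rewrite muniX_widen unmuniC mwidenXi.
Qed.

Lemma unmuniK : cancel unmuni (@muni n C).
Proof.
apply: (@poly_rmorph_ext _ _ (@muni n C \o unmuni : {rmorphism _ -> _}) idfun) => /=.
  move=> p; rewrite unmuniC; move: p.
  apply: (@mpoly_rmorph_ext n _ (@muni n C \o @mwiden n C : {rmorphism _ -> _}) (@polyC _)).
    by move=> c /=; rewrite mwidenC muniC.
  by move=> i /=; rewrite mwidenXi muniX_widen.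
by rewrite unmuniX muniX_max.
Qed.

End MPoly.

Lemma mpoly0K (C : comNzRingType) (v : 'I_0 -> C) :
  cancel (meval v) (@mpolyC 0 C).
Proof.
apply: (@mpoly_rmorph_ext C 0 _ (@mpolyC 0 C \o meval v : {rmorphism _ -> _}) idfun).
  by move=> c /=; rewrite mevalC.
by case.
Qed.

Theorem mpoly_contractible (C : comNzRingType) D n : noetherian C -> dim_le C D ->
  [/\ noetherian {mpoly C[n]}, dim_le {mpoly C[n]} (D + n)
    & contractible (@mpolyC n C : {rmorphism C -> {mpoly C[n]}}) D.+1].
Proof.
move=> HN hD; elim: n => [|n [IH1 IH2 IH3]].
  pose v (i : 'I_0) : C := 0.
  have surj p : exists c, (@mpolyC 0 C : {rmorphism _ -> _}) c = p.
    by exists (meval v p); apply: mpoly0K.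
  split.
  - exact: noetherian_surj surj HN.
  - by rewrite addn0; exact: (dim_surj surj hD).
  - apply: (@contractible_iso C C _ _ _ (@mpolyC 0 C) (meval v)) (contractible_id HN hD) => //.
    + by move=> c; apply: mevalC.
    + exact: mpoly0K.
have surj p : exists q, @unmuni C n q = p by exists (muni p); apply: muniK.
split.
- exact: noetherian_surj surj (hilbert_basis IH1).
- by rewrite addnS; exact: (dim_surj surj (dim_poly IH1 IH2)).
- apply: (contractible_iso (@unmuniK C n) (@muniK C n) _ (contractible_poly IH1 IH3)).
  by move=> c /=; rewrite unmuniC mwidenC.
Qed.

(** * Elimination of a monic variable *)

Section MonicElimination.
Variable A : comNzRingType.
Hypothesis HN : noetherian A.
Implicit Types (P : A -> Prop) (F : {poly A}) (I Q : {poly A} -> Prop).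

(** Lying over for the finite algebra A[t]/I: if I meets A inside [P], then I + P[t] also meets A
    inside [P], and an ideal containing it that is maximal among those avoiding the constants
    outside [P] is a prime over [P]. *)
Lemma monic_elimination F I P : F \is monic -> is_ideal I -> I F -> is_prime_ideal P ->
  (forall Q, is_prime_ideal Q -> incl I Q -> contr Q <> P) ->
  exists b, I b%:P /\ ~ P b.
Proof.
move=> Fm hI hF hP hno; apply: NNPP => hb.
have {}hb b : I b%:P -> P b by move=> h; apply: NNPP => h2; apply: hb; exists b.
have Pid := prime_ideal hP; have eid := ext_ideal Pid.
pose J f := exists g e, [/\ I g, ext P e & f = g + e].
have hJ : is_ideal J.
  split.
  - by exists 0, 0; split; rewrite ?addr0 //; apply: ideal0.
  - move=> _ _ [g [e [h1 h2 ->]]] [g' [e' [h1' h2' ->]]]; exists (g + g'), (e + e').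
    by split; [exact: idealD | exact: (idealD eid) | rewrite addrACA].
  - move=> a _ [g [e [h1 h2 ->]]]; exists (a * g), (a * e).
    by split; [exact: idealMl | exact: (idealMl _ eid) | rewrite mulrDr].
have hJP s : J s%:P -> P s.
  move=> [g [e [hg he sE]]]; apply: NNPP => ns.
  pose d := (size F).-1.
  have sF : size F = d.+1 by rewrite /d prednK // lt0n size_poly_eq0 monic_neq0.
  (* The module A[t]/I is generated by t^i with i < deg F. As s is in I + P[t], division by [F]
     writes s t^i with coefficients in [P]; Nakayama makes the module vanish at [P], and the image
     of 1 gives the constant in I. *)
  have [|||i|a [na ha]] := @nakayama A {poly A} (@polyC A) P I hP _ _ _
    [seq 'X^i | i <- iota 0 d].
  - exact: ideal0.
  - by move=> x y hx hy; apply: idealD.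
  - by move=> b x hx; apply: idealMl.
  - rewrite size_map size_iota => hi.
    have [k [w [r [E hr hext]]]] := @pseudo_division A F (e * 'X^i) (monic_neq0 Fm).
    have {}hext : ext P r by apply: hext => //; apply: (idealMr _ eid).
    exists s, (fun j => r`_j); split=> //.
    have -> : \sum_(j < d) (r`_j)%:P * [seq 'X^i0 | i0 <- iota 0 d]`_j = r.
      have hr' : (size r <= d)%N by rewrite -ltnS -sF.
      rewrite -[RHS](coefK r) poly_def (big_ord_widen d (fun j => r`_j *: 'X^j) hr').
      rewrite [RHS]big_mkcond; apply: eq_bigr => j _ /=.
      rewrite (nth_map 0%N) ?size_iota // nth_iota // add0n mul_polyC.
      by case: ltnP => // h; rewrite nth_default // scale0r.
    rewrite (nth_map 0%N) ?size_iota // nth_iota // add0n /= sE mulrDl.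
    rewrite (monicP Fm) expr1n mul1r in E.
    rewrite E addrA addrK; apply: idealD => //; exact: idealMr.
  case: (posnP d) => hd.
    apply: (prime1 hP); apply: hb; suff <- : F = 1%:P by [].
    rewrite hd in sF; rewrite (size1_polyC (eq_leq sF)).
    by have := monicP Fm; rewrite lead_coefE sF /= => ->.
  apply: na; apply: hb; have := ha 0%N; rewrite size_map size_iota => /(_ hd).
  by rewrite (nth_map 0%N) ?size_iota // nth_iota // add0n expr0 mulr1.
have [|||Q [hQ hJQ hQS]] := @max_disjoint_prime _ J (fun f => exists s, f = s%:P /\ ~ P s)
   (hilbert_basis HN) hJ.
- by exists 1; split=> //; apply: prime1.
- move=> _ _ [s [-> ns]] [t [-> nt]]; exists (s * t); rewrite polyCM; split=> //.
  exact: primeM.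
- by move=> f hf [s [fE ns]]; apply: ns; apply: hJP; rewrite -fE.
apply: (hno Q hQ).
  by move=> g hg; apply: hJQ; exists g, 0; split; rewrite ?addr0 //; apply: (ideal0 eid).
apply: incl_antisym => s hs.
  by apply: NNPP => ns; apply: (hQS _ hs); exists s.
apply: hJQ; exists 0, s%:P; split; rewrite ?add0r //; first exact: ideal0.
by move=> i; rewrite coefC; case: eqP => _ //; apply: ideal0.
Qed.

(** Such a prime is one of the primes listed over P[t] + (F). If it lay strictly above one of them,
    the two together with P[t] would be three primes in one fibre, as the monic [F] is not in
    P[t]. *)
Lemma finitely_many_over (ps : seq (A -> Prop)) F : F \is monic ->
  (forall P, List.In P ps -> is_prime_ideal P) ->
  exists qs, (forall Q, List.In Q qs -> is_prime_ideal Q) /\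
    forall Q, is_prime_ideal Q -> Q F -> List.In (contr Q) ps -> List.In Q qs.
Proof.
move=> Fm; elim: ps => [|P ps IH] hps; first by exists [::].
have [|qs [h1 h2]] := IH; first by move=> P' hP'; apply: hps; right.
have hP := hps P (or_introl erefl); have hext := ext_prime hP.
have eid := prime_ideal hext.
have [qs' [h1' h2']] := primes_overP (hilbert_basis HN) (adj_ideal F eid).
exists (qs' ++ qs); split=> [Q /(List.in_app_or _ _ _)|Q hQ QF].
  by case=> [/h1' []|/h1].
case=> [PQ|hQ']; apply: List.in_or_app; last by right; apply: h2.
left; have hcP : incl P (contr Q) by rewrite PQ.
have hextQ : incl (ext P) Q by apply: ext_contr => //; apply: prime_ideal.
have [|Q0 [hQ0 hQ0Q]] := primes_over_below (conj h1' h2') hQ _.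
  by apply: adj_sub => //; apply: prime_ideal.
suff -> : Q = Q0 by [].
have [hQ0p hQ0F] := h1' Q0 hQ0.
apply: incl_antisym => //; apply: NNPP => nQ.
apply: (fibre_dim hext hQ0p hQ _ _ hQ0Q nQ).
- exact: incl_trans (adj_incl F) hQ0F.
- move=> /(_ F (hQ0F _ (adj_self F eid))) /(_ (size F).-1).
  by rewrite -lead_coefE (monicP Fm); apply: prime1.
rewrite -PQ => s hs i; rewrite coefC; case: eqP => // _.
by apply: ideal0; apply: prime_ideal.
Qed.

End MonicElimination.

(** * Elementary transvections on signed coordinates *)

(* A vector of signed coordinates is a function on [int] supported on [-r .. r]; in
   the even case ([o = false]) its coordinate [0] vanishes. *)
Section SignedVectors.
Variables (o : bool) (r : nat).

Definition valid (k : int) := (k != 0) && (`|k| <= r)%N.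

Section Ring.
Variable R : comNzRingType.
Implicit Types (u w : int -> R) (x : R) (i j k : int).

Definition tr i j x u : int -> R := fun k =>
  u k + x * (k == i)%:R * u j - x * (k == - j)%:R * u (- i).

Definition tr0 i x u : int -> R := fun k =>
  u k + 2%:R * x * (k == i)%:R * u 0 - x * (k == 0)%:R * u (- i)
      - x ^+ 2 * (k == i)%:R * u (- i).

Variant estep : (int -> R) -> (int -> R) -> Prop :=
| Estep i j x u of valid i & valid j & i != j & i != - j : estep u (tr i j x u)
| Estep0 i x u of o & valid i : estep u (tr0 i x u).

Inductive reach : nat -> (int -> R) -> (int -> R) -> Prop :=
| Reach0 n u : reach n u u
| ReachS n u1 u2 u3 of estep u1 u2 & reach n u2 u3 : reach n.+1 u1 u3.

Lemma reach1 u1 u2 : estep u1 u2 -> reach 1 u1 u2.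
Proof. by move=> h; apply: ReachS h (Reach0 _ _). Qed.

Lemma reach_leq n n' u1 u2 : (n <= n')%N -> reach n u1 u2 -> reach n' u1 u2.
Proof.
move=> hn h; elim: h n' hn => {n u1 u2} [n u n' _|n u1 u2 u3 h1 _ IH [//|n'] hn].
  exact: Reach0.
by apply: ReachS h1 _; apply: IH.
Qed.

Lemma reach_trans n n' u1 u2 u3 : reach n u1 u2 -> reach n' u2 u3 -> reach (n + n') u1 u3.
Proof.
move=> h; elim: h u3 => {n u1 u2} [n u u3|n u1 u2 u3 h1 _ IH u4 h4].
  by apply: reach_leq; apply: leq_addl.
by rewrite addSn; apply: ReachS h1 _; apply: IH.
Qed.

Lemma tr_at i j x u : i != - j -> tr i j x u i = u i + x * u j.
Proof. by move=> /negbTE h; rewrite /tr eqxx h /=; ring. Qed.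
Lemma tr_opp i j x u : i != - j -> tr i j x u (- j) = u (- j) - x * u (- i).
Proof. by rewrite eq_sym => /negbTE h; rewrite /tr eqxx h /=; ring. Qed.
Lemma tr_other i j x u k : k != i -> k != - j -> tr i j x u k = u k.
Proof. by move=> /negbTE h1 /negbTE h2; rewrite /tr h1 h2 /=; ring. Qed.

Lemma tr_inv i j x u : valid i -> valid j -> i != j -> i != - j ->
  tr i j (- x) (tr i j x u) = u.
Proof.
move=> /andP [i0 _] /andP [j0 _] ij iNj; apply: functional_extensionality => k.
have e1 : tr i j x u j = u j by rewrite tr_other // 1?eq_sym //; lia.
have e2 : tr i j x u (- i) = u (- i) by rewrite tr_other //; lia.
by rewrite {1}/tr e1 e2 /tr; ring.
Qed.

Lemma tr0_at i x u : i != 0 -> tr0 i x u i = u i + 2%:R * x * u 0 - x ^+ 2 * u (- i).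
Proof. by move=> /negbTE h; rewrite /tr0 eqxx h /=; ring. Qed.
Lemma tr0_0 i x u : i != 0 -> tr0 i x u 0 = u 0 - x * u (- i).
Proof. by rewrite eq_sym => /negbTE h; rewrite /tr0 eqxx h /=; ring. Qed.
Lemma tr0_other i x u k : k != i -> k != 0 -> tr0 i x u k = u k.
Proof. by move=> /negbTE h1 /negbTE h2; rewrite /tr0 h1 h2 /=; ring. Qed.

Lemma tr0_inv i x u : i != 0 -> tr0 i (- x) (tr0 i x u) = u.
Proof.
move=> i0; apply: functional_extensionality => k.
have e1 := tr0_0 x u i0.
have e2 : tr0 i x u (- i) = u (- i) by rewrite tr0_other //; lia.
rewrite {1}/tr0 e1 e2 /tr0; case: (eqVneq k i) => [->|_]; last by ring.
by rewrite (negbTE i0) /=; ring.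
Qed.

Lemma estep_sym u1 u2 : estep u1 u2 -> estep u2 u1.
Proof.
case=> {u1 u2} [i j x u hi hj hij hiNj|i x u ho hi].
  by rewrite -{2}(@tr_inv i j x u) //; apply: Estep.
by rewrite -{2}(@tr0_inv i x u); [apply: Estep0 | case/andP: hi].
Qed.

Lemma reach_sym n u1 u2 : reach n u1 u2 -> reach n u2 u1.
Proof.
elim=> {n u1 u2} [n u|n u1 u2 u3 /estep_sym /reach1 h1 _ h2]; first exact: Reach0.
by rewrite -addn1; apply: reach_trans h2 h1.
Qed.

Definition qf u : R := u 0 ^+ 2 + \sum_(i < r) u (i.+1)%:Z * u (- (i.+1)%:Z).

(** Isolates the hyperbolic plane of i; c is the value of the form on the other coordinates. *)
Lemma qf_split u i : valid i -> exists c, forall u',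
  (forall k, k != i -> k != - i -> u' k = u k) -> qf u' = c + u' i * u' (- i).
Proof.
move=> /andP [i0 hi].
have hn : (`|i|.-1 < r)%N by lia.
exists (u 0 ^+ 2 + \sum_(j < r | j != Ordinal hn) u (j.+1)%:Z * u (- (j.+1)%:Z)) => u' h.
rewrite /qf (bigD1 (Ordinal hn)) //= h; [|lia..].
have -> : u' (`|i|.-1.+1)%:Z * u' (- (`|i|.-1.+1)%:Z) = u' i * u' (- i).
  case: (ltrP 0 i) => h0; last rewrite mulrC.
    by have -> : (`|i|.-1.+1)%:Z = i by lia.
  have -> : (`|i|.-1.+1)%:Z = - i by lia.
  by rewrite opprK.
rewrite addrCA [LHS]addrC; congr (_ + _ + _); apply: eq_bigr => j hj.
have hj' : (j : nat) <> `|i|.-1 by move=> e; case/eqP: hj; apply: val_inj.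
by rewrite !h //; lia.
Qed.

Lemma qf_tr i j x u : valid i -> valid j -> i != j -> i != - j -> qf (tr i j x u) = qf u.
Proof.
move=> hi hj hij hiNj; case/andP: (hi) => i0 _; case/andP: (hj) => j0 _.
(* The transvection is split into its changes at i and at - j, each within one plane; the two
   changes of the form cancel. *)
pose w k := if k == i then u i + x * u j else u k.
have [c hc] := qf_split u hi; have [d hd] := qf_split w hj.
rewrite (hd (tr i j x u)); last first.
  move=> k kj kNj; rewrite /w; case: (eqVneq k i) => [->|ki]; first by rewrite tr_at.
  by rewrite tr_other.
have -> : qf u = c + u i * u (- i) by apply: hc.
have -> : d = qf w - w j * w (- j) by rewrite (hd w) // addrK.
have -> : qf w = c + w i * w (- i).
  by apply: hc => k /negbTE ki _; rewrite /w ki.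
rewrite tr_opp // tr_other; [|lia..].
rewrite /w eqxx.
have -> : (- i == i) = false by apply/negbTE; lia.
have -> : (j == i) = false by apply/negbTE; lia.
have -> : (- j == i) = false by apply/negbTE; lia.
ring.
Qed.

Lemma qf_tr0 i x u : valid i -> qf (tr0 i x u) = qf u.
Proof.
move=> hi; case/andP: (hi) => i0 _.
pose w k := if k == 0 then u 0 - x * u (- i) else u k.
have [c hc] := qf_split w hi.
rewrite (hc (tr0 i x u)); last first.
  move=> k ki kNi; rewrite /w; case: (eqVneq k 0) => [->|k0]; first by rewrite tr0_0.
  by rewrite tr0_other.
have -> : c = qf w - w i * w (- i) by rewrite (hc w) // addrK.
have -> : qf w = qf u - u 0 ^+ 2 + (u 0 - x * u (- i)) ^+ 2.
  rewrite /qf /w eqxx.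
  have -> : \sum_(k < r) (if (k.+1)%:Z == 0 then u 0 - x * u (- i) else u (k.+1)%:Z) *
      (if - (k.+1)%:Z == 0 then u 0 - x * u (- i) else u (- (k.+1)%:Z)) =
      \sum_(k < r) u (k.+1)%:Z * u (- (k.+1)%:Z).
    by apply: eq_bigr => k _.
  by set S := \sum_(k < r) _; ring.
rewrite tr0_at // tr0_other; [|lia..].
rewrite /w (negbTE i0).
have -> : (- i == 0) = false by apply/negbTE; lia.
ring.
Qed.

(** Unimodularity is asked of the nonzero indices alone. For an isotropic vector this loses nothing,
    since the square of the coordinate 0 lies in the ideal of the others. *)
Record good u : Prop := Good {
  good_qf : qf u = 0;
  good_unim : forall P, is_prime_ideal P -> exists k, valid k /\ ~ P (u k);
  good_supp : forall k, (r < `|k|)%N -> u k = 0;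
  good_even : ~~ o -> u 0 = 0 }.

Lemma qf0_coord0 u (P : R -> Prop) : is_prime_ideal P -> qf u = 0 ->
  (forall k, valid k -> P (u k)) -> P (u 0).
Proof.
move=> hP hq h; have [Pid _ hM] := hP.
suff : P (u 0 * u 0) by case/hM.
have -> : u 0 * u 0 = - \sum_(i < r) u (i.+1)%:Z * u (- (i.+1)%:Z).
  by apply/eqP; rewrite -subr_eq0 opprK -expr2; apply/eqP.
apply: idealN => //; apply: ideal_sum => // i _; apply: idealMl => //; apply: h.
by have := ltn_ord i; rewrite /valid; lia.
Qed.

Lemma good_notin u P : good u -> is_prime_ideal P -> ~ (forall k, valid k -> P (u k)).
Proof. by move=> /good_unim hu /hu [k [hk nk]] /(_ k hk). Qed.

(** For unimodularity the step is inverted: a prime containing the nonzero-index coordinates of [u2]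
    contains its coordinate 0 by isotropy, hence the coordinates of [u1]. *)
Lemma good_estep u1 u2 : estep u1 u2 -> good u1 -> good u2.
Proof.
move=> h hg; split.
- case: h hg => {u1 u2} [i j x u hi hj hij hiNj|i x u ho hi] [hq _ _ _].
    by rewrite qf_tr.
  by rewrite qf_tr0.
- move=> P hP; apply: NNPP => hno.
  have hall k : valid k -> P (u2 k).
    by move=> hk; apply: NNPP => nk; apply: hno; exists k.
  apply: (good_notin hg hP) => k hk.
  have hid := prime_ideal hP.
  have hq : qf u2 = 0.
    case: h hg {hno hall} => {u1 u2} [i j x u hi hj hij hiNj|i x u ho hi] [hq _ _ _].
      by rewrite qf_tr.
    by rewrite qf_tr0.
  have h0 := qf0_coord0 hP hq hall.
  have hopp l : valid l -> valid (- l) by rewrite /valid oppr_eq0 abszN.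
  case: (estep_sym h) hall h0 => {u1 u2 h hg hno hq} [i j x u hi hj hij hiNj|i x u ho hi] hall h0.
    rewrite /tr; apply: idealB => //; last by apply: idealMl => //; apply/hall/hopp.
    by apply: idealD => //; [exact: hall | apply: idealMl => //; exact: hall].
  rewrite /tr0; apply: idealB => //; last by apply: idealMl => //; apply/hall/hopp.
  apply: idealB => //; last by apply: idealMl => //; apply/hall/hopp.
  by apply: idealD => //; [exact: hall | apply: idealMl].
- case: h hg => {u1 u2} [i j x u hi hj hij hiNj|i x u ho hi] [_ _ hs _] k hk.
    by move: hi hj => /andP [_ hi] /andP [_ hj]; rewrite tr_other ?hs //; lia.
  by move: hi => /andP [i0 hi]; rewrite tr0_other ?hs //; lia.
- case: h hg => {u1 u2} [i j x u hi hj hij hiNj|i x u ho hi] [_ _ _ he] ho'.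
    by move: hi hj => /andP [i0 _] /andP [j0 _]; rewrite tr_other ?he //; lia.
  by rewrite ho in ho'.
Qed.

Lemma good_reach n u1 u2 : reach n u1 u2 -> good u1 -> good u2.
Proof. by elim=> // {n u1 u2} n u1 u2 u3 h1 _ IH /(good_estep h1). Qed.

End Ring.

Lemma reach_map (R S : comNzRingType) (f : {rmorphism R -> S}) n (u1 u2 : int -> R) :
  reach n u1 u2 -> reach n (f \o u1) (f \o u2).
Proof.
elim=> {n u1 u2} [n u|n u1 u2 u3 h1 _ IH]; first exact: Reach0.
apply: ReachS IH; case: h1 => {u1 u2 u3} [i j x u hi hj hij hiNj|i x u ho hi].
  have -> : f \o tr i j x u = tr i j (f x) (f \o u).
    apply: functional_extensionality => k /=.
    by rewrite /tr rmorphB rmorphD !rmorphM !rmorph_nat.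
  exact: Estep.
have -> : f \o tr0 i x u = tr0 i (f x) (f \o u).
  apply: functional_extensionality => k /=.
  by rewrite /tr0 !rmorphB rmorphD !rmorphM !rmorph_nat.
exact: Estep0.
Qed.

Lemma good_map (R S : comNzRingType) (f : {rmorphism R -> S}) (u : int -> R) :
  good u -> good (f \o u).
Proof.
case=> hq hu hs he; split=> [|P hP|k hk|ho] /=.
- rewrite -(rmorph0 f) -hq /qf rmorphD rmorphXn rmorph_sum; congr (_ + _).
  by apply: eq_bigr => i _; rewrite rmorphM.
- exact: (hu (fun a => P (f a)) (preim_prime f hP)).
- by rewrite hs // rmorph0.
- by rewrite he // rmorph0.
Qed.

End SignedVectors.

(** * General position *)

Section GeneralPosition.
Variables (o : bool) (r : nat) (R : comNzRingType).
Implicit Types (u w : int -> R) (P Q : R -> Prop) (qs : seq (R -> Prop)).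

Lemma avoid qs (a c : (R -> Prop) -> R) :
  (forall Q, List.In Q qs -> is_prime_ideal Q) ->
  exists f, forall Q, List.In Q qs -> Q (a Q + f * c Q) -> Q (a Q) /\ Q (c Q).
Proof.
move=> hqs.
(* Where both elements lie in [Q] nothing is to be achieved, and the pair is replaced by (1, 0),
   which never meets [Q]. *)
pose X Q := if excluded_middle_informative (Q (a Q) /\ Q (c Q)) then (1, 0) else (a Q, c Q).
have [Q hQ|f hf] := @avoid_primes R qs X.
  split; first exact: hqs.
  rewrite /X; case: excluded_middle_informative => //= _ [h1 _].
  by apply: (prime1 (hqs Q hQ)).
exists f => Q hQ h; apply: NNPP => hn; apply: (hf Q hQ).
by rewrite /X; case: excluded_middle_informative.
Qed.

(** A transvection changes two coordinates with one parameter. Each prime imposes only one of the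
    two conditions: the second concerns the primes containing a and c, for which the first is
    empty. *)
Lemma avoid2 qs a c a' c' : (forall Q, List.In Q qs -> is_prime_ideal Q) ->
  exists f, forall Q, List.In Q qs ->
    (Q (a + f * c) -> Q a /\ Q c) /\
    (Q a -> Q c -> Q (a' + f * c') -> Q a' /\ Q c').
Proof.
move=> hqs.
pose b Q := excluded_middle_informative (Q a /\ Q c).
have [f hf] := avoid (fun Q => if b Q then a' else a) (fun Q => if b Q then c' else c) hqs.
exists f => Q hQ; have := hf Q hQ; case: (b Q) => [[ha hc]|hn] h; split=> //.
by move=> ha hc; case: (hn (conj ha hc)).
Qed.

Definition gen (S : R -> Prop) x := forall J, is_ideal J -> (forall y, S y -> J y) -> J x.

Lemma gen_ideal S : is_ideal (gen S).
Proof.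
split=> [J hJ hS|x y hx hy J hJ hS|a x hx J hJ hS].
- exact: ideal0.
- by apply: idealD => //; [apply: hx | apply: hy].
- by apply: idealMl => //; apply: hx.
Qed.

Lemma gen_mem (S : R -> Prop) x : S x -> gen S x.
Proof. by move=> h J _; apply. Qed.

Definition posI w a b := gen (fun y => exists j, (a <= j <= b)%N /\ y = w j%:Z).

Lemma posI_incl w a b Q : is_prime_ideal Q ->
  (forall j, (a <= j <= b)%N -> Q (w j%:Z)) -> incl (posI w a b) Q.
Proof.
move=> /prime_ideal hQ h x hx; apply: hx => // _ [j [hj ->]]; exact: h.
Qed.

Lemma posI_mem w a b Q j : incl (posI w a b) Q -> (a <= j <= b)%N -> Q (w j%:Z).
Proof. by move=> h hj; apply: h; apply: gen_mem; exists j. Qed.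

(** Multiples of the coordinates in [ks] are added to the coordinate i one after another by [avoid].
    As [ks] contains no opposite indices, the coordinates still to be used stay intact. *)
Lemma absorb qs i (ks : seq int) u :
  (forall Q, List.In Q qs -> is_prime_ideal Q) -> valid r i ->
  (forall k, k \in ks -> [&& valid r k, k != i & k != - i]) ->
  (forall k k', k \in ks -> k' \in ks -> k' != - k) ->
  exists u', [/\ reach o r (size ks) u u',
    forall j, j != i -> - j \notin ks -> u' j = u j,
    forall k, k \in ks -> exists c, u' (- k) = u (- k) - c * u (- i),
    forall I, is_ideal I -> (forall k, k \in ks -> I (u k)) -> I (u' i - u i)
    & forall Q, List.In Q qs -> Q (u' i) -> Q (u i) /\ forall k, k \in ks -> Q (u k)].
Proof.
move=> hqs hi; elim: ks u => [|k ks IH] u hks hopp.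
  exists u; split=> //; first exact: Reach0.
  by move=> I hI _; rewrite subrr; apply: ideal0.
have /and3P [hk ki kNi] := hks k (mem_head _ _).
have i0 : i != 0 by case/andP: hi.
have [f hf] := avoid (fun=> u i) (fun=> u k) hqs.
pose u1 := tr i k f u.
have iNk : i != - k by lia.
have u1i : u1 i = u i + f * u k by apply: tr_at.
have u1Ni : u1 (- i) = u (- i) by rewrite /u1 tr_other //; lia.
have u1k k' : k' \in ks -> u1 k' = u k'.
  move=> hk'; rewrite /u1 tr_other //.
    by have := hks k'; rewrite inE hk' orbT => /(_ isT) /and3P [].
  by apply: hopp; rewrite ?mem_head // inE hk' orbT.
have [||u' [h1 h2 h3 h4 h5]] := IH u1.
- by move=> k' hk'; apply: hks; rewrite inE hk' orbT.
- by move=> k' k'' h h'; apply: hopp; rewrite inE ?h ?h' orbT.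
exists u'; split.
- by apply: ReachS h1; apply: Estep => //; rewrite eq_sym.
- move=> j ji; rewrite inE negb_or => /andP [jk hj].
  by rewrite h2 // /u1 tr_other //; lia.
- move=> k'; rewrite inE => /orP [/eqP ->|hk'].
    have e : u1 (- k) = u (- k) - f * u (- i) by apply: tr_opp.
    case: (boolP (k \in ks)) => hkks.
      have [c hc] := h3 k hkks; exists (f + c).
      by rewrite hc e u1Ni; ring.
    by exists f; rewrite h2 ?opprK //; lia.
  have [c hc] := h3 k' hk'; rewrite u1Ni in hc.
  have /and3P [_ k'i k'Ni] : [&& valid r k', k' != i & k' != - i].
    by apply: hks; rewrite inE hk' orbT.
  case: (eqVneq k' k) => [ek|nk].
    by exists (f + c); rewrite hc ek /u1 tr_opp //; ring.
  by exists c; rewrite hc /u1 tr_other //; lia.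
- move=> I hI hI1; have -> : u' i - u i = (u' i - u1 i) + f * u k by rewrite u1i; ring.
  apply: idealD => //; last by apply: idealMl => //; apply: hI1; apply: mem_head.
  by apply: h4 => // k' hk'; rewrite u1k //; apply: hI1; rewrite inE hk' orbT.
move=> Q hQ /(h5 Q hQ) [h6 h7]; rewrite u1i in h6; have [h8 h9] := hf Q hQ h6.
split=> // k'; rewrite inE => /orP [/eqP ->//|hk'].
by rewrite -u1k //; apply: h7.
Qed.

Hypothesis HN : noetherian R.

(* For a general alternating matrix S the coordinates of u_+ + S u_- generate an ideal of
   large height; S is chosen column by column, one column in each [block_step]. *)
Definition block_height k u := forall P, is_prime_ideal P ->
  (forall j, (1 <= j <= k)%N -> P (u j%:Z)) ->
  (exists j, (1 <= j <= k)%N /\ ~ P (u (- j%:Z))) -> height_ge P k.-1.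

(** The transvections T_{j,-K} with j <= k and K = k+1 are used. At a prime without u_{-K} each new
    coordinate j raises the height by one. A prime containing u_{-K} sees u_1, .., u_k unchanged,
    has height k-1 by hypothesis, and gains one from the new u_K. *)
Lemma block_step k u : (1 <= k < r)%N -> block_height k u ->
  exists u', reach o r k u u' /\ block_height k.+1 u'.
Proof.
move=> /andP [k1 kr] hk; pose K : int := k.+1%:Z.
have [psA hA] := primes_overP HN (gen_ideal (fun y => exists j, (1 <= j <= k)%N /\ y = u j%:Z)).
have H m : (m <= k)%N -> exists w, [/\ reach o r m u w,
    forall l : int, (forall j, (1 <= j <= m)%N -> l != j%:Z) -> l != K -> w l = u l,
    forall j, (1 <= j <= m)%N -> exists c, w j%:Z = u j%:Z + c * u (- K),
    forall P, is_prime_ideal P -> ~ P (u (- K)) ->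
       (forall j, (1 <= j <= m)%N -> P (w j%:Z)) -> height_ge P m
    & forall Q, List.In Q psA -> Q (u (- K)) -> Q (w K) ->
       forall j, (1 <= j <= m)%N -> Q (u (- j%:Z))].
  elim: m => [_|m IH hm].
    exists u; split=> //; first exact: Reach0.
    - by move=> j; lia.
    - by move=> Q _ _ _ j; lia.
  have [w [h1 h2 h3 h4 h5]] := IH (ltnW hm).
  have [psB hB] := primes_overP HN (gen_ideal (fun y => exists j, (1 <= j <= m)%N /\ y = w j%:Z)).
  pose M : int := m.+1%:Z.
  (* One parameter serves both kinds of primes: those containing u_{-K} look at the coordinate K,
     the others at the coordinate m+1. *)
  have [|f hf] := @avoid (psA ++ psB)
    (fun Q => if excluded_middle_informative (Q (u (- K))) then w K else w M)
    (fun Q => if excluded_middle_informative (Q (u (- K))) then - w (- M) else w (- K)).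
    by move=> Q hQ; case: (List.in_app_or _ _ _ hQ) => [/(proj1 hA) []|/(proj1 hB) []].
  have wNK : w (- K) = u (- K) by apply: h2 => [j _|]; rewrite /K; lia.
  have wNM : w (- M) = u (- M) by apply: h2 => [j _|]; rewrite /K /M; lia.
  have wM : w M = u M by apply: h2 => [j|]; rewrite /K /M; lia.
  pose w' := tr M (- K) f w.
  have w'M : w' M = w M + f * u (- K).
    by rewrite -wNK; apply: tr_at; rewrite /M /K; lia.
  have w'K : w' K = w K - f * w (- M).
    by rewrite -[K]opprK; apply: tr_opp; rewrite /M /K; lia.
  have w'o l : l != M -> l != K -> w' l = w l.
    by move=> lM lK; rewrite /w' tr_other // opprK.
  exists w'; split.
  - rewrite -addn1; apply: reach_trans h1 _; apply: reach1.
    by apply: Estep; rewrite /valid /M /K; lia.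
  - move=> l hl lK; rewrite w'o //; last by apply: hl; lia.
    by apply: h2 => // j hj; apply: hl; lia.
  - move=> j hj; case: (eqVneq j m.+1) => [->|nj]; first by exists f; rewrite -/M w'M wM.
    have [|c hc] := h3 j; first by lia.
    by exists c; rewrite w'o //; rewrite /M /K; lia.
  - move=> P hP nP hj.
    have w'w j : (1 <= j <= m)%N -> w' j%:Z = w j%:Z.
      by move=> hj'; rewrite w'o //; rewrite /M /K; lia.
    have [|Q [hQ hQP]] := primes_over_below hB hP _.
      by apply: posI_incl => // j hj'; rewrite -w'w //; apply: hj; lia.
    have [hQp hQI] := proj1 hB Q hQ.
    have nQ : ~ Q (u (- K)) by move=> h; apply: nP; apply: hQP.
    have hQm : height_ge Q m by apply: h4 => // j hj'; apply: (posI_mem hQI).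
    apply: (height_ge_lt hQm) => // hPQ.
    have hQM : Q (w M + f * w (- K)).
      by rewrite wNK -w'M; apply: hPQ; apply: hj; lia.
    have := hf Q (List.in_or_app _ _ _ (or_intror hQ)).
    case: excluded_middle_informative => [//|n0] /= h.
    by case: (h hQM); rewrite wNK.
  - move=> Q hQ hQK hQwK j hj.
    have := hf Q (List.in_or_app _ _ _ (or_introl hQ)).
    case: excluded_middle_informative => [n0|//] /= h.
    have [hw1 hw2] : Q (w K) /\ Q (- w (- M)).
      by apply: h; rewrite mulrN -w'K.
    case: (eqVneq j m.+1) => [->|nj]; last by apply: h5 => //; lia.
    rewrite -/M -wNM -[w _]opprK; apply: idealN => //.
    by apply: prime_ideal; case: (proj1 hA Q hQ).
have [u' [h1 h2 h3 h4 h5]] := H k (leqnn k).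
exists u'; split=> // P hP hj [j0 [hj0 nj0]].
have u'neg j : u' (- j%:Z) = u (- j%:Z) \/ j = 0%N.
  by case: (posnP j) => hj1; [right | left; apply: h2 => [l _|]; rewrite /K; lia].
have {}nj0 : ~ P (u (- j0%:Z)) by case: (u'neg j0) => [<-//|e]; lia.
case: (classic (P (u (- K)))) => [hPK|nPK]; last first.
  by apply: h4 => // j hj'; apply: hj; lia.
have hPu j : (1 <= j <= k)%N -> P (u j%:Z).
  move=> hj'; have [c hc] := h3 j hj'.
  have : P (u' j%:Z) by apply: hj; lia.
  have Pid := prime_ideal hP.
  by rewrite hc ideal_addr //; apply: idealMl.
have hj0k : (1 <= j0 <= k)%N.
  have : j0 <> k.+1 by move=> e; apply: nj0; rewrite e.
  by move: hj0; lia.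
have [|Q [hQ hQP]] := primes_over_below hA hP _; first exact: posI_incl.
have [hQp hQI] := proj1 hA Q hQ.
have hQk : height_ge Q k.-1.
  apply: hk => // [j hj'|]; first exact: (posI_mem hQI).
  by exists j0; split=> // h; apply: nj0; apply: hQP.
rewrite -(prednK k1); apply: (height_ge_lt hQk) => // hPQ.
apply: nj0; apply: hQP; apply: (h5 Q hQ) hj0k; first exact: hPQ.
by apply: hPQ; apply: hj; lia.
Qed.

Definition all_height u := forall P, is_prime_ideal P ->
  (forall j, (1 <= j <= r)%N -> P (u j%:Z)) -> height_ge P r.-1.

(** For the full block the proviso in [block_height] is automatic: by unimodularity a prime
    containing all positive coordinates misses a negative one. *)
Lemma all_height_reach u : (0 < r)%N -> good o r u -> exists u',
  reach o r (r.-1 * r.-1) u u' /\ all_height u'.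
Proof.
move=> r0 hu.
have H k : (k < r)%N -> exists u', reach o r (k * r.-1) u u' /\ block_height k.+1 u'.
  elim: k => [_|k IH hk].
    by exists u; split; [exact: Reach0 | move=> P hP _ _].
  have [u1 [h1 h2]] := IH (ltnW hk).
  have [|u2 [h3 h4]] := @block_step k.+1 u1 _ h2; first by lia.
  exists u2; split=> //; rewrite mulSn addnC; apply: reach_trans h1 _.
  by apply: reach_leq h3; lia.
have [|u' [h1 h2]] := H r.-1; first by lia.
exists u'; split=> // P hP hj; rewrite -{1}(prednK r0); apply: h2 => //.
  by rewrite prednK.
apply: NNPP => hno; apply: (good_notin (good_reach h1 hu) hP) => k hk.
case: (ltrP 0 k) => hk0.
  have -> : k = `|k|%N%:Z by lia.
  by apply: hj; move: hk; rewrite /valid; lia.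
apply: NNPP => nk; apply: hno; exists `|k|%N; rewrite prednK //; split.
  by move: hk; rewrite /valid; lia.
by have -> : - `|k|%N%:Z = k by lia.
Qed.

Definition tail_height k u := forall P, is_prime_ideal P ->
  (forall j, (2 <= j <= k)%N -> P (u j%:Z)) -> height_ge P k.-1.

(** u_1 and u_(k+2), .., u_r are absorbed into u_(k+1). A prime over u_2, .., u_k that contains the
    new coordinate contains all positive ones and has height r-1 at once; over any other such prime
    the height goes up by one. *)
Lemma tail_step k u : (1 <= k < r)%N -> all_height u -> tail_height k u ->
  exists u', [/\ reach o r r.-1 u u', all_height u' & tail_height k.+1 u'].
Proof.
move=> /andP [k1 kr] hall hk; pose K : int := k.+1%:Z.
have [ps hps] := primes_overP HN (gen_ideal (fun y => exists j, (2 <= j <= k)%N /\ y = u j%:Z)).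
pose ks : seq int := 1 :: [seq j%:Z | j <- iota k.+2 (r - k.+1)].
have mem_ks (l : int) : l \in ks = (l == 1) || (K < l <= r%:Z).
  rewrite inE; case: eqP => //= _; apply/mapP/idP => [[j]|hl].
    by rewrite mem_iota /K => hj ->; lia.
  by exists `|l|%N; rewrite ?mem_iota; move: hl; rewrite /K; lia.
have [||||u' [h1 h2 h3 h4 h5]] := @absorb ps K ks u.
- by move=> Q /(proj1 hps) [].
- by rewrite /valid /K; lia.
- by move=> l; rewrite mem_ks /valid /K; lia.
- by move=> l l'; rewrite !mem_ks /K; lia.
have u'j j : (1 <= j)%N -> j%:Z != K -> u' j%:Z = u j%:Z.
  by move=> j1 jK; apply: h2 => //; rewrite mem_ks /K; lia.
have hall' : forall P, is_prime_ideal P -> (forall j, (1 <= j <= r)%N -> j != k.+1 -> P (u' j%:Z)) ->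
    P (u' K) <-> P (u K).
  move=> P hP hj; have Pid := prime_ideal hP.
  rewrite -[u' K](subrK (u K)) addrC; apply: ideal_addr => //; apply: h4 => // l hl.
  have lE : l = `|l|%N%:Z by move: hl; rewrite mem_ks /K; lia.
  rewrite lE -u'j; [apply: hj | |]; move: hl; rewrite mem_ks /K; lia.
exists u'; split.
- by apply: reach_leq h1; rewrite /= size_map size_iota; lia.
- move=> P hP hj; apply: hall => // j hj'; case: (eqVneq j k.+1) => [->|nj].
    by apply/hall' => // [i hi _|]; apply: hj.
  by rewrite -u'j; [apply: hj | lia | rewrite /K; lia].
move=> P hP hj.
have [|Q [hQ hQP]] := primes_over_below hps hP _.
  by apply: posI_incl => // j hj'; rewrite -u'j; [apply: hj| |]; rewrite ?/K; lia.
have [hQp hQI] := proj1 hps Q hQ.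
have hQk : height_ge Q k.-1 by apply: hk => // j; apply: (posI_mem hQI).
case: (classic (incl P Q)) => [hPQ|nPQ]; last first.
  by rewrite -(prednK k1); apply: (height_ge_lt hQk).
have [|hQK hQks] := h5 Q hQ; first by apply: hPQ; apply: hj; lia.
apply: (@height_ge_leq _ P r.-1); first by rewrite /=; lia.
apply: (height_ge_incl _ hP hQP); apply: hall => // j hj'.
case: (ltngtP j k.+1) => hjk; last by rewrite hjk.
  case: (eqVneq j 1%N) => [->|j1]; first by apply: hQks; rewrite mem_ks.
  by apply: (posI_mem hQI); lia.
by apply: hQks; rewrite mem_ks /K; lia.
Qed.

Lemma general_position u : (0 < r)%N -> good o r u -> exists u',
  reach o r (2 * (r.-1 * r.-1)) u u' /\ tail_height r u'.
Proof.
move=> r0 hu; have [u1 [h1 h2]] := all_height_reach r0 hu.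
have H k : (k < r)%N -> exists u', [/\ reach o r (k * r.-1) u1 u', all_height u' & tail_height k.+1 u'].
  elim: k => [_|k IH hk]; first by exists u1; split=> //; exact: Reach0.
  have [u2 [h3 h4 h5]] := IH (ltnW hk).
  have [|u3 [h6 h7 h8]] := @tail_step k.+1 u2 _ h4 h5; first by lia.
  exists u3; split=> //; rewrite mulSn addnC; exact: reach_trans h3 h6.
have [|u2 [h3 _ h4]] := H r.-1; first by lia.
exists u2; split; last by rewrite prednK in h4.
by rewrite mul2n -addnn; apply: reach_trans h1 h3.
Qed.

End GeneralPosition.

(** * Moving the parameter *)

Section Moves.
Variables (o : bool) (r : nat).

Section SetCoordinates.
Variable R : comNzRingType.
Implicit Types (u w t : int -> R).

Lemma add_combination (ks : seq int) (c : int -> R) u : (0 < r)%N ->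
  (forall k, k \in ks -> [&& valid r k, k != 1 & k != - 1]) ->
  (forall k k', k \in ks -> k' \in ks -> k' != - k) ->
  exists u', [/\ reach o r (size ks) u u',
    forall j, j != 1 -> - j \notin ks -> u' j = u j
    & u' 1 = u 1 + \sum_(k <- ks) c k * u k].
Proof.
move=> r0; elim: ks u => [|k ks IH] u hks hopp.
  by exists u; split=> //; [exact: Reach0 | rewrite big_nil addr0].
have /and3P [hk k1 kN1] := hks k (mem_head _ _).
pose u1 := tr 1 k (c k) u.
have u1k k' : k' \in ks -> u1 k' = u k'.
  move=> hk'; rewrite /u1 tr_other //.
    by have := hks k'; rewrite inE hk' orbT => /(_ isT) /and3P [].
  by apply: hopp; rewrite ?mem_head // inE hk' orbT.
have [||u' [h1 h2 h3]] := IH u1.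
- by move=> k' hk'; apply: hks; rewrite inE hk' orbT.
- by move=> k' k'' h h'; apply: hopp; rewrite inE ?h ?h' orbT.
exists u'; split.
- by apply: ReachS h1; apply: Estep => //; rewrite /valid; lia.
- move=> j ji; rewrite inE negb_or => /andP [jk hj].
  by rewrite h2 // /u1 tr_other //; lia.
rewrite h3 big_cons addrA {1}/u1 tr_at; last by lia.
by congr (_ + _); apply: eq_big_seq => k' hk'; rewrite u1k.
Qed.

(* A hyperbolic coordinate pair lets one correct [u j] by any multiple of
   [b = p * u 1 + q * u 2], at the expense of [u (-1)] and [u (-2)]. *)
Lemma set_coord w t (b p q g : R) j : (2 < r)%N ->
  (if j == 0 then o else [&& valid r j, j != 1, j != - 1, j != 2 & j != - 2]) ->
  b = p * w 1 + q * w 2 -> (exists e, t j = w j + b * g * e) ->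
  (forall k, (k == - 1) || (k == - 2) -> exists e, t k = w k + g * e) ->
  exists w', [/\ reach o r 2 w w', w' j = t j,
    forall k, k != j -> k != - 1 -> k != - 2 -> w' k = w k
    & forall k, (k == - 1) || (k == - 2) -> exists e, t k = w' k + g * e].
Proof.
move=> r3 hj hb [e he] hN.
case: (eqVneq j 0) hj => [j0 ho|j0 /and5P [hj j1 jN1 j2 jN2]].
  subst j; pose w1 := tr0 (- 1) (- (g * e * p)) w; pose w2 := tr0 (- 2) (- (g * e * q)) w1.
  have w10 : w1 0 = w 0 + g * e * p * w 1 by rewrite /w1 tr0_0 // opprK; ring.
  have w1o k : k != - 1 -> k != 0 -> w1 k = w k by move=> *; rewrite /w1 tr0_other.
  have w20 : w2 0 = w1 0 + g * e * q * w1 2 by rewrite /w2 tr0_0 // opprK; ring.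
  have w2o k : k != - 2 -> k != 0 -> w2 k = w1 k by move=> *; rewrite /w2 tr0_other.
  exists w2; split.
  - by apply: (@ReachS o r R 1 w w1); last apply: reach1; apply: Estep0 => //; rewrite /valid; lia.
  - by rewrite w20 w10 w1o // he hb; ring.
  - by move=> k k0 kN1 kN2; rewrite w2o // w1o.
  move=> k hk; have [e' he'] := hN k hk; rewrite he'.
  case/orP: hk => /eqP ->.
    rewrite w2o // /w1 tr0_at // opprK.
    by exists (e' + 2%:R * (e * p) * w 0 + g * (e * p) ^+ 2 * w 1); ring.
  rewrite /w2 tr0_at // opprK (w1o (- 2)) // (w1o 2) //.
  by exists (e' + 2%:R * (e * q) * w1 0 + g * (e * q) ^+ 2 * w 2); ring.
pose w1 := tr j 1 (g * e * p) w; pose w2 := tr j 2 (g * e * q) w1.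
have w1j : w1 j = w j + g * e * p * w 1 by apply: tr_at.
have w1N1 : w1 (- 1) = w (- 1) - g * e * p * w (- j) by apply: tr_opp.
have w1o k : k != j -> k != - 1 -> w1 k = w k by move=> *; rewrite /w1 tr_other.
have w2j : w2 j = w1 j + g * e * q * w1 2 by apply: tr_at.
have w2N2 : w2 (- 2) = w1 (- 2) - g * e * q * w1 (- j) by apply: tr_opp.
have w2o k : k != j -> k != - 2 -> w2 k = w1 k by move=> *; rewrite /w2 tr_other.
exists w2; split.
- by apply: (@ReachS o r R 1 w w1); last apply: reach1; apply: Estep => //; rewrite /valid; lia.
- by rewrite w2j w1j w1o // 1?eq_sym // he hb; ring.
- by move=> k kj kN1 kN2; rewrite w2o // w1o.
move=> k hk; have [e' he'] := hN k hk; rewrite he'.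
case/orP: hk => /eqP ->.
  by rewrite w2o // 1?eq_sym // w1N1; exists (e' + e * p * w (- j)); ring.
by rewrite w2N2 w1o // 1?eq_sym //; exists (e' + e * q * w1 (- j)); ring.
Qed.

Lemma set_coord_neq j :
  (if j == 0 then o else [&& valid r j, j != 1, j != - 1, j != 2 & j != - 2]) ->
  [&& j != 1, j != - 1, j != 2 & j != - 2].
Proof. by case: eqP => [-> //|_ /andP []]. Qed.

Lemma set_coords w t (b p q g : R) js : (2 < r)%N ->
  (forall j, j \in js ->
     if j == 0 then o else [&& valid r j, j != 1, j != - 1, j != 2 & j != - 2]) ->
  b = p * w 1 + q * w 2 -> (forall j, j \in js -> exists e, t j = w j + b * g * e) ->
  (forall k, (k == - 1) || (k == - 2) -> exists e, t k = w k + g * e) ->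
  exists w', [/\ reach o r (2 * size js) w w', forall j, j \in js -> w' j = t j,
    forall k, k \notin js -> k != - 1 -> k != - 2 -> w' k = w k
    & forall k, (k == - 1) || (k == - 2) -> exists e, t k = w' k + g * e].
Proof.
move=> r3; elim: js w => [|j js IH] w hjs hb hd hN.
  by exists w; split=> //; exact: Reach0.
have hj := hjs j (mem_head _ _).
have [w1 [h1 h2 h3 h4]] := set_coord r3 hj hb (hd j (mem_head _ _)) hN.
have /and4P [j1 jN1 j2 jN2] := set_coord_neq hj.
have [||||w2 [h5 h6 h7 h8]] := IH w1.
- by move=> k hk; apply: hjs; rewrite inE hk orbT.
- by rewrite !h3 // eq_sym.
- move=> k hk; case: (eqVneq k j) => [->|kj]; first by exists 0; rewrite h2 mulr0 addr0.
  have hk' : k \in j :: js by rewrite inE hk orbT.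
  have /and4P [_ kN1 _ kN2] := set_coord_neq (hjs k hk').
  by have [e he] := hd k hk'; exists e; rewrite h3.
- exact: h4.
exists w2; split=> //.
- by rewrite /= mulnS; apply: reach_trans h1 h5.
- move=> k; rewrite inE; case: (boolP (k \in js)) => [/h6 //|hk]; rewrite orbF => /eqP kj.
  by subst k; rewrite h7.
- move=> k; rewrite inE negb_or => /andP [kj hk] kN1 kN2.
  by rewrite h7 // h3.
Qed.

Lemma set_negative w t (b p q : R) M : (2 < r)%N -> good o r w -> good o r t ->
  (forall x : R, b ^+ M.+1 * x = 0 -> b ^+ M * x = 0) ->
  b = p * w 1 + q * w 2 -> (forall k, k != - 1 -> k != - 2 -> w k = t k) ->
  (forall k, (k == - 1) || (k == - 2) -> exists e, t k = w k + b ^+ M.+1 * e) ->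
  reach o r 1 w t.
Proof.
move=> r3 hw ht hM hb hwt hN.
have [e1 he1] := hN (- 1) isT; have [e2 he2] := hN (- 2) isT.
have v1 : valid r 1 by rewrite /valid; lia.
have v2 : valid r 2 by rewrite /valid; lia.
pose w' k := if k == - 1 then t (- 1) else w k.
have [c1 hc1] := qf_split w v1; have [c2 hc2] := qf_split w' v2.
have E1 := hc1 w (fun _ _ _ => erefl).
have E2 : qf r w' = c1 + w' 1 * w' (- 1).
  by apply: hc1 => k k1 /negbTE kN1; rewrite /w' kN1.
have E3 := hc2 w' (fun _ _ _ => erefl).
have E4 : qf r t = c2 + t 2 * t (- 2).
  apply: hc2 => k k2 kN2; rewrite /w'; case: eqP => [-> //|/eqP kN1].
  by rewrite hwt.
rewrite (good_qf hw) in E1; rewrite (good_qf ht) in E4.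
rewrite E2 /w' /= in E3; rewrite -(hwt 2) // in E4.
have e0 : b ^+ M.+1 * (w 1 * e1 + w 2 * e2) = 0.
  have c1E : c1 = - (w 1 * w (- 1)) by rewrite -[c1](addrK (w 1 * w (- 1))) -E1 sub0r.
  have c2E : c2 = - (w 2 * t (- 2)) by rewrite -[c2](addrK (w 2 * t (- 2))) -E4 sub0r.
  move: E3; rewrite c1E c2E he1 he2 => E3.
  have -> : b ^+ M.+1 * (w 1 * e1 + w 2 * e2) =
    (- (w 1 * w (- 1)) + w 1 * (w (- 1) + b ^+ M.+1 * e1)) -
    (- (w 2 * (w (- 2) + b ^+ M.+1 * e2)) + w 2 * w (- 2)) by ring.
  by rewrite E3 subrr.
have {}e0 := hM _ e0.
(* One factor b has been cancelled from the relation; the same factor of b^(M+1) is spent here as p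
   w_1 + q w_2. *)
pose s := b ^+ M * (q * e1 - p * e2).
have -> : t = tr (- 1) 2 s w.
  apply: functional_extensionality => k.
  case: (eqVneq k (- 1)) => [->|kN1].
    rewrite tr_at // he1; congr (_ + _).
    transitivity (b ^+ M * b * e1 - p * (b ^+ M * (w 1 * e1 + w 2 * e2))).
      by rewrite e0 exprSr; ring.
    by rewrite {2}hb /s; ring.
  case: (eqVneq k (- 2)) => [->|kN2].
    rewrite tr_opp // he2 opprK; congr (_ + _).
    transitivity (b ^+ M * b * e2 - q * (b ^+ M * (w 1 * e1 + w 2 * e2))).
      by rewrite e0 exprSr; ring.
    by rewrite {2}hb /s; ring.
  by rewrite tr_other // hwt.
by apply: reach1; apply: Estep => //; rewrite /valid; lia.
Qed.

End SetCoordinates.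

Lemma horner_sub_dvd (A : comNzRingType) (f : {poly A}) (a c : A) :
  exists D : {poly A}, forall z, f.[z] = f.[a] + (z - a) * D.[z].
Proof.
have /factor_theorem [D hD] : root (f - (f.[a])%:P) a by rewrite /root !hornerE subrr.
exists D => z; have := congr1 (horner^~ z) hD; rewrite /= !hornerE => h.
by rewrite mulrC -h addrC subrK.
Qed.

Definition coords : seq int :=
  (if o then [:: 0] else [::]) ++ [seq j%:Z | j <- iota 3 (r - 2)]
                             ++ [seq - j%:Z | j <- iota 3 (r - 2)].

Lemma mem_coords k : (k \in coords) =
  (if k == 0 then o else [&& valid r k, k != 1, k != - 1, k != 2 & k != - 2]).
Proof.
rewrite /coords !mem_cat.
have -> : (k \in [seq j%:Z | j <- iota 3 (r - 2)]) = (2%:Z < k <= r%:Z).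
  apply/mapP/idP => [[j]|hk]; first by rewrite mem_iota => hj ->; lia.
  by exists `|k|%N; rewrite ?mem_iota; lia.
have -> : (k \in [seq - j%:Z | j <- iota 3 (r - 2)]) = (2%:Z < - k <= r%:Z).
  apply/mapP/idP => [[j]|hk]; first by rewrite mem_iota => hj ->; lia.
  by exists `|k|%N; rewrite ?mem_iota; lia.
by case: o; rewrite ?inE; case: eqP => [->|k0]; rewrite /valid //=; lia.
Qed.

Lemma size_coords : (2 < r)%N -> (2 * size coords = 4 * r - 8 + 2 * o)%N.
Proof. by move=> r3; rewrite /coords !size_cat !size_map !size_iota; case: o => /=; lia. Qed.

Section Move.
Variables (A : comNzRingType) (V : int -> {poly A}) (p q : {poly A}) (b : A).
Hypothesis HN : noetherian A.

Definition ev (z : A) : int -> A := horner_eval z \o V.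

(* In [SL_3] on the coordinates 1, 2, 3: pass from [z] to [z1 = z + h y] with
   multiples of [h = V_3(z)], replace [h] by [h + b^K], and pass from [z1] to
   [z - b^K y] with multiples of [h + b^K]. *)
Lemma move : (2 < r)%N -> good o r V -> p * V 1 + q * V 2 = b%:P ->
  exists K, forall z y, reach o r (4 * r - 1 + 2 * o) (ev z) (ev (z - b ^+ K * y)).
Proof.
move=> r3 hV hpq; have [M hM] := torsion_bound b HN.
(* Of the M+3 factors b, one is written as p V_1 + q V_2 to change h, one is spent in [set_coords],
   and [set_negative] needs M+1. *)
exists M.+3 => z y; pose z' := z - b ^+ M.+3 * y.
pose u := ev z; pose t := ev z'; rewrite -/u -/z' -/t.
have hu : good o r u by apply: good_map.
have ht : good o r t by apply: good_map.
pose h := u 3; pose z1 := z + h * y; pose be := b ^+ M.+2.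
(* The quotients are centred at z1 because both ends are compared with it: z - z1 = - h y and z' -
   z1 = - (h + b^K) y. *)
have [D1 hD1] := horner_sub_dvd (V 1) z1 0; have [D2 hD2] := horner_sub_dvd (V 2) z1 0.
have hz a : p.[a] * (V 1).[a] + q.[a] * (V 2).[a] = b.
  by have := congr1 (horner^~ a) hpq; rewrite /= !hornerE.
have hdvd (f : {poly A}) : exists c, f.[z'] = f.[z] + be * c.
  have [D hD] := horner_sub_dvd f z 0; exists (- (b * y * D.[z'])).
  by rewrite hD /z' /be exprSr; ring.
pose la := y * D1.[z]; pose mu := y * D2.[z].
pose la' := - y * D1.[z']; pose mu' := - y * D2.[z'].
pose f1 := (V 1).[z1]; pose g1 := (V 2).[z1].
have f1E : f1 = u 1 + la * h.
  have := hD1 z; rewrite -/f1 /la /z1 /u /ev /= /horner_eval => ->; ring.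
have g1E : g1 = u 2 + mu * h.
  have := hD2 z; rewrite -/g1 /mu /z1 /u /ev /= /horner_eval => ->; ring.
have t1E : t 1 = f1 + la' * (h + be * b).
  rewrite /t /ev /= /horner_eval hD1 -/f1 /la' /z1 /z' /be exprSr; ring.
have t2E : t 2 = g1 + mu' * (h + be * b).
  rewrite /t /ev /= /horner_eval hD2 -/g1 /mu' /z1 /z' /be exprSr; ring.
pose x := be * p.[z1]; pose x' := be * q.[z1].
have xE : x * f1 + x' * g1 = be * b by rewrite -(hz z1) /x /x' /f1 /g1; ring.
pose u1 := tr 1 3 la u; pose u2 := tr 2 3 mu u1; pose u3 := tr 3 1 x u2.
pose u4 := tr 3 2 x' u3; pose u5 := tr 1 3 la' u4; pose u6 := tr 2 3 mu' u5.
pose m := u (- 3) - la * u (- 1) - mu * u (- 2).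
have u1a : u1 1 = f1 by rewrite f1E /u1 tr_at.
have u1b : u1 (- 3) = u (- 3) - la * u (- 1) by rewrite /u1 tr_opp.
have u1o k : k != 1 -> k != - 3 -> u1 k = u k by move=> *; rewrite /u1 tr_other.
have u2a : u2 2 = g1 by rewrite g1E /u2 tr_at // !u1o.
have u2b : u2 (- 3) = m by rewrite /u2 tr_opp // u1b u1o.
have u2o k : k != 2 -> k != - 3 -> u2 k = u1 k by move=> *; rewrite /u2 tr_other.
have u3a : u3 3 = h + x * f1 by rewrite /u3 tr_at // !u2o // u1a u1o.
have u3b : u3 (- 1) = u (- 1) - x * m by rewrite /u3 tr_opp // u2b u2o // u1o.
have u3o k : k != 3 -> k != - 1 -> u3 k = u2 k by move=> *; rewrite /u3 tr_other.
have u4a : u4 3 = h + be * b by rewrite /u4 tr_at // u3a u3o // u2a -addrA xE.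
have u4b : u4 (- 2) = u (- 2) - x' * m.
  by rewrite /u4 tr_opp // !u3o // u2b u2o // u1o.
have u4o k : k != 3 -> k != - 2 -> u4 k = u3 k by move=> *; rewrite /u4 tr_other.
have u5a : u5 1 = t 1 by rewrite /u5 tr_at // u4a u4o // u3o // u2o // u1a t1E.
have u5b : u5 (- 3) = m - la' * (u (- 1) - x * m).
  by rewrite /u5 tr_opp // !u4o // u3b u3o // u2b.
have u5o k : k != 1 -> k != - 3 -> u5 k = u4 k by move=> *; rewrite /u5 tr_other.
have u6a : u6 2 = t 2.
  by rewrite /u6 tr_at // !u5o // u4a u4o // u3o // u2a t2E.
have u6b : u6 (- 3) = m - la' * (u (- 1) - x * m) - mu' * (u (- 2) - x' * m).
  by rewrite /u6 tr_opp // u5b u5o // u4b.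
have u6o k : k != 2 -> k != - 3 -> u6 k = u5 k by move=> *; rewrite /u6 tr_other.
have h6 : reach o r 6 u u6.
  apply: (@ReachS o r A 5 u u1); last apply: (@ReachS o r A 4 u1 u2);
  last apply: (@ReachS o r A 3 u2 u3); last apply: (@ReachS o r A 2 u3 u4);
  last apply: (@ReachS o r A 1 u4 u5); last apply: reach1;
  by apply: Estep => //; rewrite /valid; lia.
have u61 : u6 1 = t 1 by rewrite u6o.
have cong k : k != 1 -> k != 2 -> exists e, t k = u6 k + be * e.
  move=> k1 k2; have [c hc] := hdvd (V k).
  have {}hc : t k = u k + be * c by [].
  (* At -3 the shifts by la and la' nearly cancel: la + la' is y times D1(z) - D1(z'), which is
     divisible by z - z', and likewise for mu. *)
  case: (eqVneq k (- 3)) => [kE|kN3].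
    have [E1 hE1] := horner_sub_dvd D1 z 0; have [E2 hE2] := horner_sub_dvd D2 z 0.
    rewrite hc kE u6b /m /la' /mu' hE1 hE2 /la /mu /z'.
    set d1 := D1.[z]; set d2 := D2.[z]; set e1 := E1.[_]; set e2 := E2.[_].
    rewrite /x /x' exprSr -/be; set M0 := u (- 3) - _ - _.
    exists (y * (b * y) * (e1 * u (- 1) + e2 * u (- 2)) + c
      + y * M0 * ((d1 - be * b * y * e1) * p.[z1] + (d2 - be * b * y * e2) * q.[z1])).
    by rewrite /M0; ring.
  have [e he] : exists e, u6 k = u k + be * e.
    case: (eqVneq k 3) => [->|k3]; first by exists b; rewrite u6o // u5o // u4a.
    case: (eqVneq k (- 1)) => [->|kN1].
      by exists (- (p.[z1] * m)); rewrite u6o // u5o // u4o // u3b /x; ring.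
    case: (eqVneq k (- 2)) => [->|kN2].
      by exists (- (q.[z1] * m)); rewrite u6o // u5o // u4b /x'; ring.
    by exists 0; rewrite u6o // u5o // u4o // u3o // u2o // u1o // mulr0 addr0.
  by exists (c - e); rewrite hc he; ring.
have beE : be = b * b ^+ M.+1 by rewrite /be exprS.
have hb6 : b = p.[z'] * u6 1 + q.[z'] * u6 2 by rewrite u61 u6a /t /ev /= /horner_eval hz.
have [||||w [h7 h8 h9 h10]] := @set_coords A u6 t b p.[z'] q.[z'] (b ^+ M.+1) coords r3.
- by move=> j; rewrite mem_coords.
- exact: hb6.
- move=> j; rewrite mem_coords => /set_coord_neq /and4P [j1 _ j2 _].
  by rewrite -beE; apply: cong.
- move=> k hk; have [||e he] := cong k; [by case/orP: hk => /eqP -> .. |].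
  by exists (b * e); rewrite he beE; ring.
have h67 := reach_trans h6 h7.
have hw : good o r w by apply: good_reach h67 hu.
suff h11 : reach o r 1 w t.
  (* Six steps on the coordinates 1, 2, 3, two for each member of [coords], and one for the pair -1,
     -2. *)
  have := reach_trans h67 h11; rewrite size_coords //; apply: reach_leq; lia.
apply: (@set_negative A w t b p.[z'] q.[z'] M r3 hw ht) => //.
- by move=> X; apply: hM.
- have -> : w 1 = u6 1 by rewrite h9 // mem_coords /= andbF.
  by have -> : w 2 = u6 2 by rewrite h9 // mem_coords /= andbF.
move=> k kN1 kN2; case: (boolP (k \in coords)) => [/h8 //|hk].
case: (eqVneq k 1) => [->|k1]; first by rewrite h9 // mem_coords /= andbF.
case: (eqVneq k 2) => [->|k2]; first by rewrite h9 // mem_coords /= andbF.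
move: hk; rewrite mem_coords; case: eqP => [-> ho|/eqP k0 hk].
  by rewrite (good_even hw) // (good_even ht).
have hk' : (r < `|k|)%N by move: hk; rewrite /valid k0 k1 kN1 k2 kN2 !andbT -ltnNge.
by rewrite (good_supp hw) // (good_supp ht).
Qed.

End Move.
End Moves.

Lemma mem_pos r (k : int) (a : nat) : k \in [seq j%:Z | j <- iota a (r.+1 - a)] = (a%:Z <= k <= r%:Z).
Proof.
apply/mapP/idP => [[j]|hk]; first by rewrite mem_iota => hj ->; lia.
by exists `|k|%N; rewrite ?mem_iota; lia.
Qed.

Lemma mem_neg r (k : int) (a : nat) : k \in [seq - j%:Z | j <- iota a (r.+1 - a)] = (a%:Z <= - k <= r%:Z).
Proof.
apply/mapP/idP => [[j]|hk]; first by rewrite mem_iota => hj ->; lia.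
by exists `|k|%N; rewrite ?mem_iota; lia.
Qed.

(** * From the parameter 1 to the parameter 0 *)

Section Homotopy.
Variables (o : bool) (r : nat) (A : comNzRingType).
Hypotheses (HN : noetherian A) (r3 : (2 < r)%N).
Implicit Types (P : A -> Prop) (Q : {poly A} -> Prop).

Lemma avoid_all (J : A -> Prop) (ps : seq (A -> Prop)) : is_ideal J ->
  (forall P, List.In P ps -> is_prime_ideal P /\ exists b, J b /\ ~ P b) ->
  exists b, J b /\ forall P, List.In P ps -> ~ P b.
Proof.
move=> hJ; elim: ps => [|P ps IH] h; first by exists 0; split=> //; apply: ideal0.
have [|b [hb nb]] := IH; first by move=> P' hP'; apply: h; right.
have [hP [b' [hb' nb']]] := h P (or_introl erefl).
have [|f hf] := @avoid A (P :: ps) (fun=> b) (fun=> b').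
  by move=> P' hP'; case: (h P' hP').
exists (b + f * b'); split; first by apply: idealD => //; apply: idealMl.
by move=> P' hP' /(hf P' hP') [h1 h2]; case: hP' h1 h2 => [<- //|/nb].
Qed.

Variables (V : int -> {poly A}) (m : {poly A}).
Hypotheses (hV : good o r V) (V1_monic : V 1 \is monic) (m_monic : m \is monic).
Hypothesis m_tail : forall Q, is_prime_ideal Q ->
  (forall j, (2 <= j <= r)%N -> Q (V j%:Z)) -> Q m.
Hypothesis V1_size : (size m + size (V 3%:Z) < size (V 1))%N.

(* A prime of A[t] over [ps] containing [W 1] and [W 2] would contain V_2, .., V_r, hence
   [m], so it is one of finitely many; the first transvection takes V_(-3) - f V_(-1) out
   of these primes, with f reduced modulo [m] so that [V 1] stays monic. *)
Lemma coprime_pair (ps : seq (A -> Prop)) : (forall P, List.In P ps -> is_prime_ideal P) ->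
  exists W, [/\ reach o r (2 * r - 3) V W, W 1 \is monic
    & forall Q, is_prime_ideal Q -> List.In (contr Q) ps -> Q (W 1) -> ~ Q (W 2)].
Proof.
move=> hps.
(* The primes to be excluded will turn out to contain [m]. This list does not depend on the
   transvections, so the first parameter can be chosen for it in advance. *)
have [qs1 [hqs1 hqs1']] := finitely_many_over HN m_monic hps.
have [f0 hf0] := avoid (fun=> V (- 3%:Z)) (fun=> - V (- 1)) hqs1.
have [k [w [f [fE fs _]]]] := @pseudo_division A m f0 (monic_neq0 m_monic).
rewrite (monicP m_monic) expr1n mul1r in fE.
pose V1 := tr 1 3%:Z f V.
have V1a : V1 1 = V 1 + f * V 3%:Z by apply: tr_at.
have V1b : V1 (- 3%:Z) = V (- 3%:Z) - f * V (- 1) by apply: tr_opp.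
have V1o l : l != 1 -> l != - 3%:Z -> V1 l = V l by move=> *; rewrite /V1 tr_other.
have V1m : V1 1 \is monic.
  rewrite V1a monicE lead_coefDl ?(monicP V1_monic) //.
  apply: leq_ltn_trans (size_polyMleq _ _) _; apply: leq_ltn_trans V1_size.
  by rewrite -subn1 leq_subLR add1n; apply: leqW; rewrite leq_add2r ltnW.
(* The coordinate 1 is final from here on, so this list stays valid for the remaining
   transvections. *)
have [qs2 [hqs2 hqs2']] := finitely_many_over HN V1m hps.
pose ks1 : seq int := [seq j%:Z | j <- iota 4 (r.+1 - 4)].
pose ks2 : seq int := [seq - j%:Z | j <- iota 3 (r.+1 - 3)].
have hks1 l := mem_pos r l 4; have hks2 l := mem_neg r l 3.
have v2 : valid r 2%:Z by rewrite /valid; lia.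
have [||V2 [a1 a2 a3 a4 a5]] := @absorb o r {poly A} qs2 2%:Z ks1 V1 hqs2 v2.
- by move=> l; rewrite hks1 /valid; lia.
- by move=> l l'; rewrite !hks1; lia.
(* T_{2,3} adds V_3 to V_2 and at the same time V_{-2} to V_{-3}; the second effect brings V_{-2}
   under control, which cannot be added to V_2 directly. *)
have [f3 hf3] := avoid2 (V2 2%:Z) (V2 3%:Z) (V2 (- 3%:Z)) (- V2 (- 2%:Z)) hqs2.
pose V3 := tr 2%:Z 3%:Z f3 V2.
have V3a : V3 2%:Z = V2 2%:Z + f3 * V2 3%:Z by apply: tr_at.
have V3b : V3 (- 3%:Z) = V2 (- 3%:Z) - f3 * V2 (- 2%:Z) by apply: tr_opp.
have V3o l : l != 2%:Z -> l != - 3%:Z -> V3 l = V2 l by move=> *; rewrite /V3 tr_other.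
have [||V4 [b1 b2 b3 b4 b5]] := @absorb o r {poly A} qs2 2%:Z ks2 V3 hqs2 v2.
- by move=> l; rewrite hks2 /valid; lia.
- by move=> l l'; rewrite !hks2; lia.
have V41 : V4 1 = V1 1.
  by rewrite b2 // ?hks2 // V3o // a2 // hks1.
exists V4; split; last 1 first.
- move=> Q hQ hc; rewrite V41 => hQ1 hQ2.
  have Qid := prime_ideal hQ; have hQs := hqs2' Q hQ hQ1 hc.
  have [c1 c2] := b5 Q hQs hQ2.
  have [d1 d2] := hf3 Q hQs; rewrite V3a in c1; have [e1 e2] := d1 c1.
  have [|e3 e4] := d2 e1 e2.
    by rewrite mulrN -V3b; apply: c2; rewrite hks2; lia.
  have {}e4 : Q (V2 (- 2%:Z)) by rewrite -[V2 _]opprK; apply: idealN.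
  have [g1 g2] := a5 Q hQs e1.
  have gN2 : V2 (- 2%:Z) = V1 (- 2%:Z) by rewrite a2 // hks1.
  have gN3 : V2 (- 3%:Z) = V1 (- 3%:Z) by rewrite a2 // hks1.
  have g3 : V2 3%:Z = V1 3%:Z by rewrite a2 // hks1.
  have hpos j : (2 <= j <= r)%N -> Q (V j%:Z).
    move=> hj; rewrite -V1o; [|lia..].
    case: (ltngtP j 3) => j3; [have -> : j = 2%N by lia| |by rewrite j3 -g3].
      exact: g1.
    by apply: g2; rewrite hks1; lia.
  have hneg j : (4 <= j <= r)%N -> Q (V (- j%:Z)).
    move=> hj; rewrite -V1o; [|lia..].
    have [|c hc'] := a3 j%:Z; first by rewrite hks1; lia.
    have : Q (V2 (- j%:Z)) by rewrite -V3o; [apply: c2; rewrite hks2; lia | lia | lia].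
    by rewrite hc' ideal_subr //; apply: idealMl => //; rewrite -gN2.
  have hQm : Q m by apply: m_tail.
  have hQm' := hqs1' Q hQ hQm hc.
  have [|hN3 hN1] := hf0 Q hQm'.
    rewrite mulrN fE mulrDl opprD addrCA addrC ideal_subr //.
      by rewrite -V1b -gN3.
    by apply: idealMr => //; apply: idealMr.
  have {}hN1 : Q (V (- 1)) by rewrite -[V _]opprK; apply: idealN.
  apply: (good_notin hV hQ) => l hl.
  have lE : l = `|l|%N%:Z \/ l = - `|l|%N%:Z by lia.
  case: (ltngtP `|l|%N 3) => l3.
  - have : `|l|%N = 1%N \/ `|l|%N = 2%N by move: hl; rewrite /valid; lia.
    case=> l1; rewrite l1 in lE; case: lE => ->.
    + have : Q (V 1 + f * V 3%:Z) by rewrite -V1a.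
      by rewrite ideal_addr //; apply: idealMl => //; apply: hpos; lia.
    + exact: hN1.
    + by apply: hpos; lia.
    + by rewrite -V1o // -gN2.
  - by case: lE => ->; [apply: hpos | apply: hneg]; move: hl; rewrite /valid; lia.
  - by rewrite l3 in lE; case: lE => -> //; apply: hpos; lia.
- apply: (@reach_leq o r {poly A} (1 + ((r.+1 - 4) + (1 + (r.+1 - 3))))); first by lia.
  apply: (@reach_trans _ _ _ _ _ _ V1).
    by apply: reach1; apply: Estep => //; rewrite /valid; lia.
  apply: (@reach_trans _ _ _ _ _ _ V2); first by move: a1; rewrite size_map size_iota.
  apply: (@reach_trans _ _ _ _ _ _ V3).
    by apply: reach1; apply: Estep => //; rewrite /valid; lia.
  by move: b1; rewrite size_map size_iota.
- by rewrite V41.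
Qed.

(** Passing from V to W and back costs 2r - 3 each way, and [move] costs 4r - 1 + 2o. *)
Definition step_cost := (8 * r - 7 + 2 * o)%N.

(** Conjugating [move] by the passage from V to W returns to values of the same V, so the hypotheses
    on V are available again for the next b. *)
Lemma homotopy_step (ps : seq (A -> Prop)) : (forall P, List.In P ps -> is_prime_ideal P) ->
  exists b, (forall P, List.In P ps -> ~ P b) /\
    forall z y, reach o r step_cost (ev V z) (ev V (z - b * y)).
Proof.
move=> hps; have [W [hVW hW1 hW]] := coprime_pair hps.
pose I f := exists p q, p * W 1 + q * W 2 = f.
have hI : is_ideal I.
  split.
  - by exists 0, 0; rewrite !mul0r addr0.
  - by move=> _ _ [p [q <-]] [p' [q' <-]]; exists (p + p'), (q + q'); ring.
  - by move=> a _ [p [q <-]]; exists (a * p), (a * q); ring.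
have I1 : I (W 1) by exists 1, 0; ring.
have I2 : I (W 2) by exists 0, 1; ring.
have [|P hP|b [[p [q hb]] nb]] := @avoid_all (fun b => I b%:P) ps.
- exact: (preim_ideal (@polyC A : {rmorphism _ -> _}) hI).
- split; first exact: hps.
  apply: (monic_elimination HN hW1 hI I1 (hps P hP)) => Q hQ hIQ hc.
  by apply: (hW Q hQ _ (hIQ _ I1) (hIQ _ I2)); rewrite hc.
have [K hK] := move HN r3 (good_reach hVW hV) hb.
exists (b ^+ K); split=> [P hP|z y].
  by apply: primeX; [exact: hps | exact: nb].
have hev x : reach o r (2 * r - 3) (ev V x) (ev W x).
  exact: (reach_map (horner_eval x : {rmorphism _ -> _}) hVW).
have h := reach_trans (hev z) (reach_trans (hK z y) (reach_sym (hev _))).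
by apply: reach_leq h; rewrite /step_cost; lia.
Qed.

(** Each b avoids the primes over the previous ones, so d+1 of them generate an ideal of height
    above the dimension. Writing 1 as the sum of the c_i b_i, the parameter descends from 1 to 0 by
    one summand at a time. *)
Lemma homotopy d : dim_le A d -> reach o r (d.+1 * step_cost) (ev V 1) (ev V 0).
Proof.
move=> hd.
have H h : exists bs : seq A, [/\ size bs = h,
    forall P, is_prime_ideal P -> (forall i, (i < h)%N -> P bs`_i) -> height_ge P h
    & forall i, (i < h)%N -> forall z y, reach o r step_cost (ev V z) (ev V (z - bs`_i * y))].
  elim: h => [|h [bs [h1 h2 h3]]]; first by exists [::].
  have [ps hp] := primes_overP HN (span_ideal bs).
  have [|b [nb hb]] := @homotopy_step ps; first by move=> P /(proj1 hp) [].
  exists (b :: bs); split=> [|P hP hPb|[|i] hi]; [by rewrite /= h1 | |exact: hb|exact: h3].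
  have [|Q [hQ hQP]] := primes_over_below hp hP _.
    apply: span_sub; first exact: prime_ideal.
    by rewrite h1 => i hi; apply: (hPb i.+1).
  have [hQp hQI] := proj1 hp Q hQ.
  have hQh : height_ge Q h.
    by apply: h2 => // i hi; apply: hQI; apply: span_mem; rewrite h1.
  apply: (height_ge_lt hQh) => // hPQ.
  by apply: (nb Q hQ); apply: hPQ; apply: (hPb 0%N).
have [bs [h1 h2 h3]] := H d.+1.
have [c hc] : span bs 1.
  apply: no_prime_unit => //; first exact: span_ideal.
  move=> P hP hI; apply: (hd P); apply: h2 => // i hi; apply: hI; apply: span_mem.
  by rewrite h1.
have : forall k, (k <= d.+1)%N ->
    reach o r (k * step_cost) (ev V 1) (ev V (1 - \sum_(i < k) c i * bs`_i)).
  elim=> [_|k IH hk]; first by rewrite big_ord0 subr0; exact: Reach0.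
  rewrite mulSn addnC; apply: reach_trans (IH (ltnW hk)) _.
  rewrite big_ord_recr /= opprD addrA [c k * _]mulrC; exact: h3.
by rewrite h1 in hc; move/(_ d.+1 (leqnn _)); rewrite -hc subrr.
Qed.

End Homotopy.

(** * Reduction to the first basis vector *)

Definition unit1 (R : comNzRingType) : int -> R := fun k => (k == 1)%:R.

Section Reduction.
Variables (o : bool) (r : nat).

Definition others : seq int :=
  (if o then [:: 0] else [::]) ++ [seq j%:Z | j <- iota 2 (r.+1 - 2)]
                             ++ [seq - j%:Z | j <- iota 2 (r.+1 - 2)].

Lemma mem_others k : (k \in others) =
  (if k == 0 then o else [&& valid r k, k != 1 & k != - 1]).
Proof.
rewrite /others !mem_cat mem_pos mem_neg.
by case: o; rewrite ?inE; case: eqP => [->|k0]; rewrite /valid //=; lia.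
Qed.

Lemma size_others : (0 < r)%N -> size others = (2 * r - 2 + o)%N.
Proof. by move=> r0; rewrite /others !size_cat !size_map !size_iota; case: o => /=; lia. Qed.

Lemma clear_coords (R : comNzRingType) (js : seq int) (u : int -> R) : (0 < r)%N ->
  (forall j, j \in js -> if j == 0 then o else [&& valid r j, j != 1 & j != - 1]) ->
  u 1 = 1 -> exists w, [/\ reach o r (size js) u w, w 1 = 1,
    forall j, j \in js -> w j = 0 & forall k, k \notin js -> k != - 1 -> w k = u k].
Proof.
move=> r0; elim: js u => [|j js IH] u hjs u1; first by exists u; split=> //; exact: Reach0.
have hj := hjs j (mem_head _ _).
have [j1 jN1] : j != 1 /\ j != - 1 by case: eqP hj => [-> //|_ /and3P []].
have [u' [h1 h2 h3]] : exists u', [/\ reach o r 1 u u', u' j = 0 &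
    forall k, k != j -> k != - 1 -> u' k = u k].
  case: (eqVneq j 0) hj => [j0 ho|j0 /and3P [hj _ _]].
    subst j; exists (tr0 (- 1) (u 0) u); split.
    - by apply: reach1; apply: Estep0 => //; rewrite /valid; lia.
    - by rewrite tr0_0 // opprK u1 mulr1 subrr.
    - by move=> k k0 kN1; rewrite tr0_other.
  exists (tr j 1 (- u j) u); split.
  - by apply: reach1; apply: Estep => //; rewrite /valid; lia.
  - by rewrite tr_at // u1 mulr1 subrr.
  - by move=> k kj kN1; rewrite tr_other.
have [||w [h4 h5 h6 h7]] := IH u'.
- by move=> k hk; apply: hjs; rewrite inE hk orbT.
- by rewrite h3 // eq_sym.
exists w; split=> //.
- exact: reach_trans h1 h4.
- move=> k; rewrite inE; case: (boolP (k \in js)) => [/h6 //|hk]; rewrite orbF => /eqP kj.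
  by subst k; rewrite h7.
- by move=> k; rewrite inE negb_or => /andP [kj hk] kN1; rewrite h7 // h3.
Qed.

(** The coordinate -1 is not cleared by a transvection: it vanishes by isotropy once the others
    do. *)
Lemma reach_unit1 (R : comNzRingType) (u : int -> R) : (0 < r)%N -> good o r u ->
  u 1 = 1 -> reach o r (2 * r - 2 + o) u (unit1 R).
Proof.
move=> r0 hu u1.
have [|w [h1 h2 h3 h4]] := @clear_coords R (others) u r0 _ u1.
  by move=> j; rewrite mem_others.
have hw := good_reach h1 hu.
have w0 k : k != 1 -> k != - 1 -> w k = 0.
  move=> k1 kN1; case: (boolP (k \in others)) => [/h3 //|].
  rewrite mem_others k1 kN1 !andbT; case: eqP => [-> /(good_even hw) //|/eqP k0].
  by rewrite /valid k0 /= -ltnNge => /(good_supp hw).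
have v1 : valid r 1 by rewrite /valid; lia.
have [c hc] := qf_split w v1.
have := hc w (fun _ _ _ => erefl); rewrite (good_qf hw) h2 mul1r.
have := hc (fun=> 0) (fun k k1 kN1 => esym (w0 k k1 kN1)).
rewrite mulr0 addr0 /qf expr0n add0r big1; last by move=> i _; rewrite mulr0.
move=> <-; rewrite add0r => wN1.
suff -> : unit1 R = w by rewrite -(size_others r0).
apply: functional_extensionality => k; rewrite /unit1.
case: (eqVneq k 1) => [->|k1]; first by rewrite h2.
by case: (eqVneq k (- 1)) => [->|kN1]; [exact: wN1 | rewrite w0].
Qed.

(** In general position u_2, .., u_r generate an ideal of height at least r - 1 > D, the unit ideal,
    so the coordinate 1 can be made equal to 1. *)
Lemma reduce_small (C : comNzRingType) D (u : int -> C) : noetherian C -> dim_le C D ->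
  (2 < r)%N -> (D.+2 <= r)%N -> good o r u ->
  reach o r (2 * (r.-1 * r.-1) + (r.-1 + (2 * r - 2 + o))) u (unit1 C).
Proof.
move=> HN hD r3 hDr hu.
have [|w [h1 h2]] := @general_position o r C HN u _ hu; first by lia.
apply: (reach_trans h1); have hw := good_reach h1 hu.
pose ks : seq int := [seq j%:Z | j <- iota 2 (r.+1 - 2)].
have uks : uniq ks by rewrite map_inj_uniq ?iota_uniq // => x y [].
have [c hc] : span [seq w k | k <- ks] 1.
  apply: no_prime_unit => //; first exact: span_ideal.
  move=> P hP hI; apply: (hD P); apply: (@height_ge_leq _ _ r.-1); first by lia.
  apply: h2 => // j hj; apply: hI.
  have hjk : j%:Z \in ks by rewrite mem_pos; lia.
  have hi : (index j%:Z ks < size [seq w k | k <- ks])%N by rewrite size_map index_mem.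
  by have := span_mem hi; rewrite (nth_map 0) ?index_mem // nth_index.
pose c' k := (1 - w 1) * c (index k ks).
have [|||u' [h3 h4 h5]] := @add_combination o r C ks c' w.
- by lia.
- by move=> k; rewrite mem_pos /valid; lia.
- by move=> k k'; rewrite !mem_pos; lia.
have hs : \sum_(k <- ks) c' k * w k = 1 - w 1.
  transitivity ((1 - w 1) * \sum_(i < size [seq w k | k <- ks]) c i * [seq w k | k <- ks]`_i).
    rewrite mulr_sumr (big_nth 0) big_mkord size_map; apply: eq_bigr => i _.
    by rewrite /c' index_uniq // (nth_map (0 : int) 0 w) // mulrA.
  by rewrite -hc mulr1.
have {}h5 : u' 1 = 1 by rewrite h5 hs addrC subrK.
apply: (@reach_trans _ _ _ _ _ _ u').
  by apply: reach_leq h3; rewrite size_map size_iota; lia.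
by apply: reach_unit1 => //; [lia | apply: good_reach h3 hw].
Qed.

(** The r - 1 transvections over A[t] that make V_1 monic are evaluated at t = 1 before the homotopy
    and inverted at t = 0 after it. *)
Lemma reduce_unimodular (C A : comNzRingType) (iota_C : {rmorphism C -> A}) D d (u : int -> A) :
  noetherian C -> dim_le C D -> noetherian A -> dim_le A d -> contractible iota_C D.+1 ->
  (2 < r)%N -> (D.+2 <= r)%N -> good o r u ->
  reach o r (2 * (r.-1 * r.-1) + (r.-1 + (d.+1 * step_cost o r + (r.-1 +
    (2 * (r.-1 * r.-1) + (r.-1 + (2 * r - 2 + o))))))) u (unit1 A).
Proof.
move=> HC hD HA hd hcon r3 hDr hu.
have [|v [h1 h2]] := @general_position o r A HA u _ hu; first by lia.
apply: (reach_trans h1); have hv := good_reach h1 hu.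
pose ks : seq int := [seq j%:Z | j <- iota 2 (r.+1 - 2)].
have uks : uniq ks by rewrite map_inj_uniq ?iota_uniq // => x y [].
have mem_ks (k : int) : k \in ks = (2%:Z <= k <= r%:Z) by rewrite mem_pos.
have Iid := span_ideal [seq v k | k <- ks].
have Imem j : (2 <= j <= r)%N -> span [seq v k | k <- ks] (v j%:Z).
  move=> hj; have hjk : j%:Z \in ks by rewrite mem_ks; lia.
  have hi : (index j%:Z ks < size [seq v k | k <- ks])%N by rewrite size_map index_mem.
  by have := span_mem hi; rewrite (nth_map 0) ?index_mem // nth_index.
have [P hP hI|sigma [pi [m [hm sm s1 s0]]]] := hcon _ Iid.
  apply: (@height_ge_leq _ _ r.-1); first by lia.
  by apply: h2 => // j hj; apply: hI; apply: Imem.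
pose V0 := sigma \o v; have hV0 : good o r V0 by apply: good_map.
have [c hc] := hm.
(* Large enough for t^N sigma(m) to dominate V_1 and to leave the room that [V1_size] asks for. *)
pose N := (size (V0 1) + size (sigma m) + size (V0 3%:Z))%N.
pose c' k := 'X^N * sigma (c (index k ks)).
have [|||V [h3 h4 h5]] := @add_combination o r {poly A} ks c' V0.
- by lia.
- by move=> k; rewrite mem_ks /valid; lia.
- by move=> k k'; rewrite !mem_ks; lia.
have hs : \sum_(k <- ks) c' k * V0 k = 'X^N * sigma m.
  rewrite hc rmorph_sum mulr_sumr (big_nth 0) big_mkord size_map; apply: eq_bigr => i _.
  by rewrite /c' index_uniq // (nth_map (0 : int) 0 v) // rmorphM mulrA.
rewrite hs in h5.
have Vpos j : (2 <= j <= r)%N -> V j%:Z = V0 j%:Z.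
  by move=> hj; rewrite h4 // ?mem_ks; lia.
have sm0 : sigma m != 0 by apply: monic_neq0.
have hsz : size ('X^N * sigma m) = (N + size (sigma m))%N.
  by rewrite size_monicM ?monicXn // size_polyXn.
have hpos : (0 < size (sigma m))%N by rewrite lt0n size_poly_eq0.
have hlt : (size (V0 1%R) < size ('X^N * sigma m)%R)%N.
  by rewrite hsz -[X in (X < _)%N]addn0 -addnS leq_add // /N -addnA leq_addr.
have V1m : V 1 \is monic.
  by rewrite h5 monicE lead_coefDr // -monicE; apply: rpredM; rewrite ?monicXn.
have V1s : size (V 1) = (N + size (sigma m))%N by rewrite h5 addrC size_polyDl // hsz.
have hV := good_reach h3 hV0.
have htail Q : is_prime_ideal Q -> (forall j, (2 <= j <= r)%N -> Q (V j%:Z)) -> Q (sigma m).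
  move=> hQ hj; have Qid := preim_ideal sigma (prime_ideal hQ).
  suff h : incl (span [seq v k | k <- ks]) (fun a => Q (sigma a)) by exact: h hm.
  apply: span_sub => // i; rewrite size_map => hi.
  rewrite (nth_map (0 : int) 0 v) //; have hk : ks`_i \in ks by apply: mem_nth.
  move: (ks`_i) hk => k hk; have kE : k = `|k|%N%:Z by move: hk; rewrite mem_ks; lia.
  rewrite kE -[sigma _]/(V0 _) -Vpos; first by apply: hj; move: hk; rewrite mem_ks; lia.
  by move: hk; rewrite mem_ks; lia.
have hV3 : (size (sigma m) + size (V 3%:Z) < size (V 1))%N.
  rewrite V1s Vpos; last by lia.
  rewrite [X in (X < _)%N]addnC ltn_add2r /N -[X in (X < _)%N]add0n ltn_add2r.
  by rewrite addn_gt0 hpos orbT.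
have hev x : reach o r r.-1 (ev V0 x) (ev V x).
  apply: (@reach_leq _ _ _ (size ks)); first by rewrite size_map size_iota; lia.
  exact: (reach_map (horner_eval x : {rmorphism _ -> _}) h3).
have e1 : ev V0 1 = v by apply: functional_extensionality => k; apply: s1.
have e0 : ev V0 0 = iota_C \o (pi \o v) by apply: functional_extensionality => k; apply: s0.
apply: (@reach_trans _ _ _ _ _ _ (ev V 1)); first by rewrite -[X in reach _ _ _ X]e1.
apply: (@reach_trans _ _ _ _ _ _ (ev V 0)).
  exact: (homotopy HA r3 hV V1m sm htail hV3 hd).
apply: (@reach_trans _ _ _ _ _ _ (ev V0 0)); first exact: reach_sym.
rewrite e0; have -> : unit1 A = iota_C \o unit1 C.
  by apply: functional_extensionality => k; rewrite /unit1 /= rmorph_nat.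
by apply: reach_map; apply: (reduce_small HC hD) => //; apply: good_map.
Qed.

End Reduction.

(** * Matrices *)

Section Coordinates.
Variables (R : comNzRingType) (m : nat).
Implicit Types (v w : 'cV[R]_m) (a b : 'I_m).

Definition coord v (k : int) : R := \sum_a (sidx a == k)%:R * v a 0.

Lemma sidxP a : [\/ (a < m./2)%N /\ sidx a = a.+1%:Z,
  [/\ odd m, a = m./2 :> nat & sidx a = 0]
  | (m./2 + odd m <= a)%N /\ sidx a = a%:Z - m%:Z].
Proof.
rewrite /sidx; case: ltnP => h; first by apply: Or31.
case: (boolP (odd m)) => om /=; last by apply: Or33; split=> //; lia.
case: eqP => e; first by apply: Or32.
by apply: Or33; split=> //; lia.
Qed.

Lemma sidx_inj : injective (@sidx m).
Proof.
move=> a b; have := ltn_ord a; have := ltn_ord b; have := odd_double_half m.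
move=> hm hb ha h; apply: val_inj => /=; move: h.
case: (sidxP a) => [[a1 ->]|[om a1 ->]|[a1 ->]];
  case: (sidxP b) => [[b1 ->]|[om' b1 ->]|[b1 ->]]; lia.
Qed.

Lemma sidx_range a : if sidx a == 0 then odd m else valid m./2 (sidx a).
Proof.
have := ltn_ord a; have := odd_double_half m; rewrite /valid => hm ha.
case: (sidxP a) => [[a1 ->]|[om a1 ->]|[a1 ->]].
  by case: eqP => e; lia.
  by rewrite eqxx.
by case: eqP => e; lia.
Qed.

Lemma sidx_surj k : (if k == 0 then odd m else valid m./2 k) -> exists a, sidx a = k.
Proof.
have hm := odd_double_half m.
case: eqP => [-> om|/eqP k0 /andP [_ hk]].
  have ha : (m./2 < m)%N by rewrite om in hm; lia.
  by exists (Ordinal ha); rewrite /sidx /= ltnn om eqxx.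
case: (ltrP 0 k) => kp.
  have ha : (`|k|.-1 < m)%N by lia.
  by exists (Ordinal ha); rewrite /sidx /=; case: ifP => h; lia.
have ha : (m - `|k| < m)%N by lia.
exists (Ordinal ha); rewrite /sidx /=; case: ifP => h; first by lia.
by case: eqP => e; case: (boolP (odd m)) hm => om hm /=; lia.
Qed.

Lemma coord_sidx v a : coord v (sidx a) = v a 0.
Proof.
rewrite /coord (bigD1 a) //= eqxx mul1r big1 ?addr0 // => b hb.
by rewrite (inj_eq sidx_inj) (negbTE hb) mul0r.
Qed.

Lemma coord_out v k : ~~ (if k == 0 then odd m else valid m./2 k) -> coord v k = 0.
Proof.
move=> hk; rewrite /coord big1 // => a _; case: eqP => [e|_]; last by rewrite mul0r.
by move: hk; rewrite -e sidx_range.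
Qed.

Lemma coord_inj v w : coord v =1 coord w -> v = w.
Proof. by move=> h; apply/colP => a; rewrite -!coord_sidx h. Qed.

Lemma qform_coord v : qform v = qf m./2 (coord v).
Proof.
have hm := odd_double_half m.
rewrite /qform /qf addrC; congr (_ + _).
  case: (boolP (odd m)) => om.
    have [|a ha] := @sidx_surj 0; first by rewrite eqxx.
    rewrite (bigD1 a) //= ha eqxx big1 ?addr0; first by rewrite -ha coord_sidx.
    by move=> b hb; rewrite -ha (inj_eq sidx_inj) (negbTE hb).
  rewrite coord_out ?expr0n ?eqxx // big1 // => a _.
  by case: eqP (sidx_range a) => // _; rewrite (negbTE om).
pose F (n : nat) := coord v n.+1%:Z * coord v (- n.+1%:Z).
have hle : (m./2 <= m)%N by lia.
rewrite (big_ord_widen m F hle) [RHS]big_mkcond; apply: eq_bigr => a _.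
case: ifP => ha.
  have sa : sidx a = a.+1%:Z by rewrite /sidx ha.
  rewrite /F -sa coord_sidx /coord mulr_sumr; apply: eq_bigr => b _.
  have -> : 0 < sidx a by rewrite sa; lia.
  by case: eqP => _ /=; rewrite ?mul1r ?mul0r ?mulr0.
have -> : (0 < sidx a) = false.
  by rewrite /sidx ha; have := ltn_ord a; case: ifP => _; lia.
by rewrite big1.
Qed.

Lemma coord_transv i j x v : valid m./2 i -> valid m./2 j ->
  coord (transv m i j x *m v) = tr i j x (coord v).
Proof.
move=> hi hj; apply: functional_extensionality => k.
case: (boolP (if k == 0 then odd m else valid m./2 k)) => hk; last first.
  have ki : k != i.
    by apply: contraNneq hk => ->; move: hi; case: eqP => // ->; rewrite /valid eqxx.
  have kNj : k != - j.
    apply: contraNneq hk => ->; move: hj; rewrite /valid abszN oppr_eq0.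
    by case: eqP.
  by rewrite tr_other // !coord_out.
have [a <-] := sidx_surj hk; rewrite coord_sidx mxE.
under eq_bigr => b _ do rewrite mxE mulrBl mulrDl.
rewrite sumrB big_split /= /tr coord_sidx; congr (_ + _ - _).
- rewrite (bigD1 a) //= eqxx mul1r big1 ?addr0 // => b hb.
  by rewrite eq_sym (negbTE hb) mul0r.
- rewrite /coord mulr_sumr; apply: eq_bigr => b _.
  by case: (sidx a == i); case: (sidx b == j); rewrite /= ?(mulr0, mulr1, mul0r, mul1r).
rewrite /coord mulr_sumr; apply: eq_bigr => b _.
by case: (sidx a == - j); case: (sidx b == - i); rewrite /= ?(mulr0, mulr1, mul0r, mul1r).
Qed.

Lemma coord_transv0 i x v : odd m -> valid m./2 i ->
  coord (transv0 m i x *m v) = tr0 i x (coord v).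
Proof.
move=> om hi; apply: functional_extensionality => k.
case: (boolP (if k == 0 then odd m else valid m./2 k)) => hk; last first.
  have ki : k != i.
    by apply: contraNneq hk => ->; move: hi; case: eqP => // ->; rewrite /valid eqxx.
  have k0 : k != 0 by apply: contraNneq hk => ->; rewrite eqxx.
  by rewrite tr0_other // !coord_out.
have [a <-] := sidx_surj hk; rewrite coord_sidx mxE.
under eq_bigr => b _ do rewrite mxE !mulrBl mulrDl.
rewrite !sumrB big_split /= /tr0 coord_sidx; congr (_ + _ - _ - _).
- rewrite (bigD1 a) //= eqxx mul1r big1 ?addr0 // => b hb.
  by rewrite eq_sym (negbTE hb) mul0r.
- rewrite /coord mulr_sumr; apply: eq_bigr => b _.
  by case: (sidx a == i); case: (sidx b == 0); rewrite /= ?(mulr0, mulr1, mul0r, mul1r).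
- rewrite /coord mulr_sumr; apply: eq_bigr => b _.
  by case: (sidx a == 0); case: (sidx b == - i); rewrite /= ?(mulr0, mulr1, mul0r, mul1r).
rewrite /coord mulr_sumr; apply: eq_bigr => b _.
by case: (sidx a == i); case: (sidx b == - i); rewrite /= ?(mulr0, mulr1, mul0r, mul1r).
Qed.

Lemma EO_le1 (g : 'M[R]_m) : elem_transv g -> EO_le 1 g.
Proof.
move=> hg; exists [:: g]; split=> // [t|]; first by rewrite inE => /eqP ->.
by rewrite /= mulmx1.
Qed.

Lemma EO_le_id n : EO_le n (1%:M : 'M[R]_m).
Proof. by exists [::]. Qed.

Lemma EO_le_mul n n' (g h : 'M[R]_m) : EO_le n g -> EO_le n' h -> EO_le (n + n') (g *m h).
Proof.
move=> [s [s1 s2 ->]] [t [t1 t2 ->]]; exists (s ++ t); split.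
- by rewrite size_cat leq_add.
- by move=> x; rewrite mem_cat => /orP [/s2|/t2].
by elim: s {s1 s2} => [|x s IH] /=; rewrite ?mul1mx // -mulmxA IH.
Qed.

Lemma EO_le_leq n n' (g : 'M[R]_m) : (n <= n')%N -> EO_le n g -> EO_le n' g.
Proof. by move=> h [s [s1 s2 ->]]; exists s; split=> //; apply: leq_trans h. Qed.

Lemma estep_matrix (u u' : int -> R) v : coord v = u -> estep (odd m) m./2 u u' ->
  exists h, elem_transv h /\ coord (h *m v) = u'.
Proof.
move=> hv h; case: h hv => {u u'} [i j x u hi hj hij hiNj|i x u ho hi] hv.
  exists (transv m i j x); split; last by rewrite coord_transv // hv.
  by left; exists i, j, x.
exists (transv0 m i x); split; last by rewrite coord_transv0 // hv.
by right; split=> //; exists i, x.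
Qed.

Lemma reach_matrix n (u u' : int -> R) v : coord v = u -> reach (odd m) m./2 n u u' ->
  exists h, EO_le n h /\ coord (h *m v) = u'.
Proof.
move=> hv h; elim: h v hv => {n u u'} [n u|n u1 u2 u3 h1 _ IH] v hv.
  by exists 1%:M; rewrite mul1mx; split=> //; apply: EO_le_id.
have [g [hg hgv]] := estep_matrix hv h1.
have [h [hh hhv]] := IH _ hgv.
exists (h *m g); rewrite -mulmxA; split=> //.
by rewrite -addn1; apply: EO_le_mul hh (EO_le1 hg).
Qed.

Lemma orth_mul (g h : 'M[R]_m) : is_orth g -> is_orth h -> is_orth (g *m h).
Proof.
move=> [[g' [g1 g2]] gq] [[h' [h1 h2]] hq]; split; last by move=> x; rewrite -mulmxA gq hq.
exists (h' *m g'); split.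
  by rewrite mulmxA -(mulmxA g) h1 mulmx1.
by rewrite mulmxA -(mulmxA h') g2 mulmx1.
Qed.

Lemma matrix_ext (g h : 'M[R]_m) : (forall v : 'cV_m, g *m v = h *m v) -> g = h.
Proof.
move=> H; apply/matrixP => i j; have := congr1 (fun x : 'cV_m => x i 0) (H (delta_mx j 0)).
by rewrite -!colE !mxE.
Qed.

Lemma orth_elem (g : 'M[R]_m) : elem_transv g -> is_orth g.
Proof.
case=> [[i [j [x [hi hj hij hiNj ->]]]]|[om [i [x [hi ->]]]]].
  split; last by move=> v; rewrite !qform_coord coord_transv // qf_tr.
  exists (transv m i j (- x)); split; apply: matrix_ext => v; apply: coord_inj => k;
    rewrite -mulmxA mul1mx !coord_transv //; last by rewrite (@tr_inv m./2).
  by rewrite -{1}[x]opprK (@tr_inv m./2).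
have i0 : i != 0 by case/andP: hi.
split; last by move=> v; rewrite !qform_coord coord_transv0 // qf_tr0.
exists (transv0 m i (- x)); split; apply: matrix_ext => v; apply: coord_inj => k;
  rewrite -mulmxA mul1mx !coord_transv0 //; last by rewrite tr0_inv.
by rewrite -{1}[x]opprK tr0_inv.
Qed.

Lemma orth_EO n (g : 'M[R]_m) : EO_le n g -> is_orth g.
Proof.
move=> [s [_ hs ->]] {g}; elim: s hs => [_|g s IH hs] /=.
  by split; [exists 1%:M; rewrite mulmx1 | move=> v; rewrite mul1mx].
apply: orth_mul; first by apply: orth_elem; apply: hs; apply: mem_head.
by apply: IH => t ht; apply: hs; rewrite inE ht orbT.
Qed.

Definition basis k : 'cV[R]_m := \col_a (sidx a == k)%:R.

Lemma coord_basis k l : (if k == 0 then odd m else valid m./2 k) ->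
  coord (basis k) l = (l == k)%:R.
Proof.
move=> hk; case: (boolP (if l == 0 then odd m else valid m./2 l)) => hl; last first.
  by rewrite coord_out // (_ : (l == k) = false) //; apply: contraNF hl => /eqP ->.
by have [a <-] := sidx_surj hl; rewrite coord_sidx mxE.
Qed.

(** The inverse matrix writes 1 as a combination of the entries of the column; [qf0_coord0] disposes
    of the entry of index 0. *)
Lemma good_column (g : 'M[R]_m) : (0 < m./2)%N -> is_orth g ->
  good (odd m) m./2 (coord (g *m basis 1)).
Proof.
move=> m0 [[g' [g1 g2]] hq].
have v1 : if (1 : int) == 0 then odd m else valid m./2 1 by rewrite /= /valid; lia.
have hq0 : qf m./2 (coord (g *m basis 1)) = 0.
  rewrite -qform_coord hq qform_coord /qf !coord_basis // expr0n add0r.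
  apply: big1 => i _; rewrite !coord_basis //.
  have -> : (- (i.+1)%:Z == 1) = false by apply/negbTE; lia.
  by rewrite mulr0.
split=> //.
- move=> P hP; apply: NNPP => hno.
  have hall k : valid m./2 k -> P (coord (g *m basis 1) k).
    by move=> hk; apply: NNPP => nk; apply: hno; exists k.
  have h0 := qf0_coord0 hP hq0 hall.
  have Pid := prime_ideal hP.
  have hP' a : P ((g *m basis 1) a 0).
    rewrite -coord_sidx; have := sidx_range a; case: eqP => [-> _|_ /hall] //.
  have [a ha] := @sidx_surj 1 v1.
  apply: (prime1 hP); have : basis 1 a 0 = 1 by rewrite mxE ha.
  move=> <-; rewrite -[basis 1]mul1mx -g2 -mulmxA mxE.
  by apply: ideal_sum => // b _; apply: idealMl.
- move=> k hk; apply: coord_out; case: eqP hk => [->//|_].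
  by rewrite /valid; lia.
- by move=> om; apply: coord_out.
Qed.

(** The transvections T_{j,-1} and T_{1,0} fix e_1. They clear the image of e_{-1} without undoing
    the reduction of the first column. *)
Lemma clear_dual (js : seq int) (v : 'cV[R]_m) : (0 < m./2)%N ->
  (forall j, j \in js -> if j == 0 then odd m else [&& valid m./2 j, j != 1 & j != - 1]) ->
  coord v (- 1) = 1 -> exists h, [/\ EO_le (size js) h, h *m basis 1 = basis 1,
     coord (h *m v) (- 1) = 1, forall j, j \in js -> coord (h *m v) j = 0
    & forall k, k \notin js -> k != 1 -> coord (h *m v) k = coord v k].
Proof.
move=> m0; elim: js v => [|j js IH] v hjs v1.
  by exists 1%:M; rewrite !mul1mx; split=> //; exact: EO_le_id.
have hj := hjs j (mem_head _ _).
have [j1 jN1] : j != 1 /\ j != - 1 by case: eqP hj => [-> //|_ /and3P []].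
have b1 l : coord (basis 1) l = (l == 1)%:R by apply: coord_basis; rewrite /valid /=; lia.
have [h [h1 h2 h3 h4]] : exists h, [/\ elem_transv h, h *m basis 1 = basis 1,
    coord (h *m v) j = 0 & forall k, k != j -> k != 1 -> coord (h *m v) k = coord v k].
  case: (eqVneq j 0) hj => [j0 ho|j0 /and3P [hj _ _]].
    have hv1 : valid m./2 1 by rewrite /valid; lia.
    subst j; exists (transv0 m 1 (coord v 0)); split.
    - by right; split=> //; exists 1, (coord v 0).
    - apply: coord_inj => k; rewrite coord_transv0 // /tr0 !b1 /=.
      by rewrite !mulr0 !subr0 addr0.
    - by rewrite coord_transv0 // tr0_0 // v1 mulr1 subrr.
    - by move=> k k0 k1; rewrite coord_transv0 // tr0_other.
  have hvN1 : valid m./2 (- 1) by rewrite /valid; lia.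
  exists (transv m j (- 1) (- coord v j)); split.
  - left; exists j, (- 1), (- coord v j); split=> //; by rewrite opprK.
  - apply: coord_inj => k; rewrite coord_transv // /tr !b1 /=.
    have -> : (- j == 1) = false by apply/negbTE; lia.
    by rewrite !mulr0 subr0 addr0.
  - by rewrite coord_transv // tr_at ?opprK // v1 mulr1 subrr.
  - by move=> k kj k1; rewrite coord_transv // tr_other // opprK.
have [||g [g1 g2 g3 g4 g5]] := IH (h *m v).
- by move=> k hk; apply: hjs; rewrite inE hk orbT.
- by rewrite h4 // eq_sym.
exists (g *m h); split.
- by rewrite /= -addn1; apply: EO_le_mul g1 (EO_le1 h1).
- by rewrite -mulmxA h2.
- by rewrite -mulmxA.
- move=> k; rewrite inE -mulmxA; case: (boolP (k \in js)) => [/g4 //|hk].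
  by rewrite orbF => /eqP kj; subst k; rewrite g5.
- by move=> k; rewrite inE negb_or -mulmxA => /andP [kj hk] k1; rewrite g5 // h4.
Qed.

End Coordinates.

(** * The block-diagonal subgroup *)

Section MiddleSubgroup.
Variables (R : comNzRingType) (k : nat).

Definition mid (i : 'I_k) : 'I_k.+2 := lift ord0 (widen_ord (leqnSn k) i).

Lemma mid_val i : mid i = i.+1 :> nat. Proof. by []. Qed.

Lemma big_mid (F : 'I_k.+2 -> R) :
  \sum_a F a = F ord0 + \sum_i F (mid i) + F ord_max.
Proof.
rewrite big_ord_recl big_ord_recr /= addrA; congr (_ + _ + F _); exact: val_inj.
Qed.

Lemma mid_cases (P : 'I_k.+2 -> Prop) :
  P ord0 -> P ord_max -> (forall i, P (mid i)) -> forall a, P a.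
Proof.
move=> h0 h1 hm a; case: (unliftP ord0 a) => [j ->|-> //].
case: (ltnP j k) => hj.
  by have := hm (Ordinal hj); congr P; apply: val_inj.
suff -> : lift ord0 j = ord_max by [].
apply: val_inj; rewrite /= /bump leq0n add1n; congr _.+1; apply/eqP.
by rewrite eqn_leq hj andbT -ltnS ltn_ord.
Qed.

Lemma mid_max i : (mid i == ord_max) = false.
Proof. by apply/negbTE; rewrite -val_eqE /= /bump leq0n add1n eqSS neq_ltn ltn_ord. Qed.

Lemma half2 : (k.+2)./2 = (k./2).+1. Proof. by []. Qed.

Lemma sidx_ord0 : sidx (ord0 : 'I_k.+2) = 1.
Proof. by case: (sidxP (ord0 : 'I_k.+2)) => /= [[_ ->]|[]|[]]. Qed.

Lemma sidx_ord_max : sidx (ord_max : 'I_k.+2) = - 1.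
Proof.
have := odd_double_half k.
have := sidxP (ord_max : 'I_k.+2); rewrite half2 /= negbK => -[[h _]|[om h _]|[_ ->]] hk.
- by lia.
- by move: hk; rewrite om; lia.
- by lia.
Qed.

Lemma sidx_mid (i j : 'I_k) : [/\ (0 < sidx (mid i)) = (0 < sidx i),
  (sidx (mid i) == 0) = (sidx i == 0)
  & 0 < sidx i -> (sidx (mid j) == - sidx (mid i)) = (sidx j == - sidx i)].
Proof.
have hk := odd_double_half k; have hi := ltn_ord i; have hj := ltn_ord j.
have spec (l : 'I_k) : (l < k)%N -> [\/ sidx l = l.+1%:Z /\ sidx (mid l) = l.+2%:Z,
    sidx l = 0 /\ sidx (mid l) = 0
  | sidx l = l%:Z - k%:Z /\ sidx (mid l) = l%:Z - k%:Z - 1].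
  move=> hl; rewrite /sidx mid_val half2 ltnS /= negbK eqSS.
  case: ifP => h1; first by apply: Or31.
  by case: ifP => h2; [apply: Or32 | apply: Or33; split=> //; lia].
have nle (l : 'I_k) : (l < k)%N -> l%:Z - k%:Z < 0 by lia.
case: (spec i hi) => [[-> ->]|[-> ->]|[-> ->]]; case: (spec j hj) => [[-> ->]|[-> ->]|[-> ->]];
  by split; lia.
Qed.

Lemma qform_mid (X : 'cV[R]_k.+2) (x : 'cV[R]_k) : X ord0 0 = 0 -> X ord_max 0 = 0 ->
  (forall i, X (mid i) 0 = x i 0) -> qform X = qform x.
Proof.
move=> h0 h1 hm; rewrite /qform; congr (_ + _).
  rewrite big_mid [X in X + _ + _]big1; last by move=> b _; rewrite h0 mul0r if_same.
  rewrite [X in _ + X]big1; last by move=> b _; rewrite h1 mul0r if_same.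
  rewrite add0r addr0; apply: eq_bigr => i _; rewrite big_mid h0 h1 !mulr0 !if_same add0r addr0.
  apply: eq_bigr => j _; have [e1 _ e2] := sidx_mid i j; rewrite e1 !hm.
  by case: (boolP (0 < sidx i)) => //= /e2 ->.
rewrite big_mid h0 h1 expr0n !if_same add0r addr0; apply: eq_bigr => i _.
by have [_ -> _] := sidx_mid i i; rewrite hm.
Qed.

Lemma emb2E (h : 'M[R]_k) (g : 'M[R]_k.+2) :
  (forall a, g a ord0 = (a == ord0)%:R) -> (forall a, g a ord_max = (a == ord_max)%:R) ->
  (forall i, g ord0 (mid i) = 0) -> (forall i, g ord_max (mid i) = 0) ->
  (forall i j, g (mid i) (mid j) = h i j) -> g = emb2 h.
Proof.
move=> g0 g1 g2 g3 g4.
pose c := cast_ord (esym (emb2_dim k)).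
have c0 : c ord0 = lshift _ ord0 by apply: val_inj.
have c1 : c ord_max = rshift 1 (rshift k ord0) by apply: val_inj; rewrite /= addn0.
have cm i : c (mid i) = rshift 1 (lshift 1 i) by apply: val_inj; rewrite /= /bump /=.
apply/matrixP => a b; rewrite /emb2 castmxE -!/(c _).
elim/mid_cases: b => [||j]; elim/mid_cases: a => [||i];
  rewrite ?g0 ?g1 ?g2 ?g3 ?g4 ?c0 ?c1 ?cm ?block_mxEul ?block_mxEur ?block_mxEdl ?block_mxEdr
    ?block_mxEul ?block_mxEur ?block_mxEdl ?block_mxEdr ?mxE ?eqxx // mid_max //.
Qed.

(** Polarisation at an isotropic basis vector, valid also where 2 is not invertible. *)
Lemma qform_add_basis (x : 'cV[R]_k.+2) e : e = 1 \/ e = - 1 ->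
  qform (x + basis R k.+2 e) = qform x + coord x (- e).
Proof.
move=> he; have ve : valid (k.+2)./2 e by rewrite /valid half2; case: he => ->.
have hb l : coord (basis R k.+2 e) l = (l == e)%:R.
  by apply: coord_basis; case: he => ->.
rewrite !qform_coord; have [c hc] := qf_split (coord x) ve.
have hD l : coord (x + basis R k.+2 e) l = coord x l + (l == e)%:R.
  rewrite -hb /coord -big_split; apply: eq_bigr => a _ /=.
  by rewrite [(x + _) a 0]mxE mulrDr.
rewrite (hc (coord (x + basis R k.+2 e))); last first.
  by move=> l /negbTE h1 h2; rewrite hD h1 addr0.
rewrite [in RHS](hc (coord x)) // !hD eqxx.
have -> : (- e == e) = false by case: he => ->.
by rewrite /=; ring.
Qed.

(** Fixing e_1 and e_{-1} determines the outer columns. The outer rows follow from the form: their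
    entries are pairings of the image of a middle basis vector with e_1 or e_{-1}, which [g]
    preserves. *)
Lemma mid_subgroup (g : 'M[R]_k.+2) : is_orth g ->
  g *m basis R k.+2 1 = basis R k.+2 1 -> g *m basis R k.+2 (- 1) = basis R k.+2 (- 1) ->
  in_mid_subgroup g.
Proof.
move=> [[g' [gg' g'g]] gq] g1 gN1.
have bcol (f : 'M[R]_k.+2) e b a : sidx b = e -> (f *m basis R k.+2 e) a 0 = f a b.
  move=> hb; rewrite mxE (bigD1 b) //= mxE hb eqxx mulr1 big1 ?addr0 // => c hc.
  by rewrite mxE -hb (inj_eq (@sidx_inj _)) (negbTE hc) mulr0.
have bE e b a : sidx b = e -> basis R k.+2 e a 0 = (a == b)%:R.
  by move=> hb; rewrite mxE -hb (inj_eq (@sidx_inj _)).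
have col0 (f : 'M[R]_k.+2) : f *m basis R k.+2 1 = basis R k.+2 1 ->
    forall a, f a ord0 = (a == ord0)%:R.
  by move=> h a; rewrite -(bcol f 1) ?sidx_ord0 // h (bE _ ord0) ?sidx_ord0.
have col1 (f : 'M[R]_k.+2) : f *m basis R k.+2 (- 1) = basis R k.+2 (- 1) ->
    forall a, f a ord_max = (a == ord_max)%:R.
  by move=> h a; rewrite -(bcol f (- 1)) ?sidx_ord_max // h (bE _ ord_max) ?sidx_ord_max.
have rowend e b i : e = 1 \/ e = - 1 -> sidx b = - e ->
    g *m basis R k.+2 e = basis R k.+2 e -> b != mid i -> g b (mid i) = 0.
  move=> he hb hg bi; pose x : 'cV[R]_k.+2 := delta_mx (mid i) 0.
  have := gq (x + basis R k.+2 e); rewrite mulmxDr hg !qform_add_basis // gq.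
  move/addrI; rewrite -hb !coord_sidx /x -colE !mxE => ->.
  by rewrite (negbTE bi).
have gz0 i : g ord0 (mid i) = 0.
  by apply: (rowend (- 1)); [right | rewrite opprK sidx_ord0 | exact: gN1 | ].
have gz1 i : g ord_max (mid i) = 0.
  apply: (rowend 1); [by left | exact: sidx_ord_max | exact: g1 |].
  by rewrite eq_sym mid_max.
have g'1 : g' *m basis R k.+2 1 = basis R k.+2 1 by rewrite -{1}g1 mulmxA g'g mul1mx.
have g'N1 : g' *m basis R k.+2 (- 1) = basis R k.+2 (- 1).
  by rewrite -{1}gN1 mulmxA g'g mul1mx.
pose H (f : 'M[R]_k.+2) : 'M[R]_k := \matrix_(i, j) f (mid i) (mid j).
have midN0 i : (mid i == ord0) = false by [].
have midI : injective mid by move=> i j /(congr1 val) [] h; apply: val_inj.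
have HM (f f' : 'M[R]_k.+2) : f *m basis R k.+2 1 = basis R k.+2 1 ->
    f *m basis R k.+2 (- 1) = basis R k.+2 (- 1) -> f *m f' = 1%:M -> H f *m H f' = 1%:M.
  move=> f1 fN1 ff'; apply/matrixP => i j; rewrite mxE.
  have := congr1 (fun M : 'M[R]_k.+2 => M (mid i) (mid j)) ff'.
  rewrite !mxE big_mid (col0 f) // (col1 f) // midN0 mid_max !mul0r add0r addr0.
  rewrite (inj_eq midI) => <-; by apply: eq_bigr => l _; rewrite !mxE.
exists (H g); split; last first.
  by apply: emb2E => //; [exact: col0 | exact: col1 | move=> i j; rewrite mxE].
split; first by exists (H g'); split; apply: HM.
move=> x; pose X : 'cV[R]_k.+2 := \col_a \sum_i (a == mid i)%:R * x i 0.
have X0 : X ord0 0 = 0.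
  by rewrite mxE big1 // => i _; rewrite eq_sym midN0 mul0r.
have X1 : X ord_max 0 = 0.
  by rewrite mxE big1 // => i _; rewrite eq_sym mid_max mul0r.
have Xm i : X (mid i) 0 = x i 0.
  rewrite mxE (bigD1 i) //= eqxx mul1r big1 ?addr0 // => j hj.
  by rewrite (inj_eq midI) eq_sym (negbTE hj) mul0r.
rewrite -(qform_mid X0 X1 Xm) -gq; apply/esym/qform_mid.
- rewrite mxE big_mid X0 X1 !mulr0 add0r addr0 big1 // => i _.
  by rewrite gz0 mul0r.
- rewrite mxE big_mid X0 X1 !mulr0 add0r addr0 big1 // => i _.
  by rewrite gz1 mul0r.
- move=> i; rewrite !mxE big_mid X0 X1 !mulr0 add0r addr0.
  by apply: eq_bigr => j _; rewrite Xm mxE.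
Qed.

End MiddleSubgroup.

(** The last summand pays for [clear_dual]; the rest is the bound of [reduce_unimodular]. *)
Definition total_cost (o : bool) (r d : nat) : nat :=
  2 * (r.-1 * r.-1) + (r.-1 + (d.+1 * step_cost o r + (r.-1 +
    (2 * (r.-1 * r.-1) + (r.-1 + (2 * r - 2 + o)))))) + (2 * r - 2 + o).

Lemma reduce_orthogonal (C : comNzRingType) D n m (g : 'M[{mpoly C[n]}]_m) :
  noetherian C -> krull_dim_eq C D -> (2 < m./2)%N -> (D.+2 <= m./2)%N -> is_orth g ->
  exists h, EO_le (total_cost (odd m) m./2 (D + n)) h /\ in_mid_subgroup (h *m g).
Proof.
move=> HC hdim; have hD : dim_le C D by move=> P; apply: krull_dim_height.
have [HA hA hcon] := mpoly_contractible n HC hD.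
move: g; case: m => [|[|k]] // g m3 hDm hg; set m := k.+2.
have m0 : (0 < m./2)%N by apply: leq_trans m3.
have v1 : valid m./2 1 by rewrite /valid.
have vN1 : valid m./2 (- 1) by rewrite /valid.
have hgood := good_column m0 hg.
have hred := reduce_unimodular HC hD HA hA hcon m3 hDm hgood.
have [h1 [h1E h1v]] := reach_matrix erefl hred.
have h1b : h1 *m g *m basis {mpoly C[n]} m 1 = basis {mpoly C[n]} m 1.
  apply: coord_inj => l; rewrite -mulmxA h1v /unit1 coord_basis //.
have hg1 := orth_mul (orth_EO h1E) hg.
pose v := h1 *m g *m basis {mpoly C[n]} m (- 1).
have polar : coord v (- 1) = 1.
  have := (proj2 hg1) (basis {mpoly C[n]} m (- 1) + basis {mpoly C[n]} m 1).
  rewrite mulmxDr h1b -/v !qform_add_basis; [|by left..].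
  by rewrite (proj2 hg1) => /addrI ->; rewrite coord_basis.
have [|h2 [h2E h2b h2v1 h2v2 _]] := @clear_dual {mpoly C[n]} m (others (odd m) m./2) v m0 _ polar.
  by move=> j; rewrite mem_others.
exists (h2 *m h1); split.
  rewrite /total_cost addnC; apply: EO_le_mul h1E; move: h2E.
  by rewrite size_others.
have h2O := orth_EO h2E.
rewrite -mulmxA; apply: mid_subgroup; first exact: orth_mul.
  by rewrite -mulmxA h1b h2b.
rewrite -mulmxA -/v; apply: coord_inj => l; rewrite coord_basis //.
case: (eqVneq l (- 1)) => [->|lN1]; first by rewrite h2v1.
case: (eqVneq l 1) => [->|l1]; last first.
  case: (boolP (l \in others (odd m) m./2)) => [/h2v2 //|].
  by rewrite mem_others l1 lN1 !andbT => hl; apply: coord_out.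
(* The image of e_{-1} is isotropic with coordinate 1 at -1 and zeros elsewhere, so its coordinate 1
   vanishes. *)
have hq : qform (h2 *m v) = 0.
  rewrite (proj2 h2O) (proj2 hg1) qform_coord /qf !coord_basis // expr0n add0r.
  apply: big1 => i _; rewrite !coord_basis //.
  have -> : ((i.+1)%:Z == - 1) = false by apply/negbTE; lia.
  by rewrite mul0r.
have [c hc] := qf_split (coord (h2 *m v)) v1.
have := hc (coord (h2 *m v)) (fun _ _ _ => erefl).
rewrite -qform_coord hq h2v1 mulr1.
have := hc (fun=> 0); rewrite mulr0 addr0 /qf expr0n add0r big1; last first.
  by move=> i _; rewrite mulr0.
move=> <-; first by rewrite add0r => <-.
move=> j j1 jN1; apply/esym; case: (boolP (j \in others (odd m) m./2)) => [/h2v2 //|].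
by rewrite mem_others j1 jN1 !andbT => hl; apply: coord_out.
Qed.

(** Of the D + n + 1 homotopy steps, n are charged to n M and D + 1 to (n D + 1) W. All remaining
    transvections fit into (s - 1) W, because s = r(r-1)/2 is at least r. *)
Lemma total_cost_le (o : bool) r D n M W : (1 <= n)%N -> (3 <= r)%N -> (D + 2 <= r)%N ->
  (8 * r - 7 + 2 * o <= M)%N -> (8 * r - 2 <= W)%N ->
  (total_cost o r (D + n) <= n * M + (n * D + r * (r - 1) %/ 2) * W)%N.
Proof.
move=> hn hr hD hM hW; set s := (r * (r - 1) %/ 2)%N; set X := (8 * r - 7 + 2 * o)%N.
have hs : (r <= s)%N by rewrite /s leq_divRL // leq_mul2l; apply/orP; right; move: hr; case: (r) => //; lia.
have e1 : (n * X <= n * M)%N by rewrite leq_mul2l hM orbT.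
have hXW : (X <= W)%N by apply: leq_trans hW; rewrite /X; case: (o) => /=; lia.
have e2 : ((D + 1) * X <= (n * D + 1) * W)%N by apply: leq_mul => //; nia.
have e3 : ((r - 1) * (8 * r - 2) <= (s - 1) * W)%N by apply: leq_mul => //; lia.
have e4 : ((n * D + s) * W = (n * D + 1) * W + (s - 1) * W)%N.
  by rewrite -mulnDl; congr (_ * _)%N; lia.
have e5 : ((D + n).+1 * X = n * X + (D + 1) * X)%N by nia.
have e6 : (4 * (r.-1 * r.-1) + 3 * r.-1 + 2 * (2 * r - 2 + o) <= (r - 1) * (8 * r - 2))%N.
  by case: (r) hr => // p hp; case: (o) => /=; nia.
rewrite /total_cost /step_cost -/X e5 e4; lia.
Qed.

Theorem theorem1 (C : comNzRingType) (D n r : nat) :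
  noetherian C -> krull_dim_eq C D ->
  (1 <= n)%N -> (maxn 3 (D + 2) <= r)%N ->
  (let N := (n * (11 * r - 7)
             + (n * D + r * (r - 1) %/ 2)
               * (r * (r - 1) %/ 2 + uphalf (r - 1) + 8 * r - 2)
             + 10 * r - 10)%N in
   forall g : 'M[{mpoly C[n]}]_(r.*2),
     is_orth g ->
     exists h : 'M[{mpoly C[n]}]_(r.*2),
       EO_le N h /\ in_mid_subgroup (h *m g))
  /\
  (let N := (n * (12 * r - 8)
             + (n * D + r * (r - 1) %/ 2)
               * (r * (r - 1) %/ 2 + uphalf (r - 1) + 9 * r - 2)
             + 11 * r - 9)%N in
   forall g : 'M[{mpoly C[n]}]_(r.*2.+1),
     is_orth g ->
     exists h : 'M[{mpoly C[n]}]_(r.*2.+1),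
       EO_le N h /\ in_mid_subgroup (h *m g)).

Proof.
move=> HC hdim hn; rewrite geq_max => /andP [hr hD].
have hD2 : (D.+2 <= r)%N by rewrite -addn2.
split=> [N g hg|N g hg].
  have := @reduce_orthogonal C D n r.*2 g HC hdim; rewrite doubleK odd_double.
  move=> /(_ hr hD2 hg) [h [h1 h2]]; exists h; split=> //.
  apply: EO_le_leq h1; rewrite /N.
  apply: leq_trans (@total_cost_le false r D n (11 * r - 7)
    (r * (r - 1) %/ 2 + uphalf (r - 1) + 8 * r - 2) hn hr hD _ _) _.
  - by lia.
  - by move: (_ %/ 2)%N (uphalf _) => s u; lia.
  (* The truncated subtraction in [N] applies to the whole sum; it is regrouped as the bound plus 10
     r - 10. *)
  by rewrite -addnBA ?leq_addr //; lia.
have := @reduce_orthogonal C D n r.*2.+1 g HC hdim.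
rewrite /= uphalf_double odd_double => /(_ hr hD2 hg) [h [h1 h2]]; exists h; split=> //.
apply: EO_le_leq h1; rewrite /N.
apply: leq_trans (@total_cost_le true r D n (12 * r - 8)
  (r * (r - 1) %/ 2 + uphalf (r - 1) + 9 * r - 2) hn hr hD _ _) _.
  - by lia.
  - by move: (_ %/ 2)%N (uphalf _) => s u; lia.
by rewrite -addnBA ?leq_addr //; lia.
Qed.
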